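(* Let $(g,A)$ be a Weyl geometry on a 4-dimensional real oriented manifold $\mathcal M$ and let $\Lambda,F,F',E'$ be the canonical 1-forms on the associated twistor bundle $\mathcal{PP}'$. 1) The equation $dE'\wedge\Lambda\wedge F'\wedge E'=0$ is satisfied everywhere on $\mathcal{PP}'$ if and only if the Weyl geometry $(g,A)$ on $\mathcal M$ is self-dual. 2) The equation $dE'\wedge\Lambda\wedge F\wedge E'=0$ is satisfied everywhere on $\mathcal{PP}'$ if and only if the Weyl geometry $(g,A)$ satisfies the Einstein-Weyl equations on $\mathcal M$.
   Context: Weyl geometry. A metric on $\mathcal M$ is a nondegenerate symmetric bilinear complex-valued form. A Weyl geometry $(g,A)$ consists of a metric $g$ and a complex-valued 1-form $A$. In a coframe $(\theta^i)$ of complex-valued 1-forms, $g=g_{ij}\theta^i\theta^j$, the Weyl connection 1-forms $\Gamma^i_{\ j}$ are uniquely determined by $dg_{ij}-g_{ik}\Gamma^k_{\ j}-g_{jk}\Gamma^k_{\ i}=-A\,g_{ij}$ and $d\theta^i=-\Gamma^i_{\ j}\wedge\theta^j$. Curvature: $\frac12R_{ijkl}\theta^k\wedge\theta^l=g_{ih}(d\Gamma^h_{\ j}+\Gamma^h_{\ k}\wedge\Gamma^k_{\ j})$, $R_{jl}=g^{ik}R_{ijkl}$, $R=g^{ij}R_{ij}$, $S_{ij}=R_{(ij)}-\frac14Rg_{ij}$. The Einstein-Weyl equations are $S_{ij}=0$. Let $w_{ijkl}$ be the Weyl tensor of the Levi-Civita connection of $g$ and $w_{ij}=\frac12w_{ijkl}\theta^k\wedge\theta^l$.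 A null cotetrad is a coframe $(\theta^1,\dots,\theta^4)=(M,P,N,K)$ with $g=MP-NK$, where $\alpha\beta=\frac12(\alpha\otimes\beta+\beta\otimes\alpha)$, and compatible with the orientation in the sense that the volume form is $\eta=M\wedge P\wedge N\wedge K$. The dual frame is $(m,p,n,k)$. Self-dual 2-forms are spanned by $P\wedge K,\ N\wedge K-M\wedge P,\ N\wedge M$; anti-self-dual ones by $M\wedge K,\ N\wedge K+M\wedge P,\ N\wedge P$. $(g,A)$ is anti-self-dual (self-dual) if all 2-forms $w_{ij}$ are anti-self-dual (self-dual) on $\mathcal M$. Twistor bundle. Totally null 2-planes of $T_x\mathcal M^{\mathbb C}$ form two disjoint 2-spheres: self-dual ones $s=\mathrm{Span}\{zm-k,zn-p\}$ and anti-self-dual ones $s'=\mathrm{Span}\{z'p-k,z'n-m\}$, with $z,z'\in\mathbb C\cup\{\infty\}$. $\mathcal P$ (resp. $\mathcal P'$) is the $S^2$-bundle over $\mathcal M$ of all self-dual (resp. anti-self-dual) such planes, and $\mathcal{PP}'$ is their fibre product (real dimension 8), with local coordinates $(x,z,\bar z,z',\bar z')$. On $\mathcal{PP}'$ (pullbacks not written) $$E'=dz'-\Gamma^3_{\ 1}+z'(\Gamma^2_{\ 2}-\Gamma^4_{\ 4})+z'^2\Gamma^1_{\ 3},\quad \Lambda=-N-zz'K-zP-z'M,\quad F=M+zK,\quad F'=P+z'K.$$ Intrinsically $E'$ and $\Lambda$ are defined up to multiplication by nonvanishing functions, $F$ up to $F\to\alpha F+\beta\Lambda$ and $F'$ up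 to $F'\to\alpha^{-1}F'+\gamma\Lambda$, $\alpha\neq0$; the equations do not depend on these choices. Standing assumption: $\mathcal M$ is such that $E'$ can be chosen globally (e.g. an open subset of $\mathbb R^4$). *)

(* Defs.v *)
From HB Require Import structures.
From mathcomp Require Import all_boot all_order all_algebra all_fingroup.
From mathcomp Require Import all_classical all_reals all_analysis.
From mathcomp Require Import complex.
Import Order.TTheory GRing.Theory Num.Theory numFieldNormedType.Exports.

Set Implicit Arguments.
Unset Strict Implicit.
Unset Printing Implicit Defensive.

Local Open Scope classical_set_scope.
Local Open Scope ring_scope.
Local Open Scope complex_scope.

Section Calculus.
Variable R : realType.

Definition dirE n (i : 'I_n) : 'rV[R]_n := delta_mx 0 i.

Fixpoint Ck n (k : nat) (U : set 'rV[R]_n) (f : 'rV[R]_n -> R) : Prop :=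
  (forall x, U x -> {for x, continuous f}) /\
  match k with
  | 0 => True
  | k'.+1 => forall i : 'I_n,
      (forall x, U x -> derivable f x (dirE i)) /\
      Ck k' U (fun x => 'D_(dirE i) f x)
  end.

Definition smooth n (U : set 'rV[R]_n) (f : 'rV[R]_n -> R) : Prop :=
  forall k, Ck k U f.

Definition csmooth n (U : set 'rV[R]_n) (f : 'rV[R]_n -> R[i]) : Prop :=
  smooth U (fun x => complex.Re (f x)) /\ smooth U (fun x => complex.Im (f x)).

Definition cpartial n (i : 'I_n) (f : 'rV[R]_n -> R[i]) (x : 'rV[R]_n) : R[i] :=
  'D_(dirE i) (fun y => complex.Re (f y)) x
  +i* 'D_(dirE i) (fun y => complex.Im (f y)) x.

(* Complex-valued covariant k-tensor fields on R^n, given by their components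
   T x v = T_x(e_(v 0), ..., e_(v (k-1))) in the standard basis.
   Differential k-forms are represented by their (alternating) components. *)
Definition tensor n k := 'rV[R]_n -> ('I_k -> 'I_n) -> R[i].

Definition smooth_tensor n k (U : set 'rV[R]_n) (T : tensor n k) : Prop :=
  forall v, csmooth U (fun x => T x v).

Definition alternating n k (U : set 'rV[R]_n) (w : tensor n k) : Prop :=
  forall x, U x -> forall v (s : 'S_k), w x (v \o s) = (-1) ^+ s * w x v.

(* 'J f x i j is the partial derivative of the j-th component along e_i *)
Definition pullback m n k (f : 'rV[R]_m -> 'rV[R]_n) (T : tensor n k) :
    tensor m k :=
  fun x v => \sum_(w : {ffun 'I_k -> 'I_n})
    T (f x) w * \prod_(i < k) (('J f x) (v i) (w i))%:C.

Definition form0 n (f : 'rV[R]_n -> R[i]) : tensor n 0 := fun x _ => f x.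

(* normalised so that (a /\ b)_(ij) = a_i b_j - a_j b_i for 1-forms *)
Definition wedge n k l (a : tensor n k) (b : tensor n l) : tensor n (k + l) :=
  fun x v => ((k`! * l`!)%N%:R)^-1 * \sum_(s : 'S_(k + l))
    (-1) ^+ s * a x (fun i => v (s (lshift l i)))
              * b x (fun j => v (s (rshift k j))).

Definition ext_d n k (w : tensor n k) : tensor n k.+1 :=
  fun x v => \sum_(j < k.+1)
    (-1) ^+ j * cpartial (v j) (fun y => w y (fun i => v (lift j i))) x.

Definition fadd n k (a b : tensor n k) : tensor n k := fun x v => a x v + b x v.
Definition fopp n k (a : tensor n k) : tensor n k := fun x v => - a x v.
Definition fmul n k (f : 'rV[R]_n -> R[i]) (a : tensor n k) : tensor n k :=
  fun x v => f x * a x v.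

Definition pair_idx n (a b : 'I_n) : 'I_2 -> 'I_n :=
  fun i => if val i == 0%N then a else b.

End Calculus.

Declare Scope form_field_scope.
Delimit Scope form_field_scope with ff.
Bind Scope form_field_scope with tensor.
Notation "a + b" := (fadd a b) : form_field_scope.
Notation "- a" := (fopp a) : form_field_scope.
Notation "a - b" := (fadd a (fopp b)) : form_field_scope.
Notation "f *^ a" := (fmul f%R a)
  (at level 40, left associativity) : form_field_scope.
Notation "a /^\ b" := (wedge a b)
  (at level 39, left associativity) : form_field_scope.

Section Manifold.
Variable R : realType.

(* Smooth oriented manifold: Hausdorff, second countable, with a smooth atlas
   whose transition maps have positive Jacobian determinant.
   chart_pt a is the inverse of the coordinate map chart_co a. *)
Record oriented_manifold (n : nat) := OrientedManifold {
  carrier :> topologicalType;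
  carrier_hausdorff : hausdorff_space carrier;
  carrier_second_countable : @second_countable carrier;
  chart : Type;
  chart_dom : chart -> set carrier;
  chart_co : chart -> carrier -> 'rV[R]_n;
  chart_pt : chart -> 'rV[R]_n -> carrier;
  chart_img := fun a => chart_co a @` chart_dom a;
  overlap := fun a b => chart_co a @` (chart_dom a `&` chart_dom b);
  transition := fun a b => chart_co b \o chart_pt a;
  chart_cover : forall p, exists a, chart_dom a p;
  chart_dom_open : forall a, open (chart_dom a);
  chart_img_open : forall a, open (chart_img a);
  chart_coK : forall a p, chart_dom a p -> chart_pt a (chart_co a p) = p;
  chart_co_continuous : forall a p, chart_dom a p ->
        {for p, continuous (chart_co a)};
  chart_pt_continuous : forall a x, chart_img a x ->
        {for x, continuous (chart_pt a)};
  transition_smooth : forall a b (j : 'I_n),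
        smooth (overlap a b) (fun x => transition a b x 0 j);
  transition_oriented : forall a b x, overlap a b x ->
        0 < \det ('J (transition a b) x)
}.

(* A tensor field on X: its smooth components in every chart, related on
   overlaps by the tensor transformation law. *)
Definition tensor_field n (X : oriented_manifold n) k
    (T : chart X -> tensor R n k) : Prop :=
  (forall a, smooth_tensor (chart_img a) (T a)) /\
  (forall a b x, overlap a b x ->
     forall v, T a x v = pullback (transition a b) (T b) x v).

Definition tensor2_mx n (g : tensor R n 2) (x : 'rV[R]_n) : 'M[R[i]]_n :=
  \matrix_(a, b) g x (pair_idx a b).

Record weyl_geometry (X : oriented_manifold 4) := WeylGeometry {
  metric : chart X -> tensor R 4 2;
  weyl_form : chart X -> tensor R 4 1;
  metric_field : tensor_field metric;
  metric_sym : forall a x, chart_img a x ->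
        (tensor2_mx (metric a) x)^T = tensor2_mx (metric a) x;
  metric_nondeg : forall a x, chart_img a x ->
        \det (tensor2_mx (metric a) x) != 0;
  weyl_form_field : tensor_field weyl_form
}.

(* The metric is complex-valued, so the square root of \det g has to be chosen:
   a volume form is a global smooth choice of one of the two 4-forms
   +-4 (\det g)^(1/2) dx^1 /\ dx^2 /\ dx^3 /\ dx^4.  The factor 16 makes
   M /\ P /\ N /\ K, with g = MP - NK, such a form. *)
Definition volume_form (X : oriented_manifold 4) (W : weyl_geometry X)
    (eta : chart X -> tensor R 4 4) : Prop :=
  [/\ tensor_field eta,
      forall a, alternating (chart_img a) (eta a)
    & forall a x, chart_img a x ->
        (eta a x id) ^+ 2 = 16%:R * \det (tensor2_mx (metric W a) x)].

End Manifold.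

Section LocalGeometry.
Variable R : realType.
Local Notation C := R[i].
Local Notation form k := (tensor R 4 k).

(* (th^1, ..., th^4) = (M, P, N, K), with the indices shifted to 0, ..., 3:
   Gamma^3_1 is Gam iN iM, etc. *)
Definition iM : 'I_4 := @Ordinal 4 0 isT.
Definition iP : 'I_4 := @Ordinal 4 1 isT.
Definition iN : 'I_4 := @Ordinal 4 2 isT.
Definition iK : 'I_4 := @Ordinal 4 3 isT.

Definition coframe_mx (th : 'I_4 -> form 1) (x : 'rV[R]_4) : 'M[C]_4 :=
  \matrix_(i, a) th i x (fun _ => a).

Definition coframe (V : set 'rV[R]_4) (th : 'I_4 -> form 1) : Prop :=
  [/\ open V, forall i, smooth_tensor V (th i)
    & forall x, V x -> \det (coframe_mx th x) != 0].

(* the j-th column is the j-th vector of the dual frame *)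
Definition frame_mx (th : 'I_4 -> form 1) (x : 'rV[R]_4) : 'M[C]_4 :=
  invmx (coframe_mx th x).

Definition frame_vec (th : 'I_4 -> form 1) (x : 'rV[R]_4) (j : 'I_4) :
    'rV[C]_4 := (col j (frame_mx th x))^T.

(* g_ij with g = g_ij th^i th^j *)
Definition gdown (g : form 2) (th : 'I_4 -> form 1) (x : 'rV[R]_4) : 'M[C]_4 :=
  (frame_mx th x)^T *m tensor2_mx g x *m frame_mx th x.

Definition gup (g : form 2) (th : 'I_4 -> form 1) (x : 'rV[R]_4) : 'M[C]_4 :=
  invmx (gdown g th x).

(* Gam i j is Gamma^i_j *)
Definition weyl_connection (V : set 'rV[R]_4) (g : form 2) (A : form 1)
    (th : 'I_4 -> form 1) (Gam : 'I_4 -> 'I_4 -> form 1) : Prop :=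
  [/\ forall i j, smooth_tensor V (Gam i j),
      forall i j x, V x -> forall v,
        ext_d (form0 (fun y => gdown g th y i j)) x v
        - \sum_k gdown g th x i k * Gam k j x v
        - \sum_k gdown g th x j k * Gam k i x v
        = - (A x v * gdown g th x i j)
    & forall i x, V x -> forall v,
        ext_d (th i) x v = - \sum_j (Gam i j /^\ th j)%ff x v].

Definition levi_civita (V : set 'rV[R]_4) (g : form 2)
    (th : 'I_4 -> form 1) (Gam : 'I_4 -> 'I_4 -> form 1) : Prop :=
  weyl_connection V g (fun _ _ => 0) th Gam.

Section Curvature.
Variables (g : form 2) (th : 'I_4 -> form 1) (Gam : 'I_4 -> 'I_4 -> form 1).
Variable x : 'rV[R]_4.

Definition curv_form (h j : 'I_4) : form 2 := fun y v =>
  ext_d (Gam h j) y v + \sum_k (Gam h k /^\ Gam k j)%ff y v.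

(* R_ijkl is the value of the 2-form g_ih Omega^h_j on the frame vectors
   (e_k, e_l), i.e. its coefficient in (1/2) R_ijkl th^k /\ th^l. *)
Definition riem (i j k l : 'I_4) : C :=
  \sum_a \sum_b
    (\sum_h gdown g th x i h * curv_form h j x (pair_idx a b))
    * frame_mx th x a k * frame_mx th x b l.

Definition ricci (j l : 'I_4) : C :=
  \sum_i \sum_k gup g th x i k * riem i j k l.

Definition scalar_curv : C := \sum_i \sum_j gup g th x i j * ricci i j.

Definition S_tensor (i j : 'I_4) : C :=
  (ricci i j + ricci j i) / 2%:R - scalar_curv / 4%:R * gdown g th x i j.

(* For a Levi-Civita connection Gam, w_ijkl: the totally trace-free part of
   R_ijkl in dimension 4. *)
Definition weyl_tensor (i j k l : 'I_4) : C :=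
  let G := gdown g th x in
  riem i j k l
  - (G i k * ricci j l - G i l * ricci j k
     - G j k * ricci i l + G j l * ricci i k) / 2%:R
  + scalar_curv / 6%:R * (G i k * G j l - G i l * G j k).

Definition weyl_2form (i j : 'I_4) (v : 'I_2 -> 'I_4) : C :=
  2%:R^-1 * \sum_k \sum_l weyl_tensor i j k l * (th k /^\ th l)%ff x v.

End Curvature.

(* g = MP - NK with alpha beta = (alpha (x) beta + beta (x) alpha) / 2, and
   M /\ P /\ N /\ K is the given volume form *)
Definition null_cotetrad (V : set 'rV[R]_4) (g : form 2) (eta : form 4)
    (th : 'I_4 -> form 1) : Prop :=
  [/\ coframe V th,
      forall x, V x -> forall v,
        let s (i j : 'I_4) : C :=
          (th i x (fun _ => v ord0) * th j x (fun _ => v ord_max)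
           + th j x (fun _ => v ord0) * th i x (fun _ => v ord_max)) / 2%:R in
        g x v = s iM iP - s iN iK
    & forall x, V x -> forall v,
        eta x v = (th iM /^\ th iP /^\ th iN /^\ th iK)%ff x v].

Definition self_dual_2form (th : 'I_4 -> form 1) (x : 'rV[R]_4)
    (w : ('I_2 -> 'I_4) -> C) : Prop :=
  let M := th iM in let P := th iP in let N := th iN in let K := th iK in
  exists c1 c2 c3 : C, forall v,
    w v = c1 * (P /^\ K)%ff x v
        + c2 * (N /^\ K - M /^\ P)%ff x v
        + c3 * (N /^\ M)%ff x v.

(* Span {zm - k, zn - p} and Span {z'p - k, z'n - m} as row spaces in the
   complexified tangent space; None is the value infinity of z, z'. *)
Definition sd_plane (th : 'I_4 -> form 1) (x : 'rV[R]_4) (z : option C) :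
    'M[C]_(1 + 1, 4) :=
  let e := frame_vec th x in
  match z with
  | Some z => col_mx (z *: e iM - e iK) (z *: e iN - e iP)
  | None => col_mx (e iM) (e iN)
  end.

Definition asd_plane (th : 'I_4 -> form 1) (x : 'rV[R]_4) (z' : option C) :
    'M[C]_(1 + 1, 4) :=
  let e := frame_vec th x in
  match z' with
  | Some z' => col_mx (z' *: e iP - e iK) (z' *: e iN - e iM)
  | None => col_mx (e iP) (e iN)
  end.

End LocalGeometry.

Section TwistorForms.
Variable R : realType.
Local Notation C := R[i].

(* Local coordinates of PP': y = (x, Re z, Im z, Re z', Im z'). *)
Definition PPcoords (x : 'rV[R]_4) (z z' : C) : 'rV[R]_(4 + 4) :=
  row_mx x (\row_(j < 4)
    [:: complex.Re z; complex.Im z; complex.Re z'; complex.Im z']`_j).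

Definition base_pt (y : 'rV[R]_(4 + 4)) : 'rV[R]_4 := lsubmx y.
Definition zfun (y : 'rV[R]_(4 + 4)) : C :=
  rsubmx y 0 (@Ordinal 4 0 isT) +i* rsubmx y 0 (@Ordinal 4 1 isT).
Definition z'fun (y : 'rV[R]_(4 + 4)) : C :=
  rsubmx y 0 (@Ordinal 4 2 isT) +i* rsubmx y 0 (@Ordinal 4 3 isT).

Variable th : 'I_4 -> tensor R 4 1.
Variable Gam : 'I_4 -> 'I_4 -> tensor R 4 1.

Local Notation pb w := (pullback base_pt w).
Local Notation z := zfun.
Local Notation z' := z'fun.
Local Notation M := (pb (th iM)).
Local Notation P := (pb (th iP)).
Local Notation N := (pb (th iN)).
Local Notation K := (pb (th iK)).

Definition form_E' : tensor R (4 + 4) 1 :=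
  (ext_d (form0 z') - pb (Gam iN iM) + z' *^ (pb (Gam iP iP) - pb (Gam iK iK))
   + (fun y => z' y ^+ 2) *^ pb (Gam iM iN))%ff.

Definition form_Lambda : tensor R (4 + 4) 1 :=
  (- N - (fun y => z y * z' y) *^ K - z *^ P - z' *^ M)%ff.

Definition form_F : tensor R (4 + 4) 1 := (M + z *^ K)%ff.

Definition form_F' : tensor R (4 + 4) 1 := (P + z' *^ K)%ff.

Definition dE'_Lambda_F'_E' : tensor R (4 + 4) 5 :=
  (ext_d form_E' /^\ form_Lambda /^\ form_F' /^\ form_E')%ff.

Definition dE'_Lambda_F_E' : tensor R (4 + 4) 5 :=
  (ext_d form_E' /^\ form_Lambda /^\ form_F /^\ form_E')%ff.

End TwistorForms.

Section GlobalNotions.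
Variables (R : realType) (X : oriented_manifold R 4) (W : weyl_geometry X).
Variable eta : chart X -> tensor R 4 4.
Local Notation C := R[i].

Definition coframe_on (a : chart X) (V : set 'rV[R]_4)
    (th : 'I_4 -> tensor R 4 1) : Prop :=
  V `<=` chart_img a /\ coframe V th.

Definition null_cotetrad_on (a : chart X) (V : set 'rV[R]_4)
    (th : 'I_4 -> tensor R 4 1) : Prop :=
  V `<=` chart_img a /\ null_cotetrad V (metric W a) (eta a) th.

Definition einstein_weyl : Prop :=
  forall (a : chart X) V th Gam, coframe_on a V th ->
    weyl_connection V (metric W a) (weyl_form W a) th Gam ->
    forall x, V x -> forall i j, S_tensor (metric W a) th Gam x i j = 0.

Definition self_dual : Prop :=
  forall (a : chart X) V th Gam, null_cotetrad_on a V th ->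
    levi_civita V (metric W a) th Gam ->
    forall x, V x -> forall i j,
      self_dual_2form th x (weyl_2form (metric W a) th Gam x i j).

(* A point of PP' over the point of X with coordinates x in the chart a. *)
Definition PP_point (a : chart X) (x : 'rV[R]_4) (s s' : 'M[C]_(1 + 1, 4)) :
    Prop :=
  exists V th z z', [/\ null_cotetrad_on a V th, V x,
    (s == sd_plane th x z)%MS & (s' == asd_plane th x z')%MS].

(* A form on PP', given by its expression in the coordinates (x, z, z')
   attached to a local null cotetrad, vanishes at every point (s, s') of PP'.
   The points with z or z' infinite are included: they have finite coordinates
   with respect to another null cotetrad, e.g. (K, -N, P, -M) has
   z replaced by -1/z, and (-N, K, M, -P) has z' replaced by -1/z'. *)
Definition vanishes_on_PP
    (Psi : ('I_4 -> tensor R 4 1) -> ('I_4 -> 'I_4 -> tensor R 4 1) ->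
           tensor R (4 + 4) 5) : Prop :=
  forall (a : chart X) x s s', PP_point a x s s' ->
  forall V th Gam z z', null_cotetrad_on a V th -> V x ->
    weyl_connection V (metric W a) (weyl_form W a) th Gam ->
    (s == sd_plane th x (Some z))%MS -> (s' == asd_plane th x (Some z'))%MS ->
    forall v, Psi th Gam (PPcoords x z z') v = 0.

End GlobalNotions.

(* Main.v *)
(* Modulo [E'], the 2-form [dE'] is pulled back from the base: it is
   [Theta = - Omega^3_1 + z' (Omega^2_2 - Omega^4_4) + z'^2 Omega^1_3].  So the two
   equations say that [Theta /\ Lambda /\ F'], respectively [Theta /\ Lambda /\ F],
   vanishes on the base for all [z] and [z'], and both are polynomials in [z, z'] whose
   coefficients are linear in the curvature.  By the first Bianchi identity in a null
   frame, the coefficients for [F] are the components of [S_ij], and those for [F'], when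
   the connection is the Levi-Civita one, are the components of the anti-self-dual part of
   the Weyl tensor.  Replacing the Levi-Civita connection by the Weyl connection changes
   [Theta] by [alpha /\ n + kappa /\ q] with [n = N + z' M] and [q = P + z' K]; as
   [Lambda = - (n + z q)] and [F' = q], the product with [Lambda /\ F'] does not change.
   Finally [S_ij] is a tensor and every point has a neighbourhood with a null cotetrad,
   because a symmetric nondegenerate complex matrix function is locally [T^T T] with [T]
   smooth; so it is enough to test [S_ij = 0] on null cotetrads. *)

From mathcomp Require Import all_boot all_order all_algebra all_fingroup.
From mathcomp Require Import all_classical all_reals all_analysis.
From mathcomp Require Import complex ring lra.
Require Import Defs.
Import Order.TTheory GRing.Theory Num.Theory numFieldNormedType.Exports.

Set Implicit Arguments.
Unset Strict Implicit.
Unset Printing Implicit Defensive.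

Local Open Scope classical_set_scope.
Local Open Scope ring_scope.
Local Open Scope complex_scope.

(** * Differentiable functions *)

Section RealCk.
Variables (R : realType) (n : nat).
Implicit Types (U V : set 'rV[R]_n) (f g : 'rV[R]_n -> R).

(** Counting coefficients shows why the two equations carry exactly the stated information. With [F]
    the coefficient has degree two in [z] and degree two in [z'], and its nine coefficients match
    the nine components of a trace-free symmetric tensor in dimension four. With [F'] the variable
    [z] drops out and a quartic in [z'] remains, whose five coefficients match the anti-self-dual
    half of the Weyl tensor. The Levi-Civita connection in part 1 and the connection in a null
    cotetrad in part 2 are obtained from the given connection, by a shift of the Weyl form and by a
    gauge change; so only the structure equations have to be checked for them. The metric is
    complex, so cotetrads come from local smooth square roots rather than from a signature, and the
    orientation is matched by a choice between two square roots of -1. Tensor identities are brought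
    to polynomial form: forms become component functions, connections become one matrix per
    coordinate direction, and the hypotheses enter as explicit linear combinations. *)

Lemma Ck_continuous k U f x : Ck k U f -> U x -> {for x, continuous f}.
Proof. by case: k => [|k] [h _] /h. Qed.

Lemma Ck_sub k U V f : V `<=` U -> Ck k U f -> Ck k V f.
Proof.
move=> VU; elim: k f => [|k IH] f [fc fd]; split=> //.
- by move=> x /VU /fc.
- by move=> x /VU /fc.
- by move=> i; have [df Cf] := fd i; split; [move=> x /VU /df|exact: IH].
Qed.

Lemma CkW k U f : Ck k.+1 U f -> Ck k U f.
Proof.
elim: k f => [|k IH] f [fc fd]; split=> // i.
by have [df Cf] := fd i; split=> //; exact: IH.
Qed.

Lemma near_open U x (P : 'rV[R]_n -> Prop) : open U -> U x ->
  (forall y, U y -> P y) -> \forall y \near x, P y.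
Proof.
by move=> oU Ux UP; apply: (filterS UP); exact: open_nbhs_nbhs (conj oU Ux).
Qed.

Lemma eq_continuous_on U f g x : open U -> U x -> (forall y, U y -> f y = g y) ->
  {for x, continuous f} -> {for x, continuous g}.
Proof.
move=> oU Ux fg fc; have fgx := near_open oU Ux fg.
suff h : g y @[y --> x] --> f x by rewrite /prop_for /continuous_at -(fg _ Ux).
exact: cvg_trans (@near_eq_cvg _ _ (nbhs x) (nbhs_filter x) f g fgx) fc.
Qed.

Lemma Ck_ext k U f g : open U -> (forall x, U x -> f x = g x) ->
  Ck k U f -> Ck k U g.
Proof.
move=> oU; elim: k f g => [|k IH] f g fg [fc fd].
  by split=> // x Ux; apply: (eq_continuous_on oU Ux fg); exact: fc.
split=> [x Ux|i]; first by apply: (eq_continuous_on oU Ux fg); exact: fc.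
have [df Cf] := fd i.
have nfg x : U x -> \forall y \near x, f y = g y by move=> Ux; exact: (near_open oU Ux fg).
split=> [x Ux|].
  by apply: near_eq_derivable (nfg _ Ux) _; exact: df.
apply: IH Cf => x Ux.
exact: near_eq_derive (nfg _ Ux).
Qed.

Lemma Ck_cst k U c : Ck k U (fun=> c).
Proof.
elim: k c => [|k IH] c; split=> //; first by move=> x _; exact: cst_continuous.
  by move=> x _; exact: cst_continuous.
move=> i; split=> [x _|]; first exact: derivable_cst.
have -> : (fun x => 'D_(dirE R i) (fun=> c) x) = (fun=> 0); last exact: IH.
by apply/funext => x; rewrite (_ : (fun _ => c) = cst c) // derive_cst.
Qed.

Lemma CkD k U f g : open U -> Ck k U f -> Ck k U g ->
  Ck k U (fun x => f x + g x).
Proof.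
move=> oU; elim: k f g => [|k IH] f g [fc fd] [gc gd].
  by split=> // x Ux; apply: continuousD; [exact: fc|exact: gc].
split=> [x Ux|i]; first by apply: continuousD; [exact: fc|exact: gc].
have [df Cf] := fd i; have [dg Cg] := gd i; split=> [x Ux|].
  by apply: derivableD; [exact: df|exact: dg].
apply: Ck_ext (IH _ _ Cf Cg) => // x Ux /=.
by rewrite -deriveD //; [exact: df|exact: dg].
Qed.

Lemma CkM k U f g : open U -> Ck k U f -> Ck k U g ->
  Ck k U (fun x => f x * g x).
Proof.
move=> oU; elim: k f g => [|k IH] f g Hf Hg; have [fc fd] := Hf; have [gc gd] := Hg.
  by split=> // x Ux; apply: continuousM; [exact: fc|exact: gc].
split=> [x Ux|i]; first by apply: continuousM; [exact: fc|exact: gc].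
have [df Cf] := fd i; have [dg Cg] := gd i; split=> [x Ux|].
  by apply: derivableM; [exact: df|exact: dg].
apply: Ck_ext (CkD oU (IH _ _ (CkW Hf) Cg) (IH _ _ (CkW Hg) Cf)) => // x Ux /=.
by rewrite -deriveM //; [exact: df|exact: dg].
Qed.

(** The induction closes because the derivative of [1/f] is [- (1/f)^2] times that of [f]: a
    polynomial in [1/f], already of class [k], and a derivative of [f]. *)
Lemma CkV k U f : open U -> (forall x, U x -> f x != 0) -> Ck k U f ->
  Ck k U (fun x => (f x)^-1).
Proof.
move=> oU f0; elim: k => [|k IH] Hf; have [fc fd] := Hf.
  by split=> // x Ux; apply: continuousV; [exact: f0|exact: fc].
split=> [x Ux|i]; first by apply: continuousV; [exact: f0|exact: fc].
have [df Cf] := fd i; split=> [x Ux|].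
  by apply: derivableV; [exact: f0|exact: df].
have Hi := IH (CkW Hf).
apply: Ck_ext (CkM oU (Ck_cst k U (-1)) (CkM oU (CkM oU Hi Hi) Cf)) => // x Ux /=.
rewrite deriveV; [|exact: f0|exact: df].
by rewrite mulN1r -mulNr -invfM -expr2.
Qed.

(** Reduces a directional derivative to one real variable, where the chain rule [derive1_comp]
    applies. *)
Lemma derive_line f (x v : 'rV[R]_n) :
  'D_v f x = 'D_1 (fun t : R => f (t *: v + x)) 0.
Proof.
rewrite /derive; set g1 := fun h => h^-1 *: _; set g2 := fun h => h^-1 *: _.
suff -> : g1 = g2 by []; apply/funext => t; rewrite /g1 /g2 /=.
by rewrite addr0 scale0r add0r [_%:A]mulr1.
Qed.

(** Same induction as for the inverse: the derivative of the root is that of [f] divided by twice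
    the root, which is of class [k] by induction. *)
Lemma Ck_sqrt k U f : open U -> (forall x, U x -> 0 < f x) -> Ck k U f ->
  Ck k U (fun x => Num.sqrt (f x)).
Proof.
move=> oU f0; elim: k => [|k IH] Hf; have [fc fd] := Hf.
  by split=> // x Ux; apply: continuous_comp; [exact: fc|exact: sqrt_continuous].
split=> [x Ux|i].
  by apply: continuous_comp; [exact: fc|exact: sqrt_continuous].
have [df Cf] := fd i.
have dsqrt x : U x -> is_derive x (dirE R i) (fun y => Num.sqrt (f y))
    ((2 * Num.sqrt (f x))^-1 * 'D_(dirE R i) f x).
  move=> Ux; have /derivable1P d1 := df _ Ux.
  have ds : is_derive (f x) 1 (@Num.sqrt R) (2 * Num.sqrt (f x))^-1.
    by apply: is_derive1_sqrt; exact: f0.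
  have fx : f (0 *: dirE R i + x) = f x by rewrite scale0r add0r.
  have dc : derivable (@Num.sqrt R \o (fun h => f (h *: dirE R i + x))) 0 1.
    apply/derivable1_diffP/differentiable_comp; first exact/derivable1_diffP.
    by apply/derivable1_diffP; rewrite fx; case: ds.
  have dd := derive1_comp (f := fun h => f (h *: dirE R i + x)) (g := @Num.sqrt R) d1.
  rewrite fx in dd; have {}dd := dd (@ex_derive _ _ _ _ _ _ _ ds).
  apply: DeriveDef; first exact/derivable1P.
  move: dd; rewrite !derive1E (@derive_val _ _ _ _ _ _ _ ds) => dd.
  by rewrite (derive_line (fun y => Num.sqrt (f y))) (derive_line f) dd.
split=> [x Ux|]; first by case: (dsqrt _ Ux).
have Hs := IH (CkW Hf).
have s0 x : U x -> 2 * Num.sqrt (f x) != 0.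
  by move=> Ux; rewrite mulf_neq0 // sqrtr_eq0 -ltNge f0.
apply: Ck_ext (CkM oU (CkV oU s0 (CkM oU (Ck_cst k U 2) Hs)) Cf) => // x Ux /=.
by have /@derive_val -> := dsqrt _ Ux.
Qed.

End RealCk.

(** * Symmetry of second partial derivatives *)

Section Schwarz.
Variables (R : realType) (n : nat).
Implicit Types (U : set 'rV[R]_n) (f : 'rV[R]_n -> R) (x u v : 'rV[R]_n).

Lemma is_derive_line f u c (s : R) : derivable f (s *: u + c) u ->
  is_derive s 1 (fun t : R => f (t *: u + c)) ('D_u f (s *: u + c)).
Proof.
have E : (fun h : R => h^-1 *: (((fun t : R => f (t *: u + c)) \o shift s) (h *: 1) - f (s *: u + c)))
  = (fun h : R => h^-1 *: ((f \o shift (s *: u + c)) (h *: u) - f (s *: u + c))).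
  apply/funext => h /=; congr (_ *: (f _ - _)).
  by rewrite [h%:A]mulr1 scalerDl addrA.
by move=> df; apply: DeriveDef; rewrite /derivable /derive E.
Qed.

(** The mean value theorem is applied twice: along [u] to the increment [phi] of [f] in the
    direction [v], then along [v] to the derivative of [f] along [u]. *)
Lemma second_difference_MVT f x u v (h : R) : 0 < h ->
  (forall s t, s \in `[0, h] -> t \in `[0, h] ->
     derivable f (x + s *: u + t *: v) u) ->
  (forall s t, s \in `[0, h] -> t \in `[0, h] ->
     derivable ('D_u f) (x + s *: u + t *: v) v) ->
  exists s t, [/\ s \in `[0, h], t \in `[0, h] &
    f (x + h *: u + h *: v) - f (x + h *: u) - f (x + h *: v) + f x
      = h ^+ 2 * 'D_v ('D_u f) (x + s *: u + t *: v)].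
Proof.
move=> h0 du dv.
have I0 : 0 \in `[0, h] by rewrite in_itv /= lexx ltW.
have Ih : h \in `[0, h] by rewrite in_itv /= lexx ltW.
have oc s : s \in `]0, h[ -> s \in `[0, h].
  by rewrite !in_itv /= => /andP[/ltW -> /ltW ->].
pose phi s := f (s *: u + (x + h *: v)) - f (s *: u + x).
have dphi s : s \in `[0, h] ->
    is_derive s 1 phi ('D_u f (s *: u + (x + h *: v)) - 'D_u f (s *: u + x)).
  move=> Is; apply: is_deriveB; apply: is_derive_line.
    by rewrite addrA (addrC _ x); exact: du.
  by have := du _ _ Is I0; rewrite scale0r addr0 addrC.
have cphi : {within `[0, h], continuous phi}.
  apply: derivable_within_continuous => s Is; by case: (dphi _ Is).
have [s Is Es] := MVT_segment (ltW h0) (fun s Is => dphi s (oc s Is)) cphi.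
pose psi t := 'D_u f (t *: v + (x + s *: u)).
have dpsi t : t \in `[0, h] ->
    is_derive t 1 psi ('D_v ('D_u f) (t *: v + (x + s *: u))).
  by move=> It; apply: is_derive_line; rewrite addrC; exact: dv.
have cpsi : {within `[0, h], continuous psi}.
  by apply: derivable_within_continuous => t It; case: (dpsi _ It).
have [t It Et] := MVT_segment (ltW h0) (fun t It => dpsi t (oc t It)) cpsi.
exists s, t; split => //.
have := Es; rewrite /phi scale0r !add0r subr0.
have -> : s *: u + (x + h *: v) = h *: v + (x + s *: u) by rewrite addrCA addrA addrC.
have -> : s *: u + x = 0 *: v + (x + s *: u) by rewrite scale0r add0r addrC.
rewrite -/(psi h) -/(psi 0) Et subr0 => E.
have <- : h *: u + (x + h *: v) = x + h *: u + h *: v by rewrite addrA (addrC _ x).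
have <- : h *: u + x = x + h *: u by rewrite addrC.
have <- : t *: v + (x + s *: u) = x + s *: u + t *: v by rewrite addrC.
by rewrite expr2 mulrC mulrA -E; ring.
Qed.

(** The second difference is symmetric in the two directions, so it computes both mixed derivatives,
    each at some point close to [x]; continuity of both then forces equality at [x]. *)
Lemma schwarz U f x (i j : 'I_n) : open U -> Ck 2 U f -> U x ->
  'D_(dirE R j) ('D_(dirE R i) f) x = 'D_(dirE R i) ('D_(dirE R j) f) x.
Proof.
move=> oU [_ Cf] Ux.
have [di [_ /(_ j) [dij [cij _]]]] := Cf i.
have [dj [_ /(_ i) [dji [cji _]]]] := Cf j.
set a := LHS; set b := RHS.
apply/eqP; rewrite -subr_eq0 -normr_le0; apply/ler_addgt0Pr => e e0; rewrite add0r.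
have e2 : 0 < e / 2 by lra.
have nU : \forall y \near x, U y by exact: (near_open oU Ux).
have na : \forall y \near x, `|a - 'D_(dirE R j) ('D_(dirE R i) f) y| < e / 2.
  by move/cvgrPdist_lt: (cij x Ux); apply.
have nb : \forall y \near x, `|b - 'D_(dirE R i) ('D_(dirE R j) f) y| < e / 2.
  by move/cvgrPdist_lt: (cji x Ux); apply.
have /nbhs_ballP[r r0 rP] : nbhs x [set y | U y /\
    (`|a - 'D_(dirE R j) ('D_(dirE R i) f) y| < e / 2 /\
     `|b - 'D_(dirE R i) ('D_(dirE R j) f) y| < e / 2)].
  exact: filterI nU (filterI na nb).
pose u := dirE R i; pose v := dirE R j.
(* This size keeps the whole parallelogram with sides [h u] and [h v] in the ball of radius [r]: the
   displacement is at most [r / 2], and the summand 1 keeps the denominator positive. *)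
pose h := r / (2 * (`|u| + `|v| + 1)).
have c0 : 0 < `|u| + `|v| + 1 by rewrite ltr_wpDl // addr_ge0.
have h0 : 0 < h by rewrite divr_gt0 // mulr_gt0.
have inr s t : s \in `[0, h] -> t \in `[0, h] -> ball x r (x + s *: u + t *: v).
  rewrite !in_itv /= => /andP[s0 sh] /andP[t0 th].
  rewrite -ball_normE /= -addrA opprD addNKr normrN.
  apply: le_lt_trans (ler_normD _ _) _; rewrite !normrZ !ger0_norm //.
  have : s * `|u| + t * `|v| <= h * (`|u| + `|v| + 1).
    rewrite !mulrDr -[leLHS]addr0 lerD ?lerD ?ler_wpM2r //.
    by rewrite mulr1 ltW.
  move/le_lt_trans; apply; rewrite /h invfM mulrA divfK ?gt_eqF //.
  by rewrite ltr_pdivrMr // ltr_pMr // ltr1n.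
have inr' s t : s \in `[0, h] -> t \in `[0, h] -> ball x r (x + s *: v + t *: u).
  by move=> Is It; rewrite addrAC; exact: inr.
have [||s [t [Is It E1]]] := @second_difference_MVT f x u v h h0.
- by move=> s t Is It; apply: di; case: (rP _ (inr _ _ Is It)).
- by move=> s t Is It; apply: dij; case: (rP _ (inr _ _ Is It)).
have [||s' [t' [Is' It' E2]]] := @second_difference_MVT f x v u h h0.
- by move=> p q Ip Iq; apply: dj; case: (rP _ (inr' _ _ Ip Iq)).
- by move=> p q Ip Iq; apply: dji; case: (rP _ (inr' _ _ Ip Iq)).
have [_ [H1 _]] := rP _ (inr _ _ Is It).
have [_ [_ H2]] := rP _ (inr' _ _ Is' It').
(* Both values, times [h ^+ 2], are the same second difference, so one number lies within [e / 2] of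
   both [a] and [b]. *)
have E : 'D_v ('D_u f) (x + s *: u + t *: v) = 'D_u ('D_v f) (x + s' *: v + t' *: u).
  have h2 : h ^+ 2 != 0 by rewrite expf_neq0 // gt_eqF.
  apply: (mulfI h2); apply: (etrans (esym E1)); apply: etrans E2.
  have -> : x + h *: u + h *: v = x + h *: v + h *: u by exact: addrAC.
  by congr (_ + _); exact: addrAC.
move: H1 H2; rewrite -/u -/v E -/a -/b; move: ('D_u _ _) => c H1 H2.
have -> : a - b = (a - c) - (b - c) by rewrite opprB addrA subrK.
have H := lerD (ltW H1) (ltW H2).
by rewrite -splitr in H; exact: le_trans (ler_normB _ _) H.
Qed.

End Schwarz.

Section PointwiseDerive.
Variables (R : realType) (n : nat).
Implicit Types (f g : 'rV[R]_n -> R) (x v : 'rV[R]_n).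

Lemma derivable_add f g x v : derivable f x v -> derivable g x v ->
  derivable (fun y => f y + g y) x v.
Proof. exact: (@derivableD _ _ _ f g). Qed.

Lemma derivable_mul f g x v : derivable f x v -> derivable g x v ->
  derivable (fun y => f y * g y) x v.
Proof. exact: (@derivableM _ _ f g). Qed.

Lemma derive_add f g x v : derivable f x v -> derivable g x v ->
  'D_v (fun y => f y + g y) x = 'D_v f x + 'D_v g x.
Proof. exact: (@deriveD _ _ _ f g). Qed.

Lemma derive_mul f g x v : derivable f x v -> derivable g x v ->
  'D_v (fun y => f y * g y) x = 'D_v f x * g x + f x * 'D_v g x.
Proof. by move=> df dg; rewrite (@deriveM _ _ f g x v df dg) addrC mulrC. Qed.

Lemma derive_scale (c : R) f x v : derivable f x v ->
  'D_v (fun y => c * f y) x = c * 'D_v f x.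
Proof.
move=> df; rewrite (derive_mul (derivable_cst c x v) df).
by rewrite derive_cst mul0r add0r.
Qed.

Lemma derivable_scale (c : R) f x v : derivable f x v ->
  derivable (fun y => c * f y) x v.
Proof. exact: derivable_mul (derivable_cst c x v). Qed.

End PointwiseDerive.

(** * Complex-valued functions of real variables *)

Section ComplexPartial.
Variables (R : realType) (n : nat).
Local Notation C := R[i].
Implicit Types (U V : set 'rV[R]_n) (f g : 'rV[R]_n -> C).

Lemma ReD (x y : C) : complex.Re (x + y) = complex.Re x + complex.Re y.
Proof. by case: x; case: y. Qed.
Lemma ImD (x y : C) : complex.Im (x + y) = complex.Im x + complex.Im y.
Proof. by case: x; case: y. Qed.
Lemma ReM (x y : C) : complex.Re (x * y) =
  complex.Re x * complex.Re y + -1 * (complex.Im x * complex.Im y).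
Proof. by case: x => a b; case: y => c d; rewrite mulN1r. Qed.
Lemma ImM (x y : C) : complex.Im (x * y) =
  complex.Re x * complex.Im y + complex.Im x * complex.Re y.
Proof. by case: x => a b; case: y. Qed.
Lemma ReV (x : C) : complex.Re x^-1 =
  complex.Re x * (complex.Re x * complex.Re x + complex.Im x * complex.Im x)^-1.
Proof. by case: x. Qed.
Lemma ImV (x : C) : complex.Im x^-1 =
  -1 * complex.Im x * (complex.Re x * complex.Re x + complex.Im x * complex.Im x)^-1.
Proof. by case: x => a b; rewrite mulN1r mulNr. Qed.

Lemma sqnorm_gt0 (x : C) : x != 0 ->
  0 < complex.Re x * complex.Re x + complex.Im x * complex.Im x.
Proof.
case: x => a b x0; rewrite -!expr2 lt_def addr_ge0 ?sqr_ge0 // andbT.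
by apply: contraNneq x0 => /eqP; rewrite paddr_eq0 ?sqr_ge0 // !sqrf_eq0 eq_complex.
Qed.

Lemma smooth_ext U (f g : 'rV[R]_n -> R) : open U ->
  (forall x, U x -> f x = g x) -> smooth U f -> smooth U g.
Proof. by move=> oU fg fs k; exact: Ck_ext (fs k). Qed.

Lemma csmooth_ext U f g : open U -> (forall x, U x -> f x = g x) ->
  csmooth U f -> csmooth U g.
Proof.
by move=> oU fg [f1 f2]; split; [move: f1|move: f2];
  apply: smooth_ext => // x Ux; rewrite fg.
Qed.

Lemma csmooth_ext_fun U f g : (forall x, g x = f x) -> csmooth U f -> csmooth U g.
Proof. by move=> /funext ->. Qed.

Lemma csmooth_sub U V f : V `<=` U -> csmooth U f -> csmooth V f.
Proof. by move=> VU [f1 f2]; split=> k; [exact: Ck_sub (f1 k)|exact: Ck_sub (f2 k)]. Qed.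

Lemma csmooth_cst U c : csmooth U (fun=> c).
Proof. by split=> k; exact: Ck_cst. Qed.

Lemma csmoothD U f g : open U -> csmooth U f -> csmooth U g ->
  csmooth U (fun x => f x + g x).
Proof.
move=> oU [f1 f2] [g1 g2]; split=> k.
  apply: Ck_ext (CkD oU (f1 k) (g1 k)) => // x _; exact/esym/ReD.
apply: Ck_ext (CkD oU (f2 k) (g2 k)) => // x _; exact/esym/ImD.
Qed.

Lemma csmoothM U f g : open U -> csmooth U f -> csmooth U g ->
  csmooth U (fun x => f x * g x).
Proof.
move=> oU [f1 f2] [g1 g2]; split=> k.
  apply: Ck_ext (CkD oU (CkM oU (f1 k) (g1 k))
    (CkM oU (Ck_cst k U (-1)) (CkM oU (f2 k) (g2 k)))) => // x _; exact/esym/ReM.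
apply: Ck_ext (CkD oU (CkM oU (f1 k) (g2 k)) (CkM oU (f2 k) (g1 k))) => // x _.
exact/esym/ImM.
Qed.

Lemma csmoothN U f : open U -> csmooth U f -> csmooth U (fun x => - f x).
Proof.
move=> oU fs; apply: csmooth_ext (csmoothM oU (csmooth_cst U (-1)) fs) => // x _.
by rewrite mulN1r.
Qed.

Lemma csmoothV U f : open U -> (forall x, U x -> f x != 0) -> csmooth U f ->
  csmooth U (fun x => (f x)^-1).
Proof.
move=> oU f0 [f1 f2].
have n0 x : U x -> complex.Re (f x) * complex.Re (f x)
    + complex.Im (f x) * complex.Im (f x) != 0.
  by move=> Ux; rewrite gt_eqF // sqnorm_gt0 // f0.
have fn k := CkV oU n0
  (CkD oU (CkM oU (f1 k) (f1 k)) (CkM oU (f2 k) (f2 k))).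
split=> k.
  apply: Ck_ext (CkM oU (f1 k) (fn k)) => // x _; exact/esym/ReV.
apply: Ck_ext (CkM oU (CkM oU (Ck_cst k U (-1)) (f2 k)) (fn k)) => // x _.
exact/esym/ImV.
Qed.

Lemma csmooth_sum U (I : Type) (r : seq I) (P : pred I) (F : I -> 'rV[R]_n -> C) :
  open U -> (forall i, csmooth U (F i)) ->
  csmooth U (fun x => \sum_(i <- r | P i) F i x).
Proof.
move=> oU Fs; elim: r => [|i r IH].
  by apply: csmooth_ext (csmooth_cst U 0) => // x _; rewrite big_nil.
case Pi : (P i).
  by apply: csmooth_ext (csmoothD oU (Fs i) IH) => // x _; rewrite big_cons Pi.
by apply: csmooth_ext IH => // x _; rewrite big_cons Pi.
Qed.

Lemma csmooth_prod U (I : Type) (r : seq I) (P : pred I) (F : I -> 'rV[R]_n -> C) :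
  open U -> (forall i, csmooth U (F i)) ->
  csmooth U (fun x => \prod_(i <- r | P i) F i x).
Proof.
move=> oU Fs; elim: r => [|i r IH].
  by apply: csmooth_ext (csmooth_cst U 1) => // x _; rewrite big_nil.
case Pi : (P i).
  by apply: csmooth_ext (csmoothM oU (Fs i) IH) => // x _; rewrite big_cons Pi.
by apply: csmooth_ext IH => // x _; rewrite big_cons Pi.
Qed.

Lemma cpartial_eq f g x i : (forall y, f y = g y) -> cpartial i f x = cpartial i g x.
Proof. by move=> /funext ->. Qed.

Lemma csmooth_cpartial U f i : csmooth U f -> csmooth U (cpartial i f).
Proof. by move=> [f1 f2]; split=> k; [have [_ /(_ i) []] := f1 k.+1|have [_ /(_ i) []] := f2 k.+1]. Qed.

Definition cderivable f x i := derivable (fun y => complex.Re (f y)) x (dirE R i)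
  /\ derivable (fun y => complex.Im (f y)) x (dirE R i).

Lemma csmooth_derivable U f x i : csmooth U f -> U x -> cderivable f x i.
Proof.
by move=> [/(_ 1) [_ /(_ i) [f1 _]] /(_ 1) [_ /(_ i) [f2 _]]] Ux; split; [exact: f1|exact: f2].
Qed.

Lemma cderivable_ext f g x i : f =1 g -> cderivable f x i -> cderivable g x i.
Proof. by move=> /funext ->. Qed.

Lemma cderivableD f g x i : cderivable f x i -> cderivable g x i ->
  cderivable (fun y => f y + g y) x i.
Proof.
move=> [f1 f2] [g1 g2]; split.
  by rewrite (funext (fun y => ReD (f y) (g y))); exact: derivable_add.
by rewrite (funext (fun y => ImD (f y) (g y))); exact: derivable_add.
Qed.

Lemma cpartialD f g x i : cderivable f x i -> cderivable g x i ->
  cpartial i (fun y => f y + g y) x = cpartial i f x + cpartial i g x.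
Proof.
move=> [f1 f2] [g1 g2]; rewrite /cpartial (funext (fun y => ReD (f y) (g y))).
rewrite (funext (fun y => ImD (f y) (g y))).
by rewrite (derive_add f1 g1) (derive_add f2 g2).
Qed.

Lemma cderivable_cst c x i : cderivable (fun=> c) x i.
Proof. by split; exact: derivable_cst. Qed.

Lemma cpartial_cst (c : C) x (i : 'I_n) : cpartial i (fun=> c) x = 0.
Proof.
rewrite /cpartial (_ : (fun=> complex.Re c) = cst (complex.Re c)) //.
by rewrite (_ : (fun=> complex.Im c) = cst (complex.Im c)) // !derive_cst.
Qed.

Lemma cderivableM f g x i : cderivable f x i -> cderivable g x i ->
  cderivable (fun y => f y * g y) x i.
Proof.
move=> [f1 f2] [g1 g2]; split.
  rewrite (funext (fun y => ReM (f y) (g y))).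
  exact: derivable_add (derivable_mul f1 g1)
    (derivable_scale (derivable_mul f2 g2)).
rewrite (funext (fun y => ImM (f y) (g y))).
exact: derivable_add (derivable_mul f1 g2) (derivable_mul f2 g1).
Qed.

Lemma cpartialM f g x i : cderivable f x i -> cderivable g x i ->
  cpartial i (fun y => f y * g y) x = cpartial i f x * g x + f x * cpartial i g x.
Proof.
move=> [f1 f2] [g1 g2]; rewrite /cpartial (funext (fun y => ReM (f y) (g y))).
rewrite (funext (fun y => ImM (f y) (g y))).
rewrite (derive_add (derivable_mul f1 g1)
  (derivable_scale (derivable_mul f2 g2))).
rewrite (derive_scale _ (derivable_mul f2 g2)).
rewrite (derive_add (derivable_mul f1 g2) (derivable_mul f2 g1)).
rewrite (derive_mul f1 g1) (derive_mul f2 g2) (derive_mul f1 g2) (derive_mul f2 g1).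
case: (f x) (g x) => a b [c d] /=.
by move: ('D_ _ _ x) ('D_ _ _ x) ('D_ _ _ x) ('D_ _ _ x) => p q r s; congr (_ +i* _); ring.
Qed.

Lemma cderivableN f x i : cderivable f x i -> cderivable (fun y => - f y) x i.
Proof.
move=> df; apply: cderivable_ext (cderivableM (cderivable_cst (-1) x i) df) => y.
by rewrite mulN1r.
Qed.

Lemma cpartialN f x i : cderivable f x i -> cpartial i (fun y => - f y) x = - cpartial i f x.
Proof.
move=> df; rewrite (_ : (fun y => - f y) = fun y => -1 * f y).
  rewrite (cpartialM (cderivable_cst (-1) x i) df).
  by rewrite cpartial_cst mul0r add0r mulN1r.
by apply/funext => y; rewrite mulN1r.
Qed.

Lemma cderivable_sum (I : Type) (r : seq I) (P : pred I) (F : I -> 'rV[R]_n -> C) x i :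
  (forall k, cderivable (F k) x i) ->
  cderivable (fun y => \sum_(k <- r | P k) F k y) x i.
Proof.
move=> dF; elim: r => [|k r IH].
  by apply: cderivable_ext (cderivable_cst 0 x i) => y; rewrite big_nil.
case Pk : (P k).
  by apply: cderivable_ext (cderivableD (dF k) IH) => y; rewrite big_cons Pk.
by apply: cderivable_ext IH => y; rewrite big_cons Pk.
Qed.

Lemma cpartial_sum (I : Type) (r : seq I) (P : pred I) (F : I -> 'rV[R]_n -> C) x i :
  (forall k, cderivable (F k) x i) ->
  cpartial i (fun y => \sum_(k <- r | P k) F k y) x = \sum_(k <- r | P k) cpartial i (F k) x.
Proof.
move=> dF; elim: r => [|k r IH].
  rewrite big_nil; apply: etrans (cpartial_cst 0 x i).
  by congr (cpartial i _ x); apply/funext => y; rewrite big_nil.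
rewrite big_cons; case Pk : (P k); last first.
  by rewrite -IH; congr (cpartial i _ x); apply/funext => y; rewrite big_cons Pk.
rewrite -IH -cpartialD //; last exact: cderivable_sum.
by congr (cpartial i _ x); apply/funext => y; rewrite big_cons Pk.
Qed.

Lemma cpartial_ext U f g x i : open U -> U x -> (forall y, U y -> f y = g y) ->
  cpartial i f x = cpartial i g x.
Proof.
move=> oU Ux fg; rewrite /cpartial; congr (_ +i* _); apply: near_eq_derive;
  by apply: (near_open oU Ux) => y /fg ->.
Qed.

Lemma cpartialC U f x i j : open U -> csmooth U f -> U x ->
  cpartial j (cpartial i f) x = cpartial i (cpartial j f) x.
Proof.
by move=> oU [f1 f2] Ux; rewrite /cpartial /= (schwarz _ _ oU (f1 2) Ux) (schwarz _ _ oU (f2 2) Ux).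
Qed.

Lemma open_sub_gt0 U (h : 'rV[R]_n -> R) : open U -> (forall x, U x -> {for x, continuous h}) ->
  open (U `&` [set y | 0 < h y]).
Proof.
move=> oU hc; rewrite openE => y [Uy hy].
apply: filterI; first exact: open_nbhs_nbhs (conj oU Uy).
exact: (hc y Uy) _ (lt_nbhsr hy).
Qed.

Lemma open_sub_neq0 U f : open U -> csmooth U f -> open (U `&` [set y | f y != 0]).
Proof.
move=> oU [/(_ 0%N) [f1 _] /(_ 0%N) [f2 _]].
set h := fun y => complex.Re (f y) * complex.Re (f y) + complex.Im (f y) * complex.Im (f y).
have -> : [set y | f y != 0] = [set y | 0 < h y].
  apply/seteqP; split=> y /=; first exact: sqnorm_gt0.
  by rewrite /h; apply: contraTneq => ->; rewrite /= !mul0r addr0 ltxx.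
apply: open_sub_gt0 => // x Ux; apply: continuousD; apply: continuousM;
  by [exact: f1|exact: f2].
Qed.

(** After division by [f x] the values near [x] have positive real part, where the principal root is
    smooth: its real part [p] is the square root of half of modulus plus real part, hence positive,
    and its imaginary part is [Im g / (2 p)]. The constant [sqrtc (f x)] undoes the
    normalisation. *)
Lemma csmooth_sqrt U f x : open U -> csmooth U f -> U x -> f x != 0 ->
  exists V s, [/\ open V, V `<=` U, V x, csmooth V s &
    forall y, V y -> s y ^+ 2 = f y].
Proof.
move=> oU fs Ux fx0.
pose g y := f y / f x.
have gs : csmooth U g by apply: csmoothM => //; exact: csmooth_cst.
have [g1 g2] := gs.
pose V := U `&` [set y | 0 < complex.Re (g y)].
have oV : open V by apply: open_sub_gt0 => // y Uy; exact: Ck_continuous (g1 0%N) Uy.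
have VU : V `<=` U by move=> y [].
pose rho2 y := complex.Re (g y) * complex.Re (g y) + complex.Im (g y) * complex.Im (g y).
pose p2 y := (Num.sqrt (rho2 y) + complex.Re (g y)) * 2^-1.
pose p y := Num.sqrt (p2 y).
pose q y := complex.Im (g y) * (2 * p y)^-1.
have g1V k := Ck_sub VU (g1 k); have g2V k := Ck_sub VU (g2 k).
have rho2_gt0 y : V y -> 0 < rho2 y.
  move=> [_ gy]; apply: sqnorm_gt0; apply: contraTneq gy => ->.
  by rewrite ltxx.
have p2_gt0 y : V y -> 0 < p2 y.
  by move=> [Uy gy]; rewrite /p2 mulr_gt0 // ltr_wpDl ?sqrtr_ge0.
have p_gt0 y : V y -> 0 < p y by move=> Vy; rewrite sqrtr_gt0 p2_gt0.
have sp : smooth V p.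
  move=> k; apply: Ck_sqrt => //; apply: CkM => //; last exact: Ck_cst.
  apply: CkD => //; apply: Ck_sqrt => //.
  by apply: CkD => //; apply: CkM.
have sq : smooth V q.
  move=> k; apply: CkM => //; apply: CkV => //.
    by move=> y Vy; rewrite mulf_neq0 // gt_eqF // p_gt0.
  by apply: CkM => //; exact: Ck_cst.
exists V, (fun y => sqrtc (f x) * (p y +i* q y)); split => //.
- by split => //=; rewrite /g divff.
- by apply: csmoothM => //; exact: csmooth_cst.
move=> y Vy; rewrite exprMn sqr_sqrtc.
have -> : f y = f x * g y by rewrite /g mulrC divfK.
congr (_ * _); have := p_gt0 _ Vy; have := p2_gt0 _ Vy; have := rho2_gt0 _ Vy.
have E1 : p y * p y = p2 y by rewrite -expr2 sqr_sqrtr // ltW // p2_gt0.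
have E2 : Num.sqrt (rho2 y) * Num.sqrt (rho2 y) = rho2 y.
  by rewrite -expr2 sqr_sqrtr // ltW // rho2_gt0.
move=> r0 p20 p0.
have pn0 : p y != 0 by rewrite gt_eqF.
have p2n0 : p2 y != 0 by rewrite gt_eqF.
move: E1 E2; rewrite /q /p2 /rho2 in r0 p20 p2n0 *.
case: (g y) => u w /= in r0 p20 p2n0 *.
move: (Num.sqrt _) (p y) p0 pn0 p20 p2n0 => r s s0 sn0 p20 p2n0 E1 E2.
rewrite expr2; congr (_ +i* _).
  have -> : w / (2 * s) * (w / (2 * s)) = w * w / (4 * (s * s)) by field; rewrite sn0.
  rewrite E1.
  have -> : w * w = r * r - u * u by rewrite E2; ring.
  have rn : r + u != 0 by apply: contraNneq p2n0 => ->; rewrite mul0r.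
  by field.
by field.
Qed.

End ComplexPartial.

(** * Wedge products and pullbacks *)

Section AlternatingSum.
Variables (F : fieldType) (n : nat).

Lemma lift_perm_onto k (i j : 'I_k.+1) (s : 'S_k.+1) : s i = j ->
  exists t, s = lift_perm i j t.
Proof.
move=> sij; pose f k' := odflt k' (unlift j (s (lift i k'))).
have fK k' : lift j (f k') = s (lift i k').
  rewrite /f; case: unliftP => [k'' -> //|E].
  by have /eqP[] := neq_lift i k'; apply: (@perm_inj _ s); rewrite sij E.
have injf : injective f by move=> p q /(congr1 (lift j)); rewrite !fK => /perm_inj/lift_inj.
exists (perm injf); apply/permP => k'.
case: (unliftP i k') => [k''|] ->; first by rewrite lift_perm_lift permE fK.
by rewrite lift_perm_id.
Qed.

Lemma lift_perm_inj k (i j : 'I_k.+1) : injective (@lift_perm k i j).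
Proof.
move=> s t E; apply/permP => k'; apply: (@lift_inj _ j).
by rewrite -!(lift_perm_lift i) E.
Qed.

(** The permutations are grouped by the image [j] of the last index. Those in one group differ by a
    permutation of the other [k] arguments, whose sign [a] absorbs, so each group consists of [k!]
    equal terms. *)
Lemma sum_perm_last k (a : ('I_k -> 'I_n) -> F) (b : 'I_n -> F) (v : 'I_k.+1 -> 'I_n) :
  (forall w (s : 'S_k), a (w \o s) = (-1) ^+ s * a w) ->
  \sum_(s : 'S_k.+1) (-1) ^+ s * a (fun i => v (s (lift ord_max i))) * b (v (s ord_max))
  = k`!%:R * \sum_(j < k.+1) (-1) ^+ (j + k) * a (fun i => v (lift j i)) * b (v j).
Proof.
move=> aalt; rewrite (partition_big (fun s : 'S_k.+1 => s ord_max) predT) //=.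
rewrite big_distrr; apply: eq_bigr => j _ /=.
(* [[pick t | ...]] inverts [lift_perm]; the default [1%g] is never met when [s ord_max = j], by
   [lift_perm_onto]. *)
rewrite (reindex_onto (@lift_perm k ord_max j)
  (fun s => odflt 1%g [pick t | s == lift_perm ord_max j t])) /=; last first.
  move=> s /eqP /lift_perm_onto[t Et]; case: pickP => [t' /eqP -> //|/(_ t)].
  by rewrite Et eqxx.
rewrite (eq_bigl predT); last first.
  move=> s; rewrite lift_perm_id eqxx /=; case: pickP => [t /eqP /lift_perm_inj -> /=|/(_ s)]; rewrite ?eqxx //.
rewrite (eq_bigr (fun=> (-1) ^+ (j + k) * a (fun i => v (lift j i)) * b (v j))); last first.
  move=> s _; rewrite lift_perm_id.
  have -> : (fun i => v (lift_perm ord_max j s (lift ord_max i))) =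
      (fun i => v (lift j i)) \o s by apply/funext => i /=; rewrite lift_perm_lift.
  by rewrite aalt odd_lift_perm mulrA -signr_addb addbK addbC -oddD signr_odd.
by rewrite sumr_const -[LHS]mulr_natl -card_Sn.
Qed.

End AlternatingSum.

Lemma odd_cast_perm m n (e : m = n) (s : 'S_m) : cast_perm e s = s :> bool.
Proof. by subst n; rewrite cast_perm_id. Qed.

Section WedgeOne.
Variables (R : realType) (n : nat).
Local Notation C := R[i].

Definition alt_at k (a : tensor R n k) x :=
  forall v (s : 'S_k), a x (v \o s) = (-1) ^+ s * a x v.

Lemma wedge_alt k l (a : tensor R n k) (b : tensor R n l) x : alt_at (a /^\ b)%ff x.
Proof.
move=> v s; rewrite /wedge mulrCA; congr (_ * _).
rewrite big_distrr (reindex_inj (mulIg s^-1%g)) /=.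
apply: eq_bigr => t _; rewrite odd_permM odd_permV signr_addb.
rewrite [_ ^+ t * _]mulrC -!mulrA; congr (_ * (_ * (a x _ * b x _)));
  by apply/funext => i /=; rewrite permM permKV.
Qed.

Lemma alt_at1 (a : tensor R n 1) x : alt_at a x.
Proof.
move=> v s; have -> : s = 1%g by apply/permP => i; rewrite !ord1.
by rewrite odd_perm1 mul1r; congr (a x _); apply/funext => i; rewrite /= perm1.
Qed.

(** For a 1-form on the right the factorials in [wedge] cancel the multiplicity of [sum_perm_last].
    The sign [(-1) ^+ (j + k)] is that of moving argument [j] to the last place, and [w] only
    transports [v] from ['I_(k + 1)] to ['I_k.+1]. *)
Lemma wedge1E k (a : tensor R n k) (b : tensor R n 1) x
    (v : 'I_(k + 1) -> 'I_n) : alt_at a x ->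
  let w (j : 'I_k.+1) := v (cast_ord (esym (addn1 k)) j) in
  (a /^\ b)%ff x v =
  \sum_(j < k.+1) (-1) ^+ (j + k) * a x (fun i => w (lift j i)) * b x (fun=> w j).
Proof.
move=> aalt w; rewrite /wedge muln1.
have := sum_perm_last (fun j => b x (fun=> j)) w aalt => E.
apply: (mulfI (x := (k`!)%:R)); first by rewrite pnatr_eq0 -lt0n fact_gt0.
rewrite mulVKf ?pnatr_eq0 -?lt0n ?fact_gt0 // -E.
rewrite (reindex (cast_perm (esym (addn1 k)))) /=; last first.
  by apply: onW_bij; exists (cast_perm (addn1 k)); [exact: cast_permKV|exact: cast_permK].
apply: eq_bigr => t _; rewrite odd_cast_perm; congr (_ * a x _ * b x _).
  apply/funext => i; rewrite /w cast_permE; congr (v (cast_ord _ (t _))).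
  by apply: val_inj; rewrite /= /bump leqNgt ltn_ord.
apply/funext => i; rewrite /w cast_permE; congr (v (cast_ord _ (t _))).
by apply: val_inj; rewrite /= ord1 addn0.
Qed.

End WedgeOne.

Section ExplicitWedge.
Variables (F : comNzRingType) (T : Type).
Implicit Types (w : T -> T -> F) (a b c : T -> F).

(** Components of a 2-form wedged with one, two and three 1-forms. As bare polynomials over a
    commutative ring they can be handed to [ring]. *)
Definition wedge21 w a i j k := w i j * a k - w i k * a j + w j k * a i.
Definition wedge211 w a b i j k l :=
  wedge21 w a i j k * b l - wedge21 w a i j l * b k
  + wedge21 w a i k l * b j - wedge21 w a j k l * b i.
Definition wedge2111 w a b c i j k l m :=
  wedge211 w a b i j k l * c m - wedge211 w a b i j k m * c l
  + wedge211 w a b i j l m * c k - wedge211 w a b i k l m * c j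
  + wedge211 w a b j k l m * c i.

End ExplicitWedge.

Section WedgeValues.
Variables (R : realType) (n : nat).
Local Notation C := R[i].
Implicit Types (x : 'rV[R]_n).

Definition form1_at (a : tensor R n 1) x i := a x (fun=> i).
Definition form2_at (a : tensor R n 2) x i j := a x (pair_idx i j).

Lemma pair_idxE (u : nat -> 'I_n) :
  (fun i : 'I_2 => u i) = pair_idx (u 0%N) (u 1%N).
Proof. by apply/funext => -[[|[|//]] ?]. Qed.

Lemma pair_idx_eta (v : 'I_2 -> 'I_n) : v = pair_idx (v ord0) (v ord_max).
Proof.
by apply/funext => -[[|[|//]] ?]; rewrite /pair_idx /=; congr v; apply: val_inj.
Qed.

(** Reading the arguments from a function on [nat] hides the casts between ordinal types, and [bump]
    then computes on numerals. *)
Lemma wedge1_natE k (a : tensor R n k) (b : tensor R n 1) x (u : nat -> 'I_n) :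
  alt_at a x ->
  (a /^\ b)%ff x (fun i => u i) =
  \sum_(j < k.+1) (-1) ^+ (j + k) * a x (fun i : 'I_k => u (bump j i)) * b x (fun=> u j).
Proof. by move=> /wedge1E ->. Qed.

Lemma wedge11E (a b : tensor R n 1) x i j :
  (a /^\ b)%ff x (pair_idx i j) =
  form1_at a x i * form1_at b x j - form1_at a x j * form1_at b x i.
Proof.
pose u m := if m == 0%N then i else j.
have := wedge1_natE b u (alt_at1 a x).
rewrite (_ : (fun i : 'I_(1 + 1) => u i) = pair_idx i j); last exact: pair_idxE.
move=> ->; rewrite !big_ord_recl big_ord0 /= addr0 /form1_at.
have E (c : tensor R n 1) m : c x (fun i : 'I_1 => u (bump m i)) = c x (fun=> u (bump m 0)).
  by congr (c x _); apply/funext => p; rewrite ord1.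
rewrite !E /u /bump /= expr1 sqrrN expr1n mul1r mulN1r mulNr addrC; congr (_ - _).
Qed.

Variables (a : tensor R n 2) (b c d : tensor R n 1) (x : 'rV[R]_n).
Hypothesis aalt : alt_at a x.

Lemma wedge21E (u : nat -> 'I_n) :
  (a /^\ b)%ff x (fun i => u i) =
  wedge21 (form2_at a x) (form1_at b x) (u 0%N) (u 1%N) (u 2%N).
Proof.
rewrite wedge1_natE // !big_ord_recl big_ord0 /= /wedge21 /form2_at /form1_at.
rewrite !(pair_idxE (fun m => u (bump _ m))) /bump /=.
by rewrite !exprS expr0 /=; ring.
Qed.

Lemma wedge211E (u : nat -> 'I_n) :
  (a /^\ b /^\ c)%ff x (fun i => u i) =
  wedge211 (form2_at a x) (form1_at b x) (form1_at c x) (u 0%N) (u 1%N) (u 2%N) (u 3%N).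
Proof.
rewrite (wedge1_natE c u (wedge_alt a b x)) !big_ord_recl big_ord0 /= /wedge211.
rewrite !(wedge21E (fun m => u (bump _ m))) /bump /= /form1_at.
by rewrite !exprS expr0 /=; ring.
Qed.

Lemma wedge2111E (u : nat -> 'I_n) :
  (a /^\ b /^\ c /^\ d)%ff x (fun i => u i) =
  wedge2111 (form2_at a x) (form1_at b x) (form1_at c x) (form1_at d x)
    (u 0%N) (u 1%N) (u 2%N) (u 3%N) (u 4%N).
Proof.
rewrite (wedge1_natE d u (wedge_alt (a /^\ b)%ff c x)) !big_ord_recl big_ord0 /= /wedge2111.
rewrite !(wedge211E (fun m => u (bump _ m))) /bump /= /form1_at.
by rewrite !exprS expr0 /=; ring.
Qed.

End WedgeValues.

Section Alternating.
Variables (F : numDomainType) (n : nat).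

(** An injective [v] is a permutation of the identity; a repeated argument gives [T v = - T v]
    through a transposition. *)
Lemma alternating_top_eq0 (T : ('I_n -> 'I_n) -> F) :
  (forall v (s : 'S_n), T (v \o s) = (-1) ^+ s * T v) -> T id = 0 -> forall v, T v = 0.
Proof.
move=> Talt T0 v; have [/injectiveP vinj|/injectivePn[i [j ij vij]]] := boolP (injectiveb v).
  have -> : v = id \o perm vinj by apply/funext => k /=; rewrite permE.
  by rewrite Talt T0 mulr0.
have E : v = v \o tperm i j.
  by apply/funext => k /=; case: tpermP => [->|->|//].
have := Talt v (tperm i j); rewrite -E odd_tperm ij expr1 mulN1r => /eqP.
by rewrite -subr_eq0 opprK -mulr2n mulrn_eq0 => /eqP.
Qed.

End Alternating.

Section TwoForms.
Variables (R : realType) (n : nat).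

Lemma alt_at2 (a : tensor R n 2) x :
  (forall i j, a x (pair_idx i j) = - a x (pair_idx j i)) -> alt_at a x.
Proof.
move=> aN v s; rewrite [v \o s]pair_idx_eta [in RHS](pair_idx_eta v) /=.
have or2 (i : 'I_2) : i = ord0 \/ i = ord_max.
  by case: i => -[|[|//]] ?; [left|right]; apply: val_inj.
have ss : s ord0 != s ord_max by rewrite (inj_eq perm_inj).
case: (or2 (s ord0)) (or2 (s ord_max)) => [s0|s0] [s1|s1]; rewrite s0 s1 ?eqxx // in ss *.
  have -> : s = 1%g by apply/permP => i; rewrite perm1; case: (or2 i) => ->.
  by rewrite odd_perm1 mul1r.
have -> : s = tperm ord0 ord_max.
  by apply/permP => i; case: (or2 i) => ->; rewrite ?tpermL ?tpermR.
by rewrite odd_tperm mulN1r -aN.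
Qed.

Lemma ext_d1E (a : tensor R n 1) x i j :
  ext_d a x (pair_idx i j) =
  cpartial i (fun y => form1_at a y j) x - cpartial j (fun y => form1_at a y i) x.
Proof.
rewrite /ext_d !big_ord_recl big_ord0 /= expr0 mul1r addr0 expr1 mulN1r /pair_idx /=.
by congr (cpartial _ _ x - cpartial _ _ x); apply/funext => y;
  rewrite /form1_at; congr (a y _); apply/funext => p; rewrite ord1.
Qed.

Lemma ext_d0E (f : 'rV[R]_n -> R[i]) x i :
  form1_at (ext_d (form0 f)) x i = cpartial i f x.
Proof. by rewrite /form1_at /ext_d big_ord_recl big_ord0 /= expr0 mul1r addr0. Qed.

Lemma ext_d1_alt (a : tensor R n 1) x : alt_at (ext_d a) x.
Proof. by apply: alt_at2 => i j; rewrite !ext_d1E opprB. Qed.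

End TwoForms.

Section BasePullback.
Variable R : realType.
Local Notation C := R[i].
Implicit Types (y : 'rV[R]_(4 + 4)) (al : tensor R 4 1).

(** Components on the eight-dimensional space of the pullback of a covector on the base: the four
    fibre directions are sent to 0. *)
Definition base_ext (f : 'I_4 -> C) (c : 'I_(4 + 4)) : C :=
  if fintype.split c is inl a then f a else 0.
Definition base_ext2 (f : 'I_4 -> 'I_4 -> C) (c d : 'I_(4 + 4)) : C :=
  base_ext (fun a => base_ext (f a) d) c.

Lemma jacobian_base_pt y c a :
  ('J (@base_pt R) y) c a = (c == lshift 4 a)%:R.
Proof.
rewrite /jacobian mxE diff_lin; last exact: continuous_lsubmx.
by rewrite /base_pt !mxE eqxx /= eq_sym.
Qed.

Lemma pullback_base1 al y : form1_at (pullback (@base_pt R) al) y =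
  base_ext (form1_at al (base_pt y)).
Proof.
apply/funext => c; rewrite /form1_at /pullback.
rewrite (reindex (fun j : 'I_4 => [ffun=> j] : {ffun 'I_1 -> 'I_4})) /=; last first.
  apply: onW_bij; exists (fun w : {ffun 'I_1 -> 'I_4} => w ord0) => [j|w].
    by rewrite ffunE.
  by apply/ffunP => i; rewrite ffunE (ord1 i).
rewrite (eq_bigr (fun j => al (base_pt y) (fun=> j) * (c == lshift 4 j)%:R)); last first.
  move=> j _; rewrite big_ord1 ffunE jacobian_base_pt; congr (_ * _); last by case: eqP.
  by congr (al _ _); apply/funext => p; rewrite ffunE.
rewrite /base_ext; case: splitP => [j cj|k ck].
  have -> : c = lshift 4 j by apply: val_inj.
  rewrite (bigD1 j) //= eqxx mulr1 big1 ?addr0 // => i ij.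
  by rewrite eq_lshift eq_sym (negbTE ij) mulr0.
rewrite big1 // => j _; rewrite (_ : c == _ = false) ?mulr0 //.
by apply/eqP => cj; move: ck; rewrite cj /= => E; have := ltn_ord j; rewrite E ltnNge leq_addr.
Qed.

(** The projection is linear and maps a coordinate vector either to a coordinate vector of the base
    or to 0, so each derivative is one along a line in the base. *)
Lemma cderivable_base (f : 'rV[R]_4 -> C) y c :
  (forall a, cderivable f (base_pt y) a) ->
  cderivable (fun y' => f (base_pt y')) y c /\
  cpartial c (fun y' => f (base_pt y')) y = base_ext (fun a => cpartial a f (base_pt y)) c.
Proof.
move=> df.
have dir : lsubmx (dirE R c) = if fintype.split c is inl a then dirE R a else 0 :> 'rV[R]_4.
  apply/rowP => b; rewrite !mxE; case: splitP => [j cj|k ck].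
    have -> : c = lshift 4 j by apply: val_inj.
    by rewrite eq_lshift !mxE eqxx.
  rewrite !mxE eqxx (_ : lshift 4 b == c = false) //.
  by apply/eqP => /(congr1 val) /= E; have := ltn_ord b; rewrite E ck ltnNge leq_addr.
have line (h : 'rV[R]_4 -> R) u : lsubmx (dirE R c) = u -> derivable h (base_pt y) u ->
    is_derive y (dirE R c) (fun y' => h (base_pt y')) ('D_u h (base_pt y)).
  move=> Eu dh.
  have E : (fun t : R => t^-1 *: (((fun y' => h (base_pt y')) \o shift y) (t *: dirE R c)
        - h (base_pt y)))
      = (fun t : R => t^-1 *: ((h \o shift (base_pt y)) (t *: u) - h (base_pt y))).
    apply/funext => t /=; congr (_ *: (h _ - _)).
    by rewrite -Eu; apply/rowP => b; rewrite !mxE.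
  by apply: DeriveDef; rewrite /derivable /derive E.
have main (h : 'rV[R]_4 -> R) : (forall a, derivable h (base_pt y) (dirE R a)) ->
    is_derive y (dirE R c) (fun y' => h (base_pt y'))
    (if fintype.split c is inl a then 'D_(dirE R a) h (base_pt y) else 0).
  move=> dh; have := line h _ dir; case: (fintype.split c) => [a|_] L; first exact: L.
  by rewrite -(derive0 h (base_pt y)); apply: L; exact: derivable0.
have [d1 e1] := main (fun x => complex.Re (f x)) (fun a => (df a).1).
have [d2 e2] := main (fun x => complex.Im (f x)) (fun a => (df a).2).
split; first exact: (conj d1 d2).
by rewrite {1}/cpartial e1 e2 /base_ext /cpartial; case: (fintype.split c).
Qed.

End BasePullback.

(** * The twistor forms *)

Section Twistor.
Variable R : realType.
Local Notation C := R[i].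
Local Notation o2 := (@Ordinal 4 2 isT).
Local Notation o3 := (@Ordinal 4 3 isT).

Lemma is_derive_coord n (j : 'I_n) (y v : 'rV[R]_n) :
  is_derive y v (fun y : 'rV[R]_n => y 0 j) (v 0 j).
Proof.
have E : 'D_v (fun y : 'rV[R]_n => y 0 j) y = v 0 j.
  have -> : v 0 j = 'D_v (fun y : 'rV[R]_n => y) y 0 j by rewrite derive_id.
  by rewrite derive_mx ?mxE //; exact: derivable_id.
rewrite -[X in is_derive _ _ _ X]E; apply: derivableP.
exact/diff_derivable/differentiable_coord.
Qed.

(** [d Re z' + i d Im z'] on the coordinate vectors; [Re z'] and [Im z'] are the fibre coordinates
    number 2 and 3. *)
Definition dz' (c : 'I_(4 + 4)) : C :=
  (c == rshift 4 o2)%:R +i* (c == rshift 4 o3)%:R.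

Lemma cpartial_z' y c : cderivable (@z'fun R) y c /\ cpartial c (@z'fun R) y = dz' c.
Proof.
have E (k : 'I_4) : is_derive y (dirE R c) (fun y : 'rV[R]_(4 + 4) => rsubmx y 0 k)
    ((c == rshift 4 k)%:R).
  have -> : (fun y : 'rV[R]_(4 + 4) => rsubmx y 0 k) = fun y => y 0 (rshift 4 k).
    by apply/funext => y'; rewrite mxE.
  have := is_derive_coord (rshift 4 k) y (dirE R c).
  by rewrite /dirE mxE eqxx /= eq_sym.
have [d1 e1] := E o2; have [d2 e2] := E o3.
by split; [exact: (conj d1 d2)|rewrite /cpartial e1 e2].
Qed.

Lemma cderivable_base_ext (al : tensor R 4 1) y c d :
  (forall a b, cderivable (fun x => form1_at al x b) (base_pt y) a) ->
  cderivable (fun y' => base_ext (form1_at al (base_pt y')) d) y c /\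
  cpartial c (fun y' => base_ext (form1_at al (base_pt y')) d) y =
  base_ext2 (fun a b => cpartial a (fun x => form1_at al x b) (base_pt y)) c d.
Proof.
move=> dal; rewrite /base_ext2 {1 2 4}/base_ext; case: (fintype.split d) => [b|_].
  by apply: cderivable_base => a; exact: dal.
split; first exact: cderivable_cst.
by rewrite cpartial_cst /base_ext; case: (fintype.split c).
Qed.

Lemma base_ptE (x : 'rV[R]_4) z z' : base_pt (PPcoords x z z') = x.
Proof. by rewrite /base_pt /PPcoords row_mxKl. Qed.
Lemma zfunE (x : 'rV[R]_4) z z' : zfun (PPcoords x z z') = z.
Proof. by rewrite /zfun /PPcoords !row_mxKr !mxE /=; case: z. Qed.
Lemma z'funE (x : 'rV[R]_4) z z' : z'fun (PPcoords x z z') = z'.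
Proof. by rewrite /z'fun /PPcoords !row_mxKr !mxE /=; case: z'. Qed.

Variable Gam : 'I_4 -> 'I_4 -> tensor R 4 1.
Local Notation G i j := (form1_at (Gam i j)).
Local Notation dG i j := (form2_at (ext_d (Gam i j))).

Lemma form_E'E y c : form1_at (form_E' Gam) y c =
  dz' c - base_ext (G iN iM (base_pt y)) c
  + z'fun y * (base_ext (G iP iP (base_pt y)) c - base_ext (G iK iK (base_pt y)) c)
  + z'fun y ^+ 2 * base_ext (G iM iN (base_pt y)) c.
Proof.
rewrite /form_E' {1}/form1_at /fadd /fmul /fopp.
rewrite -!/(form1_at (pullback _ _) y c) !pullback_base1.
by rewrite -/(form1_at _ y c) ext_d0E (cpartial_z' y c).2.
Qed.

(* Modulo E' = dz' - eps, the 2-form dE' is the pullback of [Theta]. *)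
Definition eps (x : 'rV[R]_4) z' a := G iN iM x a - z' * (G iP iP x a - G iK iK x a) - z' ^+ 2 * G iM iN x a.
Definition beta (x : 'rV[R]_4) z' a := G iP iP x a - G iK iK x a + 2%:R * z' * G iM iN x a.
Definition Theta x z' a b := - dG iN iM x a b + z' * (dG iP iP x a b - dG iK iK x a b)
  + z' ^+ 2 * dG iM iN x a b + (eps x z' a * beta x z' b - eps x z' b * beta x z' a).

Variable x : 'rV[R]_4.
Hypothesis Gam_derivable :
  forall i j a b, cderivable (fun x' => form1_at (Gam i j) x' b) x a.

Lemma ThetaN z' a b : Theta x z' a b = - Theta x z' b a.
Proof. by rewrite /Theta /form2_at !ext_d1E; ring. Qed.

(** Write [E' = dz' - eps]. As [beta] is minus the derivative of [eps] in [z'], the differential is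
    [- d_x eps + dz' /\ beta]; replacing [dz'] by [E' + eps] gives [Theta + E' /\ beta], where
    [Theta = - d_x eps + eps /\ beta]. *)
Lemma dE'E z z' c d : let y := PPcoords x z z' in
  let e := form1_at (form_E' Gam) y in
  form2_at (ext_d (form_E' Gam)) y c d = base_ext2 (Theta x z') c d
    + (e c * base_ext (beta x z') d - e d * base_ext (beta x z') c).
Proof.
move=> y e; rewrite /form2_at ext_d1E.
have P k l : cpartial k (fun y => form1_at (form_E' Gam) y l) y =
   - base_ext2 (fun a b => cpartial a (fun x => G iN iM x b) x) k l
   + dz' k * (base_ext (G iP iP x) l - base_ext (G iK iK x) l)
   + z' * (base_ext2 (fun a b => cpartial a (fun x => G iP iP x b) x) k l
           - base_ext2 (fun a b => cpartial a (fun x => G iK iK x b) x) k l)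
   + 2%:R * z' * dz' k * base_ext (G iM iN x) l
   + z' ^+ 2 * base_ext2 (fun a b => cpartial a (fun x => G iM iN x b) x) k l.
  rewrite (funext (fun y => form_E'E y l)).
  have [dz ez] := cpartial_z' y k.
  have B i j : cderivable (fun y' => base_ext (G i j (base_pt y')) l) y k /\
      cpartial k (fun y' => base_ext (G i j (base_pt y')) l) y =
      base_ext2 (fun a b => cpartial a (fun x => G i j x b) x) k l.
    have := @cderivable_base_ext (Gam i j) y k l; rewrite base_ptE; apply.
    exact: Gam_derivable.
  have dB i j := (B i j).1.
  have dN i j := cderivableN (dB i j).
  have d1 := cderivableD (dB iP iP) (dN iK iK).
  have d2 := cderivableM dz d1.
  have dzz := cderivableM dz dz.
  have d3 := cderivableM dzz (dB iM iN).
  have d0 := cderivableD (cderivable_cst (dz' l) y k) (dN iN iM).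
  have -> : (fun y => dz' l - base_ext (G iN iM (base_pt y)) l
      + z'fun y * (base_ext (G iP iP (base_pt y)) l - base_ext (G iK iK (base_pt y)) l)
      + z'fun y ^+ 2 * base_ext (G iM iN (base_pt y)) l) =
    (fun y => dz' l - base_ext (G iN iM (base_pt y)) l
      + z'fun y * (base_ext (G iP iP (base_pt y)) l - base_ext (G iK iK (base_pt y)) l)
      + z'fun y * z'fun y * base_ext (G iM iN (base_pt y)) l).
    by apply/funext => t; rewrite expr2.
  rewrite (cpartialD (cderivableD d0 d2) d3) (cpartialD d0 d2).
  rewrite (cpartialD (cderivable_cst (dz' l) y k) (dN iN iM)) cpartial_cst.
  rewrite (cpartialM dz d1) (cpartialM dzz (dB iM iN)) (cpartialM dz dz).
  rewrite (cpartialD (dB iP iP) (dN iK iK)) !(cpartialN (dB _ _)) !(B _ _).2 ez.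
  by rewrite z'funE !base_ptE; ring.
rewrite !P /e !form_E'E z'funE !base_ptE.
rewrite /base_ext2 /base_ext /Theta /form2_at /eps /beta.
case: (fintype.split c) => [a|a]; case: (fintype.split d) => [b|b];
  rewrite ?ext_d1E; ring.
Qed.

Section FiveForm.
Variables (Lam Phi : tensor R (4 + 4) 1) (z z' : C) (lam phi : 'I_4 -> C).
Let y := PPcoords x z z'.
Hypothesis LamE : form1_at Lam y = base_ext lam.
Hypothesis PhiE : form1_at Phi y = base_ext phi.

(** The space of 4-forms in dimension four is a line. The component functions are packed as constant
    tensor fields so that [wedge_alt] applies. *)
Lemma wedge211_top (w : 'I_4 -> 'I_4 -> C) (f g : 'I_4 -> C) :
  (forall a b, w a b = - w b a) -> wedge211 w f g iM iP iN iK = 0 ->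
  forall a b c d, wedge211 w f g a b c d = 0.
Proof.
move=> wN w0 a b c d.
pose W : tensor R 4 2 := fun _ v => w (v ord0) (v ord_max).
pose F : tensor R 4 1 := fun _ v => f (v ord0).
pose H : tensor R 4 1 := fun _ v => g (v ord0).
have Walt : alt_at W x by apply: alt_at2 => i j; exact: wN.
pose T v := (W /^\ F /^\ H)%ff x v.
have TE (u : nat -> 'I_4) : T (fun i => u i) = wedge211 w f g (u 0%N) (u 1%N) (u 2%N) (u 3%N).
  exact: wedge211E.
have T0 : T id = 0.
  have -> : id = (fun i : 'I_4 => inord i : 'I_4).
    by apply/funext => i; rewrite /= inord_val.
  rewrite (TE inord) -[RHS]w0.
  by congr wedge211; apply: val_inj; rewrite /= inordK.
have Talt v (s : 'S_4) : T (v \o s) = (-1) ^+ s * T v by exact: wedge_alt.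
have := alternating_top_eq0 Talt T0.
pose u m := nth a [:: a; b; c; d] m.
by move=> /(_ (fun i => u i)); rewrite TE.
Qed.

(** The final factor [E'] kills [E' /\ beta], which leaves [Theta /\ Lam /\ Phi /\ E'] with the
    first three factors pulled back from the base. As [E'] does not vanish on the fibre, the base
    4-form must be zero. *)
Lemma twistor_5form_eq0 :
  (forall v, (ext_d (form_E' Gam) /^\ Lam /^\ Phi /^\ form_E' Gam)%ff y v = 0) <->
  wedge211 (Theta x z') lam phi iM iP iN iK = 0.
Proof.
have D : form2_at (ext_d (form_E' Gam)) y = fun c d => base_ext2 (Theta x z') c d
    + (form1_at (form_E' Gam) y c * base_ext (beta x z') d
       - form1_at (form_E' Gam) y d * base_ext (beta x z') c).
  by apply/funext => c; apply/funext => d; exact: dE'E.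
split=> [H|H0 v].
  (* The test vectors are the four base directions and the direction of [Re z'], on which [E'] is 1
     and every pulled-back form is 0. *)
  pose u m : 'I_(4 + 4) := if (m < 4)%N then lshift 4 (inord m) else rshift 4 o2.
  have := H (fun i => u i); rewrite (wedge2111E _ _ _ (ext_d1_alt _ _)) D LamE PhiE.
  set e := form1_at (form_E' Gam) y.
  have eK : e (u 4%N) = 1.
    rewrite /e form_E'E /base_ext (unsplitK (inr o2)) /dz' eqxx eq_rshift /=.
    by rewrite !subr0 !mulr0 !addr0.
  have B (f : 'I_4 -> C) m : (m < 4)%N -> base_ext f (u m) = f (inord m).
    by move=> m4; rewrite /base_ext /u m4 (unsplitK (inl _)).
  have B4 (f : 'I_4 -> C) : base_ext f (u 4%N) = 0 by rewrite /base_ext /u (unsplitK (inr _)).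
  rewrite /wedge2111 /wedge211 /wedge21 /base_ext2 !B4 !(B _ 0%N isT) !(B _ 1%N isT)
    !(B _ 2%N isT) !(B _ 3%N isT) !B4 !eK.
  have i0 : inord 0 = iM by apply: val_inj; rewrite /= inordK.
  have i1 : inord 1 = iP by apply: val_inj; rewrite /= inordK.
  have i2 : inord 2 = iN by apply: val_inj; rewrite /= inordK.
  have i3 : inord 3 = iK by apply: val_inj; rewrite /= inordK.
  by rewrite i0 i1 i2 i3 => <-; ring.
pose u m := v (inord m : 'I_(4.+1)).
have -> : v = (fun i : 'I_(2 + 1 + 1 + 1) => u i).
  by apply/funext => i; rewrite /u inord_val.
rewrite (wedge2111E Lam Phi (form_E' Gam) (ext_d1_alt _ y) u) D LamE PhiE.
have W0 i j k l : wedge211 (base_ext2 (Theta x z')) (base_ext lam) (base_ext phi) i j k l = 0.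
  have := wedge211_top (ThetaN z') H0.
  rewrite /wedge211 /wedge21 /base_ext2 /base_ext => W.
  case: (fintype.split i) => [a|a]; case: (fintype.split j) => [b|b];
    case: (fintype.split k) => [c|c]; case: (fintype.split l) => [d|d];
    rewrite ?W //; ring.
move: (u 0%N) (u 1%N) (u 2%N) (u 3%N) (u 4%N) => i j k l m.
have := W0 i j k l; have := W0 i j k m; have := W0 i j l m; have := W0 i k l m.
have := W0 j k l m.
move: (base_ext2 _) (base_ext lam) (base_ext phi) (base_ext (beta _ _)) (form1_at _ y) => T f g b e.
move=> E1 E2 E3 E4 E5.
(* The two sides differ by [E' /\ beta] wedged with a product that contains [E'] again. *)
transitivity (wedge2111 T f g e i j k l m); last first.
  by rewrite /wedge2111 E1 E2 E3 E4 E5; ring.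
by rewrite /wedge2111 /wedge211 /wedge21; ring.
Qed.

End FiveForm.

End Twistor.

(** * Connections and curvature *)

Section LinearCombination.
Variable F : pzRingType.

(** With [eq_add] and [eq_scale] this acts as a linear-combination tactic: hypotheses are combined
    into one equation [l = r], and a polynomial identity is left for [ring] or [field]. *)
Lemma eq_lincomb (x y l r : F) : l = r -> x - y = l - r -> x = y.
Proof. by move=> -> /eqP; rewrite subrr subr_eq0 => /eqP. Qed.

Lemma eq_add (a b c d : F) : a = b -> c = d -> a + c = b + d.
Proof. by move=> -> ->. Qed.

Lemma eq_scale (k a b : F) : a = b -> k * a = k * b.
Proof. by move=> ->. Qed.

End LinearCombination.

(** Unlike [mxE], these entry rules leave the entries of matrix products folded, so noncommutative
    monomials become atoms for [ring]. *)
Lemma mx0E (Z : zmodType) p q i j : (0 : 'M[Z]_(p, q)) i j = 0.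
Proof. by rewrite mxE. Qed.

Lemma mxaddE (Z : zmodType) p q (A B : 'M[Z]_(p, q)) i j : (A + B) i j = A i j + B i j.
Proof. by rewrite mxE. Qed.

Lemma mxoppE (Z : zmodType) p q (A : 'M[Z]_(p, q)) i j : (- A) i j = - A i j.
Proof. by rewrite mxE. Qed.

(** * Calculus of matrix-valued functions *)

Section MatrixFunctions.
Variables (R : realType) (n : nat).
Local Notation C := R[i].
Implicit Types (U V : set 'rV[R]_n).

Definition mpartial p q (i : 'I_n) (M : 'rV[R]_n -> 'M[C]_(p, q)) x :=
  \matrix_(a, b) cpartial i (fun y => M y a b) x.

Definition msmooth p q U (M : 'rV[R]_n -> 'M[C]_(p, q)) :=
  forall a b, csmooth U (fun x => M x a b).

Lemma msmooth_ext p q U (M N : 'rV[R]_n -> 'M[C]_(p, q)) : open U ->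
  (forall x, U x -> M x = N x) -> msmooth U M -> msmooth U N.
Proof. by move=> oU MN sM a b; apply: csmooth_ext (sM a b) => // x /MN ->. Qed.

Lemma msmooth_sub p q U V (M : 'rV[R]_n -> 'M[C]_(p, q)) : V `<=` U ->
  msmooth U M -> msmooth V M.
Proof. by move=> VU sM a b; exact: csmooth_sub (sM a b). Qed.

Lemma msmooth_cst p q U (M : 'M[C]_(p, q)) : msmooth U (fun=> M).
Proof. by move=> a b; exact: csmooth_cst. Qed.

Lemma msmoothD p q U (M N : 'rV[R]_n -> 'M[C]_(p, q)) : open U ->
  msmooth U M -> msmooth U N -> msmooth U (fun x => M x + N x).
Proof.
move=> oU sM sN a b; apply: csmooth_ext (csmoothD oU (sM a b) (sN a b)) => // x _.
by rewrite mxE.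
Qed.

Lemma msmoothN p q U (M : 'rV[R]_n -> 'M[C]_(p, q)) : open U ->
  msmooth U M -> msmooth U (fun x => - M x).
Proof.
move=> oU sM a b; apply: csmooth_ext (csmoothN oU (sM a b)) => // x _.
by rewrite mxE.
Qed.

Lemma msmoothZ p q U (f : 'rV[R]_n -> C) (M : 'rV[R]_n -> 'M[C]_(p, q)) : open U ->
  csmooth U f -> msmooth U M -> msmooth U (fun x => f x *: M x).
Proof.
move=> oU sf sM a b; apply: csmooth_ext (csmoothM oU sf (sM a b)) => // x _.
by rewrite mxE.
Qed.

Lemma msmoothM p q r U (M : 'rV[R]_n -> 'M[C]_(p, q)) (N : 'rV[R]_n -> 'M[C]_(q, r)) :
  open U -> msmooth U M -> msmooth U N -> msmooth U (fun x => M x *m N x).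
Proof.
move=> oU sM sN a b.
have s := csmooth_sum (index_enum 'I_q) predT oU (fun k => csmoothM oU (sM a k) (sN k b)).
by apply: csmooth_ext s => // x _; rewrite mxE.
Qed.

Lemma msmooth_tr p q U (M : 'rV[R]_n -> 'M[C]_(p, q)) : open U ->
  msmooth U M -> msmooth U (fun x => (M x)^T).
Proof. by move=> oU sM a b; apply: csmooth_ext (sM b a) => // x _; rewrite mxE. Qed.

Lemma csmooth_det p U (M : 'rV[R]_n -> 'M[C]_p) : open U -> msmooth U M ->
  csmooth U (fun x => \det (M x)).
Proof.
move=> oU sM.
have s := csmooth_sum (index_enum _) predT oU (fun s : 'S_p =>
  csmoothM oU (csmooth_cst U ((-1) ^+ s))
   (csmooth_prod (index_enum _) predT oU (fun i => sM i (s i)))).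
by apply: csmooth_ext s.
Qed.

(** Cramer's formula: the inverse is the adjugate, polynomial in the entries, divided by the
    determinant. *)
Lemma msmooth_inv p U (M : 'rV[R]_n -> 'M[C]_p) : open U ->
  (forall x, U x -> \det (M x) != 0) -> msmooth U M -> msmooth U (fun x => invmx (M x)).
Proof.
move=> oU M0 sM a b.
have sd := csmoothV oU M0 (csmooth_det oU sM).
have sa : csmooth U (fun x => \adj (M x) a b).
  have sc : msmooth U (fun x => row' b (col' a (M x))).
    by move=> i j; apply: csmooth_ext (sM (lift b i) (lift a j)) => // x _; rewrite !mxE.
  apply: csmooth_ext (csmoothM oU (csmooth_cst U ((-1) ^+ (b + a))) (csmooth_det oU sc)) => // x _.
  by rewrite mxE.
apply: csmooth_ext (csmoothM oU sd sa) => // x Ux.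
by rewrite /invmx unitmxE unitfE M0 // [in RHS]mxE.
Qed.

Lemma mpartial_cst p q i (M : 'M[C]_(p, q)) x : mpartial i (fun=> M) x = 0.
Proof. by apply/matrixP => a b; rewrite !mxE cpartial_cst. Qed.

Lemma mpartial_ext p q U (M N : 'rV[R]_n -> 'M[C]_(p, q)) x i : open U -> U x ->
  (forall y, U y -> M y = N y) -> mpartial i M x = mpartial i N x.
Proof.
by move=> oU Ux MN; apply/matrixP => a b; rewrite !mxE; apply: cpartial_ext oU Ux _ => y /MN ->.
Qed.

Lemma mpartialD p q U (M N : 'rV[R]_n -> 'M[C]_(p, q)) x i : msmooth U M -> msmooth U N -> U x ->
  mpartial i (fun y => M y + N y) x = mpartial i M x + mpartial i N x.
Proof.
move=> sM sN Ux; apply/matrixP => a b; rewrite !mxE -cpartialD.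
- by apply: cpartial_eq => y; rewrite mxE.
- exact: csmooth_derivable (sM a b) Ux.
- exact: csmooth_derivable (sN a b) Ux.
Qed.

Lemma mpartialN p q U (M : 'rV[R]_n -> 'M[C]_(p, q)) x i : msmooth U M -> U x ->
  mpartial i (fun y => - M y) x = - mpartial i M x.
Proof.
move=> sM Ux; apply/matrixP => a b; rewrite !mxE -cpartialN.
- by apply: cpartial_eq => y; rewrite mxE.
- exact: csmooth_derivable (sM a b) Ux.
Qed.

Lemma mpartialM p q r U (M : 'rV[R]_n -> 'M[C]_(p, q)) (N : 'rV[R]_n -> 'M[C]_(q, r)) x i :
  msmooth U M -> msmooth U N -> U x ->
  mpartial i (fun y => M y *m N y) x = mpartial i M x *m N x + M x *m mpartial i N x.
Proof.
move=> sM sN Ux; apply/matrixP => a b; rewrite !mxE -big_split /=.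
have dM k := csmooth_derivable i (sM a k) Ux.
have dN k := csmooth_derivable i (sN k b) Ux.
rewrite (eq_bigr (fun k => cpartial i (fun y => M y a k * N y k b) x)); last first.
  by move=> k _; rewrite (cpartialM (dM k) (dN k)) !mxE.
rewrite -(cpartial_sum _ _ (fun k => cderivableM (dM k) (dN k))).
by apply: cpartial_eq => y; rewrite mxE.
Qed.

Lemma mpartial_tr p q (M : 'rV[R]_n -> 'M[C]_(p, q)) x i :
  mpartial i (fun y => (M y)^T) x = (mpartial i M x)^T.
Proof.
apply/matrixP => a b; rewrite !mxE; apply: cpartial_eq => y; exact: mxE.
Qed.

Lemma msmooth_mpartial p q U (M : 'rV[R]_n -> 'M[C]_(p, q)) i : open U ->
  msmooth U M -> msmooth U (mpartial i M).
Proof.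
move=> oU sM a b; apply: csmooth_ext (csmooth_cpartial i (sM a b)) => // x _.
by rewrite mxE.
Qed.

Lemma mpartialC p q U (M : 'rV[R]_n -> 'M[C]_(p, q)) x i j : open U -> msmooth U M -> U x ->
  mpartial j (mpartial i M) x = mpartial i (mpartial j M) x.
Proof.
move=> oU sM Ux; apply/matrixP => a b; rewrite [LHS]mxE [RHS]mxE.
have E k : (fun y => mpartial k M y a b) = cpartial k (fun y => M y a b).
  by apply/funext => y; rewrite mxE.
by rewrite !E; exact: cpartialC (sM a b) Ux.
Qed.

End MatrixFunctions.

Ltac mxexpand := rewrite ?(mulmxDl, mulmxDr, mulmxBl, mulmxBr, mulNmx, mulmxN, mulmxA);
  apply/matrixP => ? ?; rewrite ?(mxaddE, mxoppE, mx0E).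

Section Connection.
Variable R : realType.
Local Notation C := R[i].
Local Notation form k := (tensor R 4 k).
Implicit Types (V : set 'rV[R]_4) (g : form 2) (A : form 1) (th : 'I_4 -> form 1).
Implicit Types (Gam : 'I_4 -> 'I_4 -> form 1).

(** For a fixed coordinate direction the connection is a matrix and the coframe a column, so that
    the structure equations become matrix equations between partial derivatives. *)
Definition conn_mx Gam (a : 'I_4) (x : 'rV[R]_4) : 'M[C]_4 :=
  \matrix_(i, j) form1_at (Gam i j) x a.

Definition coframe_col th (a : 'I_4) (x : 'rV[R]_4) : 'cV[C]_4 := col a (coframe_mx th x).

Definition curv_mx Gam (a b : 'I_4) (x : 'rV[R]_4) : 'M[C]_4 :=
  mpartial a (conn_mx Gam b) x - mpartial b (conn_mx Gam a) x
  + (conn_mx Gam a x *m conn_mx Gam b x - conn_mx Gam b x *m conn_mx Gam a x).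

Lemma curv_formE Gam h j x a b :
  curv_form Gam h j x (pair_idx a b) = curv_mx Gam a b x h j.
Proof.
rewrite /curv_form ext_d1E /curv_mx !mxE; congr (_ - _ + _).
- by apply: cpartial_eq => y; rewrite mxE.
- by apply: cpartial_eq => y; rewrite mxE.
rewrite -sumrB; apply: eq_bigr => k _.
by rewrite wedge11E !mxE.
Qed.

Lemma form1_eta k (a : tensor R k 1) x (v : 'I_1 -> 'I_k) : a x v = form1_at a x (v ord0).
Proof. by rewrite /form1_at; congr (a x _); apply/funext => i; rewrite ord1. Qed.

Lemma weyl_connectionP V g A th Gam :
  weyl_connection V g A th Gam <->
  [/\ forall a, msmooth V (conn_mx Gam a),
      forall a x, V x -> mpartial a (gdown g th) x
        - gdown g th x *m conn_mx Gam a x - (gdown g th x *m conn_mx Gam a x)^T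
        = - (form1_at A x a *: gdown g th x)
    & forall a b x, V x ->
        mpartial a (coframe_col th b) x - mpartial b (coframe_col th a) x
        = - (conn_mx Gam a x *m coframe_col th b x
             - conn_mx Gam b x *m coframe_col th a x)].
Proof.
have T i a b x : ext_d (th i) x (pair_idx a b) =
    (mpartial a (coframe_col th b) x - mpartial b (coframe_col th a) x) i 0.
  by rewrite ext_d1E !mxE; congr (_ - _); apply: cpartial_eq => y; rewrite !mxE.
have W i a b x : \sum_j (Gam i j /^\ th j)%ff x (pair_idx a b) =
    (conn_mx Gam a x *m coframe_col th b x - conn_mx Gam b x *m coframe_col th a x) i 0.
  by rewrite !mxE -sumrB; apply: eq_bigr => j _; rewrite wedge11E !mxE.
have D i j a x : ext_d (form0 (fun y => gdown g th y i j)) x (fun=> a)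
        - \sum_k gdown g th x i k * Gam k j x (fun=> a)
        - \sum_k gdown g th x j k * Gam k i x (fun=> a) =
    (mpartial a (gdown g th) x
        - gdown g th x *m conn_mx Gam a x - (gdown g th x *m conn_mx Gam a x)^T) i j.
  rewrite -[ext_d _ _ _]/(form1_at _ x a) ext_d0E !mxE.
  by congr (_ - _ - _); apply: eq_bigr => k _; rewrite !mxE.
split=> [[s m t]|[s m t]]; split.
- by move=> a i j; have := s i j (fun=> a); apply: csmooth_ext_fun => y; rewrite mxE.
- move=> a x Vx; apply/matrixP => i j; rewrite -D (m _ _ _ Vx) !mxE.
  by rewrite /form1_at.
- move=> a b x Vx; apply/matrixP => i j; rewrite (ord1 j) -T (t _ _ Vx) W.
  by rewrite [in RHS]mxE.
- by move=> i j v; have := s (v ord0) i j; apply: csmooth_ext_fun => y; rewrite mxE form1_eta.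
- move=> i j x Vx v; rewrite (_ : v = fun=> v ord0); last by apply/funext => p; rewrite ord1.
  by rewrite D (m _ _ Vx) !mxE.
- move=> i x Vx v; rewrite (pair_idx_eta v) T (t _ _ _ Vx) W.
  by rewrite mxE.
Qed.

End Connection.

(** * Matrix identities for the Bianchi identity and for gauge changes *)

Section MatrixIdentities.
Variables (F : comNzRingType) (n : nat).

(** This is [d (d theta) = 0]. The second derivatives [u], [v], [w] cancel in the sum of the three
    differentiated torsion equations, and the remaining first derivatives of the coframe are removed
    by the torsion equations multiplied by a connection matrix. *)
Lemma first_bianchi_mx (Ga Gb Gc Gab Gba Gbc Gcb Gca Gac : 'M[F]_n)
    (ta tb tc tab tba tbc tcb tca tac u v w : 'cV[F]_n) :
  u - v = - (Gca *m tb + Ga *m tcb - Gcb *m ta - Gb *m tca) ->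
  w - u = - (Gab *m tc + Gb *m tac - Gac *m tb - Gc *m tab) ->
  v - w = - (Gbc *m ta + Gc *m tba - Gba *m tc - Ga *m tbc) ->
  tab - tba = - (Ga *m tb - Gb *m ta) ->
  tbc - tcb = - (Gb *m tc - Gc *m tb) ->
  tca - tac = - (Gc *m ta - Ga *m tc) ->
  (Gab - Gba + (Ga *m Gb - Gb *m Ga)) *m tc + (Gbc - Gcb + (Gb *m Gc - Gc *m Gb)) *m ta
  + (Gca - Gac + (Gc *m Ga - Ga *m Gc)) *m tb = 0.
Proof.
move=> T1 T2 T3 /(congr1 (mulmx Gc)) t1 /(congr1 (mulmx Ga)) t2 /(congr1 (mulmx Gb)) t3.
have E : (u - v) + (w - u) + (v - w) = 0 by mxexpand; ring.
rewrite {}T1 {}T2 {}T3 in E.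
apply/matrixP => i j; move: E t1 t2 t3; rewrite !(mulmxDl, mulmxDr, mulmxN, mulNmx, mulmxA).
move=> /matrixP/(_ i j) + /matrixP/(_ i j) + /matrixP/(_ i j) + /matrixP/(_ i j).
rewrite ?(mxaddE, mxoppE, mx0E) => E E1 E2 E3.
by apply: (eq_lincomb (eq_add (eq_scale (-1) E) (eq_add E1 (eq_add E2 E3)))); ring.
Qed.

(* The change of connection [G' = L (G K + dK)] under [th' = L th], [K = L^-1],
   written with [K G'] so that [L] is never differentiated. *)
Lemma curvature_gauge_mx (K Ka Kb Kab Ga Gb Gab Gba Ga' Gb' Gab' Gba' : 'M[F]_n) :
  K *m Ga' = Ga *m K + Ka -> K *m Gb' = Gb *m K + Kb ->
  Ka *m Gb' + K *m Gab' = Gab *m K + Gb *m Ka + Kab ->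
  Kb *m Ga' + K *m Gba' = Gba *m K + Ga *m Kb + Kab ->
  K *m (Gab' - Gba' + (Ga' *m Gb' - Gb' *m Ga')) =
  (Gab - Gba + (Ga *m Gb - Gb *m Ga)) *m K.
Proof.
move=> Ea Eb Eab Eba.
have Ea2 := congr1 (mulmx^~ Gb') Ea; have Eb2 := congr1 (mulmx^~ Ga') Eb.
have Ea3 := congr1 (mulmx Gb) Ea; have Eb3 := congr1 (mulmx Ga) Eb.
move: Ea2 Eb2 Ea3 Eb3 Eab Eba; rewrite /= !(mulmxDl, mulmxDr, mulmxN, mulNmx, mulmxA).
move=> /matrixP Ea2 /matrixP Eb2 /matrixP Ea3 /matrixP Eb3 /matrixP Eab /matrixP Eba.
apply/matrixP => i j; move: (Ea2 i j) (Eb2 i j) (Ea3 i j) (Eb3 i j) (Eab i j) (Eba i j).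
rewrite ?(mxaddE, mxoppE) => H1 H2 H3 H4 H5 H6.
apply: (eq_lincomb (eq_add (eq_add H1 (eq_scale (-1) H2)) (eq_add (eq_add H4 (eq_scale (-1) H3))
  (eq_add H5 (eq_scale (-1) H6))))); ring.
Qed.

Lemma metric_gauge_mx (G dG Ga k dk : 'M[F]_n) (c : F) : G^T = G ->
  dG - G *m Ga - (G *m Ga)^T = - (c *: G) ->
  (dk^T *m G + k^T *m dG) *m k + k^T *m G *m dk
    - k^T *m G *m (Ga *m k + dk) - (k^T *m G *m (Ga *m k + dk))^T
  = - (c *: (k^T *m G *m k)).
Proof.
move=> Gs /(congr1 (fun X => k^T *m X *m k)).
have trD (X Y : 'M[F]_n) : (X + Y)^T = X^T + Y^T by apply/matrixP => i j; rewrite !mxE.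
rewrite !(trmx_mul, trD, trmxK) Gs.
rewrite !(mulmxDl, mulmxDr, mulmxN, mulNmx, mulmxA) -scalemxAr -scalemxAl.
move=> /matrixP E; apply/matrixP => i j; move: (E i j).
rewrite !(mxaddE, mxoppE) => H.
by apply: (eq_lincomb H); ring.
Qed.

Lemma torsion_gauge_mx (k l ka kb Ga Gb Ga' Gb' : 'M[F]_n) (ta tb tab tba : 'cV[F]_n) :
  l *m k = 1%:M -> k *m Ga' = Ga *m k + ka -> k *m Gb' = Gb *m k + kb ->
  (ka *m tb + k *m tab) - (kb *m ta + k *m tba) = - (Ga *m (k *m tb) - Gb *m (k *m ta)) ->
  tab - tba = - (Ga' *m tb - Gb' *m ta).
Proof.
move=> lk Ea Eb E; rewrite -[LHS]mul1mx -[RHS]mul1mx -lk -!mulmxA; congr (l *m _).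
rewrite mulmxN (mulmxBr k (Ga' *m tb)) !(mulmxA k) Ea Eb.
move: E; rewrite !(mulmxDl, mulmxDr, mulmxN, mulNmx, mulmxA).
move=> /matrixP E; apply/matrixP => i j; move: (E i j).
rewrite !(mxaddE, mxoppE) => H.
by apply: (eq_lincomb H); ring.
Qed.

End MatrixIdentities.

Section Geometry.
Variable R : realType.
Local Notation C := R[i].
Local Notation form k := (tensor R 4 k).
Implicit Types (V : set 'rV[R]_4) (g : form 2) (A : form 1) (th : 'I_4 -> form 1).
Implicit Types (Gam : 'I_4 -> 'I_4 -> form 1).

Lemma coframe_unit V th x : coframe V th -> V x -> coframe_mx th x \in unitmx.
Proof. by move=> [_ _ d] Vx; rewrite unitmxE unitfE d. Qed.

Lemma coframe_smooth V th : coframe V th -> msmooth V (coframe_mx th).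
Proof. by move=> [_ s _] i a; apply: csmooth_ext_fun (s i (fun=> a)) => x; rewrite mxE. Qed.

Lemma frame_smooth V th : coframe V th -> msmooth V (frame_mx th).
Proof. by move=> cth; have [oV _ d] := cth; apply: msmooth_inv => //; exact: coframe_smooth. Qed.

Lemma coframe_col_smooth V th a : coframe V th -> msmooth V (coframe_col th a).
Proof.
by move=> /coframe_smooth s i j; apply: csmooth_ext_fun (s i a) => x; rewrite mxE.
Qed.

Lemma mulmx_coframe_frame V th x : coframe V th -> V x -> coframe_mx th x *m frame_mx th x = 1%:M.
Proof. by move=> c Vx; rewrite mulmxV //; exact: coframe_unit Vx. Qed.

Lemma mulmx_frame_coframe V th x : coframe V th -> V x -> frame_mx th x *m coframe_mx th x = 1%:M.
Proof. by move=> c Vx; rewrite mulVmx //; exact: coframe_unit Vx. Qed.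

Lemma curv_mxN Gam a b x : curv_mx Gam a b x = - curv_mx Gam b a x.
Proof. by rewrite /curv_mx; mxexpand; ring. Qed.

Section Bianchi.
Variables (V : set 'rV[R]_4) (g : form 2) (A : form 1) (th : 'I_4 -> form 1).
Variable Gam : 'I_4 -> 'I_4 -> form 1.
Hypothesis cth : coframe V th.
Hypothesis wc : weyl_connection V g A th Gam.

Let oV : open V. Proof. by case: cth. Qed.
Let sG a : msmooth V (conn_mx Gam a).
Proof. by have /weyl_connectionP[s _ _] := wc. Qed.
Let sth a := coframe_col_smooth a cth.

Lemma torsion_partial a b c x : V x ->
  mpartial c (mpartial a (coframe_col th b)) x - mpartial c (mpartial b (coframe_col th a)) x
  = - (mpartial c (conn_mx Gam a) x *m coframe_col th b x
       + conn_mx Gam a x *m mpartial c (coframe_col th b) x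
       - mpartial c (conn_mx Gam b) x *m coframe_col th a x
       - conn_mx Gam b x *m mpartial c (coframe_col th a) x).
Proof.
move=> Vx; have /weyl_connectionP[_ _ t] := wc.
have sd i j := msmooth_mpartial i oV (sth j).
have := mpartial_ext c oV Vx (fun y Vy => t a b y Vy).
rewrite (mpartialD c (sd a b) (msmoothN oV (sd b a)) Vx) (mpartialN c (sd b a) Vx).
have sM i j := msmoothM oV (sG i) (sth j).
rewrite (mpartialN c (msmoothD oV (sM a b) (msmoothN oV (sM b a))) Vx).
rewrite (mpartialD c (sM a b) (msmoothN oV (sM b a)) Vx) (mpartialN c (sM b a) Vx).
rewrite (mpartialM c (sG a) (sth b) Vx) (mpartialM c (sG b) (sth a) Vx) => ->.
by congr (- _); rewrite opprD addrA.
Qed.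

Lemma first_bianchi a b c x : V x ->
  curv_mx Gam a b x *m coframe_col th c x + curv_mx Gam b c x *m coframe_col th a x
  + curv_mx Gam c a x *m coframe_col th b x = 0.
Proof.
move=> Vx; have /weyl_connectionP[_ _ t] := wc.
(* Commuting second partials makes the three differentiated equations share only three second
   derivatives. *)
have S i j k : mpartial i (mpartial j (coframe_col th k)) x = mpartial j (mpartial i (coframe_col th k)) x.
  exact: mpartialC oV (sth k) Vx.
have T2 := torsion_partial b c a Vx; rewrite -[X in _ - X](S c a b) in T2.
have T3 := torsion_partial c a b Vx.
rewrite [X in X - _](S b c a) -[X in _ - X](S a b c) in T3.
exact: first_bianchi_mx (torsion_partial a b c Vx) T2 T3
  (t a b x Vx) (t b c x Vx) (t c a x Vx).
Qed.

End Bianchi.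
Section CoframeChange.
Variables (V V' : set 'rV[R]_4) (g : form 2) (A : form 1) (th th' : 'I_4 -> form 1).
Variable Gam : 'I_4 -> 'I_4 -> form 1.
Hypothesis cth : coframe V th.
Hypothesis cth' : coframe V' th'.
Hypothesis V'V : V' `<=` V.
Hypothesis sg : msmooth V (tensor2_mx g).
Hypothesis gsym : forall x, V x -> (tensor2_mx g x)^T = tensor2_mx g x.
Hypothesis wc : weyl_connection V g A th Gam.

Definition coframe_change x := coframe_mx th x *m frame_mx th' x.
Definition coframe_change_inv x := coframe_mx th' x *m frame_mx th x.
Local Notation K := coframe_change.
Local Notation L := coframe_change_inv.

(** The gauge transform of [Gam] under [th = K th'], in the order [L (Gam K + dK)], so that
    multiplying by [K] removes [L] before anything is differentiated. *)
Definition changed_connection (i j : 'I_4) : form 1 := fun x v =>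
  (L x *m (conn_mx Gam (v ord0) x *m K x + mpartial (v ord0) K x)) i j.
Local Notation Gam' := changed_connection.

Let oV : open V. Proof. by case: cth. Qed.
Let oV' : open V'. Proof. by case: cth'. Qed.

Lemma conn_mx_changed a x :
  conn_mx Gam' a x = L x *m (conn_mx Gam a x *m K x + mpartial a K x).
Proof. by apply/matrixP => i j; rewrite mxE. Qed.

Lemma mulmx_changeV x : V' x -> L x *m K x = 1%:M.
Proof.
move=> V'x; rewrite /L mulmxA -(mulmxA (coframe_mx th' x)).
by rewrite (mulmx_frame_coframe cth (V'V V'x)) mulmx1 (mulmx_coframe_frame cth' V'x).
Qed.

Lemma mulmx_change x : V' x -> K x *m L x = 1%:M.
Proof. by move=> V'x; apply: mulmx1C; exact: mulmx_changeV. Qed.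

Lemma frame_mx_change x : V' x -> frame_mx th' x = frame_mx th x *m K x.
Proof. by move=> V'x; rewrite mulmxA (mulmx_frame_coframe cth (V'V V'x)) mul1mx. Qed.

Lemma coframe_mx_change x : V' x -> coframe_mx th x = K x *m coframe_mx th' x.
Proof. by move=> V'x; rewrite -mulmxA (mulmx_frame_coframe cth' V'x) mulmx1. Qed.

Lemma coframe_col_change a x : V' x -> coframe_col th a x = K x *m coframe_col th' a x.
Proof.
move=> V'x; rewrite /coframe_col coframe_mx_change //.
by move: (K x) (coframe_mx th' x) => X Y; rewrite !colE mulmxA.
Qed.

Lemma gdown_change x : V' x -> gdown g th' x = (K x)^T *m gdown g th x *m K x.
Proof. by move=> V'x; rewrite /gdown (frame_mx_change V'x) trmx_mul !mulmxA. Qed.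

Let sK : msmooth V' K.
Proof.
apply: msmoothM oV' (msmooth_sub V'V (coframe_smooth cth)) _; exact: frame_smooth cth'.
Qed.

Let sL : msmooth V' L.
Proof.
apply: msmoothM oV' (coframe_smooth cth') _.
exact: msmooth_sub V'V (frame_smooth cth).
Qed.

Let sG a : msmooth V' (conn_mx Gam a).
Proof. by have /weyl_connectionP[s _ _] := wc; exact: msmooth_sub V'V (s a). Qed.

Let sgd : msmooth V' (gdown g th).
Proof.
have sE := msmooth_sub V'V (frame_smooth cth).
apply: msmoothM oV' _ (sE); apply: msmoothM oV' _ (msmooth_sub V'V sg).
exact: (msmooth_tr oV' sE).
Qed.

Lemma gdown_sym x : V x -> (gdown g th x)^T = gdown g th x.
Proof. by move=> Vx; rewrite /gdown !trmx_mul trmxK gsym // !mulmxA. Qed.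

Lemma changed_smooth a : msmooth V' (conn_mx Gam' a).
Proof.
have s : msmooth V' (fun x => L x *m (conn_mx Gam a x *m K x + mpartial a K x)).
  apply: msmoothM oV' sL _; apply: msmoothD oV' _ (msmooth_mpartial a oV' sK).
  exact: msmoothM oV' (sG a) sK.
by apply: msmooth_ext s => // x _; rewrite conn_mx_changed.
Qed.

Lemma mul_change_conn a x : V' x ->
  K x *m conn_mx Gam' a x = conn_mx Gam a x *m K x + mpartial a K x.
Proof. by move=> V'x; rewrite conn_mx_changed mulmxA mulmx_change // mul1mx. Qed.

Lemma changed_weyl_connection : weyl_connection V' g A th' Gam'.
Proof.
have /weyl_connectionP[_ m t] := wc.
apply/weyl_connectionP; split=> [a|a x V'x|a b x V'x]; first exact: changed_smooth.
  have -> : mpartial a (gdown g th') x =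
      mpartial a (fun x => (K x)^T *m gdown g th x *m K x) x.
    exact: mpartial_ext oV' V'x gdown_change.
  have sKt := msmooth_tr oV' sK.
  rewrite (mpartialM a (msmoothM oV' sKt sgd) sK V'x) (mpartialM a sKt sgd V'x) mpartial_tr.
  rewrite gdown_change // conn_mx_changed.
  have -> : (K x)^T *m gdown g th x *m K x *m
      (L x *m (conn_mx Gam a x *m K x + mpartial a K x)) =
    (K x)^T *m gdown g th x *m (conn_mx Gam a x *m K x + mpartial a K x).
    rewrite -mulmxA; congr (_ *m _).
    by rewrite mulmxA mulmx_change // mul1mx.
  exact: metric_gauge_mx (gdown_sym (V'V V'x)) (m a x (V'V V'x)).
have Eb c d : mpartial c (coframe_col th d) x =
    mpartial c K x *m coframe_col th' d x + K x *m mpartial c (coframe_col th' d) x.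
  rewrite -(mpartialM c sK (coframe_col_smooth d cth') V'x).
  exact: mpartial_ext oV' V'x (fun y => @coframe_col_change d y).
apply: torsion_gauge_mx (mulmx_changeV V'x) (mul_change_conn a V'x) (mul_change_conn b V'x) _.
by rewrite -!Eb t ?(coframe_col_change _ V'x) //; exact: V'V.
Qed.

Lemma mul_change_curv a b x : V' x ->
  K x *m curv_mx Gam' a b x = curv_mx Gam a b x *m K x.
Proof.
move=> V'x.
have D c d : mpartial c K x *m conn_mx Gam' d x + K x *m mpartial c (conn_mx Gam' d) x =
    mpartial c (conn_mx Gam d) x *m K x + conn_mx Gam d x *m mpartial c K x
    + mpartial c (mpartial d K) x.
  rewrite -(mpartialM c sK (changed_smooth d) V'x) -(mpartialM c (sG d) sK V'x).
  rewrite -(mpartialD c (msmoothM oV' (sG d) sK) (msmooth_mpartial d oV' sK) V'x).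
  exact: mpartial_ext oV' V'x (fun y V'y => mul_change_conn d V'y).
have Dba := D b a; rewrite (mpartialC a b oV' sK V'x) in Dba.
exact: curvature_gauge_mx (mul_change_conn a V'x) (mul_change_conn b V'x) (D a b) Dba.
Qed.

End CoframeChange.

(** * Ricci and trace-free tensors under a change of frame *)

Section Ricci.
Variables (g : form 2) (th : 'I_4 -> form 1) (Gam : 'I_4 -> 'I_4 -> form 1).
Variable x : 'rV[R]_4.

(** Lowering and raising the first index cancel, so the Ricci tensor is the contraction of
    [Omega^k_j (e_k, e_l)]; written with rows of the frame matrix, its behaviour under [E -> E K]
    can be read off. *)
Definition ricci_mx (E : 'M[C]_4) (Om : 'I_4 -> 'I_4 -> 'M[C]_4) : 'M[C]_4 :=
  \sum_a \sum_b (row a (E *m Om a b))^T *m row b E.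

Lemma riemE i j k l : riem g th Gam x i j k l = \sum_a \sum_b
  (gdown g th x *m curv_mx Gam a b x) i j * frame_mx th x a k * frame_mx th x b l.
Proof.
rewrite /riem; apply: eq_bigr => a _; apply: eq_bigr => b _; rewrite mxE.
by congr (_ * _ * _); apply: eq_bigr => h _; rewrite curv_formE.
Qed.

Hypothesis gunit : gdown g th x \in unitmx.
Hypothesis gsym : (gdown g th x)^T = gdown g th x.

Lemma ricciE j l : ricci g th Gam x j l =
  ricci_mx (frame_mx th x) (fun a b => curv_mx Gam a b x) j l.
Proof.
rewrite /ricci /ricci_mx summxE exchange_big /=.
under eq_bigr => k _ do under eq_bigr => i _ do rewrite riemE big_distrr /=.
under eq_bigr => k _ do rewrite exchange_big /=.
rewrite exchange_big /=; apply: eq_bigr => a _; rewrite summxE.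
under eq_bigr => k _ do under eq_bigr => i _ do rewrite big_distrr /=.
under eq_bigr => k _ do rewrite exchange_big /=.
rewrite exchange_big /=; apply: eq_bigr => b _.
have guT : (gup g th x)^T = gup g th x by rewrite /gup trmx_inv gsym.
transitivity (\sum_k frame_mx th x a k * (curv_mx Gam a b x) k j * frame_mx th x b l).
  apply: eq_bigr => k _.
  have -> : curv_mx Gam a b x k j =
      (gup g th x *m (gdown g th x *m curv_mx Gam a b x)) k j.
    by rewrite mulmxA mulVmx // mul1mx.
  rewrite mxE big_distrr /= big_distrl /=; apply: eq_bigr => i _.
  by rewrite -[in LHS]guT [_^T i k]mxE; ring.
rewrite !mxE big_ord1 !mxE big_distrl /=.
by apply: eq_bigr => k _.
Qed.

End Ricci.

Lemma invmx_congruence (G K L : 'M[C]_4) : G \in unitmx -> K *m L = 1%:M ->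
  invmx (K^T *m G *m K) = L *m invmx G *m L^T.
Proof.
move=> Gu KL; have LK := mulmx1C KL.
have inv_unique (X Y : 'M[C]_4) : X *m Y = 1%:M -> invmx X = Y.
  by move=> XY; have [u _] := mulmx1_unit XY; rewrite -[LHS]mulmx1 -XY mulKmx.
apply: inv_unique; rewrite !mulmxA -(mulmxA _ K) KL mulmx1 -(mulmxA _ G) mulmxV // mulmx1.
by rewrite -trmx_mul LK trmx1.
Qed.

Lemma traceless_congruence (r t : C) (Ric G K L : 'M[C]_4) : K *m L = 1%:M ->
  L^T *m (r *: (K^T *m Ric *m K + (K^T *m Ric *m K)^T) - t *: (K^T *m G *m K)) *m L
  = r *: (Ric + Ric^T) - t *: G.
Proof.
move=> KL; have cancel X : L^T *m (K^T *m X *m K) *m L = X.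
  by rewrite !mulmxA -trmx_mul KL trmx1 mul1mx -mulmxA KL mulmx1.
have -> : (K^T *m Ric *m K)^T = K^T *m Ric^T *m K by rewrite !trmx_mul trmxK mulmxA.
by rewrite mulmxBr mulmxBl -!scalemxAr -!scalemxAl mulmxDr mulmxDl !cancel.
Qed.

Section STransform.
Variables (g : form 2) (th th' : 'I_4 -> form 1) (Gam Gam' : 'I_4 -> 'I_4 -> form 1).
Variables (x : 'rV[R]_4) (K L : 'M[C]_4).
Hypothesis KL : K *m L = 1%:M.
Hypothesis frameK : frame_mx th' x = frame_mx th x *m K.
Hypothesis gunit : gdown g th x \in unitmx.
Hypothesis gsym : (gdown g th x)^T = gdown g th x.
Hypothesis curvK : forall a b, K *m curv_mx Gam' a b x = curv_mx Gam a b x *m K.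

Let gdownK : gdown g th' x = K^T *m gdown g th x *m K.
Proof. by rewrite /gdown frameK trmx_mul !mulmxA. Qed.

Let KTu : K^T \in unitmx.
Proof. by rewrite unitmx_tr; case/mulmx1_unit: KL. Qed.

Definition ricci_matrix (th0 : 'I_4 -> form 1) Gam0 := \matrix_(i, j) ricci g th0 Gam0 x i j.

Lemma S_tensorE (th0 : 'I_4 -> form 1) Gam0 i j :
  S_tensor g th0 Gam0 x i j =
  (2%:R^-1 *: (ricci_matrix th0 Gam0 + (ricci_matrix th0 Gam0)^T)
   - (\tr ((gup g th0 x)^T *m ricci_matrix th0 Gam0) / 4%:R) *: gdown g th0 x) i j.
Proof.
rewrite /S_tensor !mxE mulrC; congr (_ - _ / _ * _).
rewrite /scalar_curv /mxtrace exchange_big; apply: eq_bigr => p _.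
by rewrite mxE; apply: eq_bigr => q _; rewrite !mxE.
Qed.

(** Conjugation of the curvature by [K] together with the change of frame turns the Ricci matrix
    into [K^T Ric K] and leaves the scalar curvature unchanged. So [S] changes by a congruence,
    which [L] inverts. *)
Lemma S_tensor_change : (forall i j, S_tensor g th' Gam' x i j = 0) ->
  forall i j, S_tensor g th Gam x i j = 0.
Proof.
move=> S0 i j.
have gunit' : gdown g th' x \in unitmx.
  by rewrite gdownK 2!unitmx_mul KTu gunit /=; case/mulmx1_unit: KL.
have gsym' : (gdown g th' x)^T = gdown g th' x.
  by rewrite gdownK 2!trmx_mul trmxK gsym mulmxA.
have RK : ricci_matrix th' Gam' = K^T *m ricci_matrix th Gam *m K.
  have R0 : ricci_matrix th Gam = ricci_mx (frame_mx th x) (fun a b => curv_mx Gam a b x).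
    by apply/matrixP => p q; rewrite mxE ricciE.
  have R1 : ricci_matrix th' Gam' = ricci_mx (frame_mx th' x) (fun a b => curv_mx Gam' a b x).
    by apply/matrixP => p q; rewrite mxE ricciE.
  rewrite R0 R1 /ricci_mx mulmx_sumr mulmx_suml; apply: eq_bigr => a _.
  rewrite mulmx_sumr mulmx_suml; apply: eq_bigr => b _.
  by rewrite frameK -mulmxA curvK mulmxA !row_mul trmx_mul !mulmxA.
have trK : \tr ((gup g th' x)^T *m ricci_matrix th' Gam') =
    \tr ((gup g th x)^T *m ricci_matrix th Gam).
  have -> : gup g th' x = L *m gup g th x *m L^T.
    by rewrite /gup gdownK (invmx_congruence gunit KL).
  rewrite RK !trmx_mul trmxK !mulmxA -(mulmxA (L *m _)) -trmx_mul KL trmx1 mulmx1.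
  by rewrite mxtrace_mulC !mulmxA KL mul1mx.
have E : \matrix_(p, q) S_tensor g th Gam x p q =
    L^T *m (\matrix_(p, q) S_tensor g th' Gam' x p q) *m L.
  have M (th0 : 'I_4 -> form 1) Gam0 : \matrix_(p, q) S_tensor g th0 Gam0 x p q =
    (2%:R^-1 *: (ricci_matrix th0 Gam0 + (ricci_matrix th0 Gam0)^T)
     - (\tr ((gup g th0 x)^T *m ricci_matrix th0 Gam0) / 4%:R) *: gdown g th0 x).
    by apply/matrixP => p q; rewrite mxE S_tensorE.
  by rewrite !M trK RK gdownK (traceless_congruence _ _ _ _ KL).
have /matrixP/(_ i j) := E; rewrite mxE => ->.
rewrite (_ : \matrix_(p, q) S_tensor g th' Gam' x p q = 0).
  by rewrite mulmx0 mul0mx mxE.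
by apply/matrixP => p q; rewrite !mxE S0.
Qed.

End STransform.
End Geometry.

(** * Existence of null cotetrads *)

Section GramFactorization.
Variables (R : realType) (m : nat).
Local Notation C := R[i].

(** Polarisation: if the quadratic form vanished identically, its value at [e_i + e_j] would give
    [2 H i j = 0]. *)
Lemma exists_nonisotropic (F : numFieldType) n (H : 'M[F]_n) : H^T = H -> H != 0 ->
  exists c : 'rV_n, (c *m H *m c^T) 0 0 != 0.
Proof.
move=> Hs; apply: contraNP => /forallNP H0; apply/eqP/matrixP => i j; rewrite mxE.
have Q (c : 'rV_n) : (c *m H *m c^T) 0 0 = 0 by apply/eqP; have /negP := H0 c; rewrite negbK.
have E p q : (delta_mx (0 : 'I_1) p *m H *m (delta_mx (0 : 'I_1) q)^T) 0 0 = H p q.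
  by rewrite trmx_delta -rowE -colE !mxE.
have := Q (delta_mx 0 i + delta_mx 0 j); rewrite linearD /= !mulmxDl !mulmxDr !mxaddE !E.
rewrite -[H i i]E -[H j j]E !Q -{2}Hs mxE add0r addr0 -mulr2n => /eqP.
by rewrite mulrn_eq0 => /eqP.
Qed.

(** [row_ebase c] completes [c], up to a scalar, to a basis, which gives the constant change of
    basis needed for a nonzero pivot. *)
Lemma row_ebase_row (F : fieldType) n (c : 'rV[F]_n.+1) : c != 0 ->
  exists a, c = a *: row 0 (row_ebase c).
Proof.
move=> c0; have := mulmx_ebase c; rewrite rank_rV c0 => E.
exists (col_ebase c 0 0); rewrite -[LHS]E; apply/rowP => j.
rewrite -mulmxA !mxE big_ord1 mxE; congr (_ * _).
rewrite (bigD1 0) //= !mxE eqxx mul1r big1 ?addr0 // => k k0.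
by rewrite !mxE [0 == _]eq_sym /= (_ : (_ == _) = false) ?mul0r //; exact: negbTE k0.
Qed.

Lemma row_quadratic (F : fieldType) p n (B : 'M[F]_(p, n)) (H : 'M[F]_n) i :
  (row i B *m H *m (row i B)^T) 0 0 = (B *m H *m B^T) i i.
Proof. by rewrite -row_mul !mxE; apply: eq_bigr => k _; rewrite !mxE. Qed.

Lemma det_schur (F : fieldType) n (a : F) (b : 'rV[F]_n) (c : 'cV[F]_n) (D : 'M[F]_n) : a != 0 ->
  \det (block_mx a%:M b c D) = a * \det (D - a^-1 *: (c *m b)).
Proof.
move=> a0.
have -> : block_mx a%:M b c D = block_mx 1%:M 0 (a^-1 *: c) 1%:M
    *m block_mx a%:M b 0 (D - a^-1 *: (c *m b)).
  rewrite mulmx_block !mul1mx !mul0mx ?mulmx0 !addr0 -!scalemxAl.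
  by rewrite mul_mx_scalar scalerA mulVf // scale1r [_ + (D - _)]addrC subrK.
by rewrite det_mulmx det_lblock det_ublock !det1 !mul1r det_scalar1.
Qed.

(** Cholesky factorisation with complex roots, by induction on the size. A constant congruence makes
    the first diagonal entry nonzero at [x0]; its smooth root starts the factor, and the Schur
    complement, symmetric and still nondegenerate at [x0], is factored by induction. *)
Lemma msmooth_sqrt_factor n (U : set 'rV[R]_m) (H : 'rV[R]_m -> 'M[C]_n) x0 :
  open U -> U x0 -> msmooth U H -> (forall x, U x -> (H x)^T = H x) ->
  \det (H x0) != 0 ->
  exists V (T : 'rV[R]_m -> 'M[C]_n), [/\ open V, V `<=` U, V x0, msmooth V T &
    forall x, V x -> (T x)^T *m T x = H x].
Proof.
elim: n U H => [|n IH] U H oU Ux0 sH Hs dH.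
  by exists U, (fun=> 0); split=> // [|x _]; [exact: msmooth_cst|rewrite [LHS]flatmx0 [RHS]flatmx0].
have [c cH] : exists c : 'rV_n.+1, (c *m H x0 *m c^T) 0 0 != 0.
  apply: exists_nonisotropic; first exact: Hs.
  by apply: contraNneq dH => ->; rewrite det0.
have c0 : c != 0 by apply: contraNneq cH => ->; rewrite !mul0mx mxE.
have [al Ec] := row_ebase_row c0.
pose B := row_ebase c.
have Bu : B \in unitmx by exact: row_ebase_unit.
pose H' x : 'M[C]_(1 + n) := B *m H x *m B^T.
have sH' : msmooth U H'.
  by apply: (msmoothM oU _ (msmooth_cst _ _)); apply: (msmoothM oU (msmooth_cst _ _) sH).
have H's x : U x -> (H' x)^T = H' x.
  by move=> Ux; rewrite /H' !trmx_mul trmxK Hs // mulmxA.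
pose a x := H' x 0 0.
pose b x : 'rV[C]_n := ursubmx (H' x).
pose D x : 'M[C]_n := drsubmx (H' x).
have H'E x : U x -> H' x = block_mx (a x)%:M (b x) (b x)^T (D x).
  move=> Ux; rewrite -[LHS]submxK; congr block_mx.
    apply/matrixP => i j; rewrite !ord1 [RHS]mxE mulr1n [LHS]mxE [LHS]mxE.
    by congr (H' x _ _); apply: val_inj.
  by rewrite /b trmx_ursub H's.
have ax0 : a x0 != 0.
  apply: contraNneq cH => a0.
  rewrite Ec linearZ /= -scalemxAr -scalemxAl -scalemxAl scalerA mxE.
  suff -> : (row 0 (row_ebase c) *m H x0 *m (row 0 (row_ebase c))^T) 0 0 = 0 by rewrite mulr0.
  by rewrite -[RHS]a0 /a /H' row_quadratic.
have [V1 [s [oV1 V1U V1x ss sE]]] := csmooth_sqrt oU (sH' 0 0) Ux0 ax0.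
(* Shrinking the neighbourhood keeps the pivot invertible. *)
pose V2 := V1 `&` [set y | a y != 0].
have sa1 : csmooth V1 a := csmooth_sub V1U (sH' 0 0).
have oV2 : open V2 by exact: open_sub_neq0.
have V2V1 : V2 `<=` V1 by move=> y [].
have V2U : V2 `<=` U by move=> y /V2V1 /V1U.
have sa : csmooth V2 a by exact: csmooth_sub sa1.
have sb : msmooth V2 b.
  by move=> i j; apply: csmooth_ext_fun ((csmooth_sub V2U (sH' (lshift n i) (rshift 1 j)))) => y; rewrite !mxE.
have sD : msmooth V2 D.
  by move=> i j; apply: csmooth_ext_fun ((csmooth_sub V2U (sH' (rshift 1 i) (rshift 1 j)))) => y; rewrite !mxE.
have sai : csmooth V2 (fun y => (a y)^-1) by exact: csmoothV oV2 (fun y (V2y : V2 y) => V2y.2) sa.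
pose S x := D x - (a x)^-1 *: ((b x)^T *m b x).
have sS : msmooth V2 S.
  apply: (msmoothD oV2 sD _); apply: (msmoothN oV2 _); apply: (msmoothZ oV2 sai _).
  exact: msmoothM oV2 (msmooth_tr oV2 sb) sb.
have Ss x : V2 x -> (S x)^T = S x.
  move=> V2x; have := H's x (V2U _ V2x); rewrite H'E; last exact: V2U.
  rewrite tr_block_mx => /eq_block_mx[_ _ _ Ds].
  by rewrite /S linearB /= linearZ /= trmx_mul trmxK Ds.
have dS : \det (S x0) != 0.
  apply: contraNneq dH => dS0.
  have : \det (H' x0) = 0 by rewrite H'E // det_schur // -/(S x0) dS0 mulr0.
  rewrite /H' !det_mulmx det_tr => /eqP; rewrite !mulf_eq0.
  by move: Bu; rewrite unitmxE unitfE => /negbTE ->; rewrite orbF.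
have V2x0 : V2 x0 by [].
have [V3 [T1 [oV3 V3V2 V3x0 sT1 T1E]]] := IH V2 S oV2 V2x0 sS Ss dS.
have V3U : V3 `<=` U by move=> y /V3V2 /V2U.
have s0 y : V3 y -> s y != 0.
  move=> /V3V2 [V1y]; apply: contraNneq => s0.
  by rewrite /a -(sE y V1y) s0 expr0n.
have ss3 : csmooth V3 s by apply: csmooth_sub (ss) => y /V3V2 /V2V1.
(* Since [s ^+ 2 = a], the product of the transpose with this block matrix has blocks [a], [b],
   [b^T] and [a^-1 b^T b + S = D]. *)
pose T' x : 'M[C]_(1 + n) := block_mx (s x)%:M ((s x)^-1 *: b x) 0 (T1 x).
have sT' : msmooth V3 T'.
  move=> i j; rewrite /T'.
  have ssi := csmoothV oV3 s0 ss3.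
  have sb3 := msmoothZ oV3 ssi (msmooth_sub V3V2 sb).
  case: (split_ordP i) => i' ->; case: (split_ordP j) => j' ->.
  - apply: csmooth_ext_fun (ss3) => y; rewrite block_mxEul !mxE !ord1 eqxx.
    by rewrite mulr1n.
  - by apply: csmooth_ext_fun ((sb3 i' j')) => y; rewrite block_mxEur.
  - by apply: csmooth_ext_fun ((csmooth_cst V3 0)) => y; rewrite block_mxEdl mxE.
  - by apply: csmooth_ext_fun ((sT1 i' j')) => y; rewrite block_mxEdr.
(* The factor of [B H B^T] is carried back to [H] by the inverse of [B^T]. *)
exists V3, (fun x => T' x *m invmx B^T); split => //.
  exact: msmoothM oV3 sT' (msmooth_cst _ _).
move=> x V3x; have V1y := V2V1 _ (V3V2 _ V3x).
have bT (r : C) : (r *: b x)^T = r *: (b x)^T by rewrite linearZ.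
have T'E : (T' x)^T *m T' x = H' x.
  rewrite H'E; last exact: V3U.
  rewrite /T' tr_block_mx mulmx_block !trmx0 !mul0mx !mulmx0 !addr0 T1E // /S.
  rewrite tr_scalar_mx; congr block_mx.
  - by rewrite -scalar_mxM -expr2 sE.
  - by rewrite mul_scalar_mx scalerA mulfV ?scale1r // s0.
  - by rewrite bT mul_mx_scalar scalerA mulfV ?scale1r // s0.
  - rewrite bT -scalemxAl -scalemxAr scalerA -invfM -expr2 sE //.
    by rewrite [_ + (D x - _)]addrC subrK.
rewrite trmx_mul -mulmxA (mulmxA (T' x)^T) T'E /H' trmx_inv trmxK.
by rewrite mulmxK ?unitmx_tr // mulKmx //.
Qed.

End GramFactorization.

Section WedgeDeterminant.
Variables (R : realType) (n : nat).
Local Notation C := R[i].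

(* One step of Laplace expansion along the last row. *)
Lemma wedge_det k (a : tensor R n k) (b : tensor R n 1) x (f : nat -> 'I_n -> C) :
  alt_at a x -> (forall v, a x v = \det (\matrix_(i < k, j < k) f i (v j))) ->
  (forall c, form1_at b x c = f k c) ->
  forall v, (a /^\ b)%ff x v =
    \det (\matrix_(i < k.+1, j < k.+1) f i (v (cast_ord (esym (addn1 k)) j))).
Proof.
move=> aalt aE bE v; rewrite wedge1E // (expand_det_row _ ord_max).
apply: eq_bigr => j _; rewrite mxE -/(form1_at b x _) bE aE /cofactor /= addnC.
rewrite [RHS]mulrC; congr (_ * \det _ * _); apply/matrixP => p q; rewrite !mxE.
by congr (f _ _); rewrite /= /bump leqNgt ltn_ord.
Qed.

Lemma wedge4_det (a b c d : tensor R n 1) x v :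
  (a /^\ b /^\ c /^\ d)%ff x v =
  \det (\matrix_(i < 4, j < 4) nth 0 [:: form1_at a x (v j); form1_at b x (v j);
    form1_at c x (v j); form1_at d x (v j)] i).
Proof.
pose f m j := nth 0 [:: form1_at a x j; form1_at b x j; form1_at c x j; form1_at d x j] m.
have E1 w : a x w = \det (\matrix_(i < 1, j < 1) f i (w j)).
  by rewrite det_mx11 mxE form1_eta.
have E2 w : (a /^\ b)%ff x w = \det (\matrix_(i < 2, j < 2) f i (w j)).
  rewrite (wedge_det (alt_at1 a x) E1 (f := f)) //; congr (\det _).
  by apply/matrixP => i j; rewrite !mxE; congr (f _ (w _)); apply: val_inj.
have E3 w : (a /^\ b /^\ c)%ff x w = \det (\matrix_(i < 3, j < 3) f i (w j)).
  rewrite (wedge_det (wedge_alt a b x) E2 (f := f)) //; congr (\det _).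
  by apply/matrixP => i j; rewrite !mxE; congr (f _ (w _)); apply: val_inj.
rewrite (wedge_det (wedge_alt (a /^\ b)%ff c x) E3 (f := f)) //; congr (\det _).
by apply/matrixP => i j; rewrite !mxE; congr (f _ (v _)); apply: val_inj.
Qed.

End WedgeDeterminant.

Section NullCotetrad.
Variable R : realType.
Local Notation C := R[i].
Local Notation form k := (tensor R 4 k).

Lemma ord4_ind (P : 'I_4 -> Prop) : P iM -> P iP -> P iN -> P iK -> forall i, P i.
Proof.
move=> p0 p1 p2 p3 [[|[|[|[|//]]]] h].
- by rewrite (_ : Ordinal h = iM) //; apply: val_inj.
- by rewrite (_ : Ordinal h = iP) //; apply: val_inj.
- by rewrite (_ : Ordinal h = iN) //; apply: val_inj.
- by rewrite (_ : Ordinal h = iK) //; apply: val_inj.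
Qed.

Lemma volume_det (th : 'I_4 -> form 1) x :
  (th iM /^\ th iP /^\ th iN /^\ th iK)%ff x id = \det (coframe_mx th x).
Proof.
by rewrite wedge4_det; congr (\det _); apply/matrixP; apply: ord4_ind => j; rewrite !mxE.
Qed.

(** Gives the determinant as an explicit polynomial, in the same [wedge211] form as the twistor
    equations. *)
Lemma det_mx4 (A : 'M[C]_4) : \det A =
  wedge211 (fun a b => A iM a * A iP b - A iM b * A iP a) (A iN) (A iK) iM iP iN iK.
Proof.
pose th (i : 'I_4) : form 1 := fun _ v => A i (v ord0).
have -> : A = coframe_mx th 0 by apply/matrixP => i j; rewrite !mxE.
rewrite -volume_det.
have E := wedge211E (th iN) (th iK) (wedge_alt (th iM) (th iP) 0) (fun m => inord m).
rewrite (_ : id = (fun i : 'I_4 => inord i)); last by apply/funext => i; rewrite /= inord_val.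
rewrite E; have -> : form2_at (th iM /^\ th iP)%ff 0 =
    (fun a b => A iM a * A iP b - A iM b * A iP a).
  by apply/funext => a; apply/funext => b; rewrite /form2_at wedge11E.
have -> : coframe_mx th 0 = A by apply/matrixP => i j; rewrite !mxE.
by congr wedge211; apply: val_inj; rewrite /= inordK.
Qed.

Lemma exists_null_cotetrad (V : set 'rV[R]_4) (g : form 2) (eta : form 4) x0 :
  open V -> V x0 -> msmooth V (tensor2_mx g) ->
  (forall x, V x -> (tensor2_mx g x)^T = tensor2_mx g x) ->
  (forall x, V x -> \det (tensor2_mx g x) != 0) ->
  smooth_tensor V eta -> alternating V eta ->
  (forall x, V x -> eta x id ^+ 2 = 16%:R * \det (tensor2_mx g x)) ->
  exists V' th, [/\ V' `<=` V, V' x0 & null_cotetrad V' g eta th].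
Proof.
move=> oV Vx0 sg gs gd se ea e2.
have [U [T [oU UV Ux0 sT TE]]] := msmooth_sqrt_factor oV Vx0 sg gs (gd _ Vx0).
pose I : C := 'i%C.
have I2 : I * I = -1 by rewrite -expr2 sqr_i.
(* The rows of [T] form an orthonormal coframe. If [s] and [I] square to -1, then [MP] is the sum of
   the first two squares and [NK] is minus the sum of the last two, so [MP - NK] is the metric. *)
pose th (s : C) (i : 'I_4) : form 1 := fun x v =>
  nth 0 [:: T x iM (v ord0) + s * T x iP (v ord0); T x iM (v ord0) - s * T x iP (v ord0);
            T x iN (v ord0) + I * T x iK (v ord0); I * T x iK (v ord0) - T x iN (v ord0)] i.
have dT x : U x -> \det (T x) ^+ 2 = \det (tensor2_mx g x).
  by move=> Ux; rewrite -TE // det_mulmx det_tr expr2.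
have dth s x : \det (coframe_mx (th s) x) = - (4%:R * s * I * \det (T x)).
  by rewrite !det_mx4 /wedge211 /wedge21 /coframe_mx !mxE /th /=; ring.
have d0 x : U x -> \det (T x) != 0.
  move=> Ux; have := gd x (UV _ Ux); rewrite -dT //; apply: contraNneq => ->.
  by rewrite expr0n.
(* The coframe determinant is [- 4 s I det T]. So the two roots of -1 realise the two signs of
   [4 det T], one of which is the given volume form at [x0]. *)
have [s [s2 es]] : exists s, s * s = -1 /\ eta x0 id = \det (coframe_mx (th s) x0).
  have : (eta x0 id) ^+ 2 == (4%:R * \det (T x0)) ^+ 2.
    by rewrite e2 // exprMn dT // -natrX.
  rewrite eqf_sqr => /orP[] /eqP ->; [exists I|exists (- I)]; rewrite dth; split => //.
  - by rewrite -[in RHS]mulrA -[in RHS]mulrA (mulrA I) I2; ring.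
  - by rewrite mulrNN.
  - by rewrite mulrN !mulNr opprK -[in RHS]mulrA -[in RHS]mulrA (mulrA I) I2; ring.
have sth i : smooth_tensor U (th s i).
  move=> v.
  have c := csmooth_cst U.
  move: i; apply: ord4_ind; rewrite /th /=.
  - by apply: (csmoothD oU (sT _ _) _); exact: csmoothM oU (c s) (sT _ _).
  - by apply: (csmoothD oU (sT _ _) _); apply: (csmoothN oU _); exact: csmoothM oU (c s) (sT _ _).
  - by apply: (csmoothD oU (sT _ _) _); exact: csmoothM oU (c I) (sT _ _).
  - by apply: (csmoothD oU _ (csmoothN oU (sT _ _))); exact: csmoothM oU (c I) (sT _ _).
have sm : msmooth U (coframe_mx (th s)).
  by move=> i a; apply: csmooth_ext_fun (sth i (fun=> a)) => x; rewrite mxE.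
have esm : csmooth U (fun x => eta x id + \det (coframe_mx (th s) x)).
  apply: (csmoothD oU _ (csmooth_det oU sm)); exact: csmooth_sub UV (se id).
(* Everywhere on [U] the volume form is plus or minus the coframe determinant; where their sum is
   nonzero the sign must be plus. *)
pose V' := U `&` [set x | eta x id + \det (coframe_mx (th s) x) != 0].
have V'U : V' `<=` U by move=> x [].
have dth0 x : U x -> \det (coframe_mx (th s) x) != 0.
  move=> Ux; rewrite dth oppr_eq0 !mulf_neq0 ?d0 ?pnatr_eq0 //.
    by apply/eqP => s0; move: s2 => /eqP; rewrite s0 mul0r eq_sym oppr_eq0 oner_eq0.
  by apply/eqP => s0; move: I2 => /eqP; rewrite s0 mul0r eq_sym oppr_eq0 oner_eq0.
exists V', (th s); split; first by move=> x /V'U /UV.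
  split=> //=; rewrite es -mulr2n mulrn_eq0 /=; exact: dth0.
split.
- split; first exact: open_sub_neq0.
    by move=> i v; exact: csmooth_sub V'U (sth i v).
  by move=> x /V'U; exact: dth0.
- move=> x /V'U Ux v.
  have -> : g x v = (tensor2_mx g x) (v ord0) (v ord_max) by rewrite mxE -pair_idx_eta.
  rewrite -TE // mxE !big_ord_recl big_ord0 /th /=.
  rewrite !mxE.
  have o0 : ord0 = iM by apply: val_inj.
  have o1 : lift ord0 ord0 = iP by apply: val_inj.
  have o2 : lift ord0 (lift ord0 ord0) = iN by apply: val_inj.
  have o3 : lift ord0 (lift ord0 (lift ord0 ord0)) = iK by apply: val_inj.
  rewrite o3 o2 o1 o0.
  apply: (eq_lincomb (eq_add (eq_scale (T x iP (v ord0) * T x iP (v ord_max)) s2)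
    (eq_scale (T x iK (v ord0) * T x iK (v ord_max)) I2))).
  by field.
move=> x V'x v.
have Ux := V'U _ V'x.
have E : eta x id = \det (coframe_mx (th s) x).
  have : eta x id ^+ 2 == \det (coframe_mx (th s) x) ^+ 2.
    rewrite e2; last exact: UV.
    rewrite dth sqrrN -dT // !exprMn ![_ ^+ 2]expr2 -[s * s]/(s * s) s2 I2.
    by apply/eqP; ring.
  rewrite eqf_sqr => /orP[/eqP //|/eqP E]; case: V'x => _ /=.
  by rewrite E addNr eqxx.
apply/eqP; rewrite -subr_eq0; apply/eqP.
pose D v := eta x v - (th s iM /^\ th s iP /^\ th s iN /^\ th s iK)%ff x v.
apply: (alternating_top_eq0 (T := D)).
  move=> w t; rewrite /D mulrBr; congr (_ - _); first exact: ea _ (UV _ Ux) _ _.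
  exact: wedge_alt.
by rewrite /D volume_det E subrr.
Qed.

End NullCotetrad.

(** * Curvature in a null frame *)

Section NullCurvature.
Variable F : numFieldType.
Implicit Types (f : 'I_4 -> 'I_4 -> F).

Lemma sum4E (Z : zmodType) (f : 'I_4 -> Z) : \sum_i f i = f iM + f iP + f iN + f iK.
Proof.
rewrite !big_ord_recl big_ord0 addr0 !addrA.
by do ?congr (_ + _); congr f; apply: val_inj.
Qed.

(** The matrix of [g = MP - NK] in its own coframe; the halves come from the symmetrised product. *)
Definition null_form : 'M[F]_4 := \matrix_(i, j)
  nth 0 (nth [::] [:: [:: 0; 2%:R^-1; 0; 0]; [:: 2%:R^-1; 0; 0; 0];
                     [:: 0; 0; 0; - 2%:R^-1]; [:: 0; 0; - 2%:R^-1; 0]] i) j.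
Local Notation J := null_form.

Lemma null_form_sqr : (4%:R *: J) *m J = 1%:M.
Proof.
apply/matrixP; apply: ord4_ind; apply: ord4_ind; rewrite !mxE sum4E !mxE /= ?mulr0n ?mulr1n;
  by field.
Qed.

Lemma null_form_sym : J^T = J.
Proof. by apply/matrixP; apply: ord4_ind; apply: ord4_ind; rewrite !mxE. Qed.

Lemma null_form_unit : J \in unitmx.
Proof. by have [_] := mulmx1_unit null_form_sqr. Qed.

Lemma invmx_null_form : invmx J = 4%:R *: J.
Proof.
by rewrite -[LHS]mul1mx -null_form_sqr mulmxK // null_form_unit.
Qed.

(** The conformal orthogonal Lie algebra of [null_form], with multiplier [c], solved for ten entries
    so that the equations can serve as rewrite rules; six entries and [c] stay free. *)
Record null_conformal (X : 'I_4 -> 'I_4 -> F) (c : F) : Prop := NullConformal {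
  ncPM : X iP iM = 0; ncMP : X iM iP = 0; ncKN : X iK iN = 0; ncNK : X iN iK = 0;
  ncMM : X iM iM = c - X iP iP; ncNN : X iN iN = c - X iK iK;
  ncPN : X iP iN = X iK iM; ncPK : X iP iK = X iN iM;
  ncKP : X iK iP = X iM iN; ncMK : X iM iK = X iN iP }.

Lemma null_conformalP (X : 'M[F]_4) c : J *m X + (J *m X)^T = c *: J ->
  null_conformal X c.
Proof.
move=> /matrixP E.
split; [have := E iM iM | have := E iP iP | have := E iN iN | have := E iK iK
  | have := E iM iP | have := E iN iK | have := E iM iN | have := E iM iK
  | have := E iP iN | have := E iP iK]; rewrite !mxE !sum4E !mxE /= => H.
1: by apply: (eq_lincomb H); field.
1: by apply: (eq_lincomb H); field.
1: by apply: (eq_lincomb (eq_scale (-1) H)); field.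
1: by apply: (eq_lincomb (eq_scale (-1) H)); field.
1: by apply: (eq_lincomb (eq_scale 2%:R H)); field.
1: by apply: (eq_lincomb (eq_scale (- 2%:R) H)); field.
1: by apply: (eq_lincomb (eq_scale 2%:R H)); field.
1: by apply: (eq_lincomb (eq_scale 2%:R H)); field.
1: by apply: (eq_lincomb (eq_scale (- 2%:R) H)); field.
by apply: (eq_lincomb (eq_scale 2%:R H)); field.
Qed.

(* [o h j k l] stands for the frame components of the curvature 2-form
   [Omega^h_j] of a Weyl connection and [Fa] for those of [dA]. *)
Record null_curvature (o : 'I_4 -> 'I_4 -> 'I_4 -> 'I_4 -> F) (Fa : 'I_4 -> 'I_4 -> F) : Prop :=
  NullCurvature {
    nc_conf : forall k l, null_conformal (fun h j => o h j k l) (Fa k l);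
    nc_alt : forall h j k l, o h j k l = - o h j l k;
    nc_bianchi : forall i j k l, o i j k l + o i k l j + o i l j k = 0 }.

Section Consequences.
Variables (o : 'I_4 -> 'I_4 -> 'I_4 -> 'I_4 -> F) (Fa : 'I_4 -> 'I_4 -> F).
Hypothesis nc : null_curvature o Fa.

Let altE h j := (nc_alt nc h j iP iM, nc_alt nc h j iN iM, nc_alt nc h j iN iP,
  nc_alt nc h j iK iM, nc_alt nc h j iK iP, nc_alt nc h j iK iN).

Lemma null_curvature_diag h j k : o h j k k = 0.
Proof.
have /eqP := nc_alt nc h j k k.
by rewrite -subr_eq0 opprK -mulr2n mulrn_eq0 => /eqP.
Qed.

Definition conf_rules := (fun k l => ncPM (nc_conf nc k l), fun k l => ncMP (nc_conf nc k l),
  fun k l => ncKN (nc_conf nc k l), fun k l => ncNK (nc_conf nc k l),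
  fun k l => ncMM (nc_conf nc k l), fun k l => ncNN (nc_conf nc k l),
  fun k l => ncPN (nc_conf nc k l), fun k l => ncPK (nc_conf nc k l),
  fun k l => ncKP (nc_conf nc k l), fun k l => ncMK (nc_conf nc k l)).

Lemma Fa_alt k l : Fa k l = - Fa l k.
Proof.
have H1 := ncMM (nc_conf nc k l); have H2 := ncMM (nc_conf nc l k).
have H3 := nc_alt nc iM iM k l; have H4 := nc_alt nc iP iP k l.
by apply: (eq_lincomb (eq_add (eq_scale (-1) (eq_add H1 H2)) (eq_add H3 H4))); ring.
Qed.

(* The independent components after the sixteen Bianchi identities. *)
Lemma null_bianchi :
  [/\ [/\ o iM iN iM iP = o iP iP iP iN - Fa iP iN,
          o iN iP iM iP = o iP iP iP iK - Fa iP iK,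
          o iK iM iM iP = o iP iP iM iN &
          o iN iM iM iP = o iP iP iM iK],
      [/\ o iM iN iP iK = o iN iP iP iN,
          o iK iM iM iK = o iN iM iM iN,
          o iN iM iP iK = o iN iP iM iK &
          o iM iN iM iN = o iK iM iP iN],
      [/\ o iN iM iN iK = Fa iM iK - o iK iK iM iK,
          o iN iP iN iK = Fa iP iK - o iK iK iP iK,
          o iK iM iN iK = - o iK iK iM iN &
          o iM iN iN iK = - o iK iK iP iN] &
      [/\ o iN iP iM iN = o iN iM iP iN + Fa iM iP - o iK iK iM iP,
          o iP iP iN iK = (Fa iN iK + Fa iM iP) / 2%:R - o iK iK iM iP,
          o iK iM iP iK = o iN iM iP iN + o iP iP iN iK &
          o iM iN iM iK = o iK iM iP iK + o iK iK iM iP]].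
Proof.
have b := nc_bianchi nc.
have FA := (Fa_alt iP iM, Fa_alt iN iM, Fa_alt iN iP, Fa_alt iK iM, Fa_alt iK iP, Fa_alt iK iN).
have := b iM iM iP iN; have := b iM iM iP iK; have := b iM iM iN iK; have := b iM iP iN iK.
have := b iP iM iP iN; have := b iP iM iP iK; have := b iP iM iN iK; have := b iP iP iN iK.
have := b iN iM iP iN; have := b iN iM iP iK; have := b iN iM iN iK; have := b iN iP iN iK.
have := b iK iM iP iN; have := b iK iM iP iK; have := b iK iM iN iK; have := b iK iP iN iK.
rewrite !(altE, conf_rules, FA).
move=> K4 K3 K2 K1 N4 N3 N2 N1 P4 P3 P2 P1 M4 M3 M2 M1.
split; split.
- by apply: (eq_lincomb M1); ring.
- by apply: (eq_lincomb M2); ring.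
- by apply: (eq_lincomb P1); ring.
- by apply: (eq_lincomb P2); ring.
- by apply: (eq_lincomb (eq_scale (-1) M4)); ring.
- by apply: (eq_lincomb (eq_scale (-1) P3)); ring.
- by apply: (eq_lincomb N2); ring.
- by apply: (eq_lincomb (eq_scale (-1) K1)); ring.
- by apply: (eq_lincomb N3); ring.
- by apply: (eq_lincomb N4); ring.
- by apply: (eq_lincomb K3); ring.
- by apply: (eq_lincomb K4); ring.
- by apply: (eq_lincomb (eq_scale (-1) N1)); ring.
- by apply: (eq_lincomb (eq_scale 2%:R^-1 (eq_add (eq_add K2 P4)
    (eq_scale (-1) (eq_add M3 N1))))); field.
- by apply: (eq_lincomb (eq_scale (-1) P4)); ring.
- by apply: (eq_lincomb (eq_scale (-1) K2)); ring.
Qed.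

(** From here on the [o_] functions are the curvature quantities in frame components, with the
    constant metric [null_form]. They are linear in [o]. *)
Definition o_ricci j l := \sum_k o k j k l.
Definition o_scalar := \sum_i \sum_j invmx J i j * o_ricci i j.
Definition o_S i j := (o_ricci i j + o_ricci j i) / 2%:R - o_scalar / 4%:R * J i j.
Definition o_riem i j k l := \sum_h J i h * o h j k l.
Definition o_weyl i j k l :=
  o_riem i j k l
  - (J i k * o_ricci j l - J i l * o_ricci j k
     - J j k * o_ricci i l + J j l * o_ricci i k) / 2%:R
  + o_scalar / 6%:R * (J i k * J j l - J i l * J j k).
Definition o_Theta z' k l :=
  - o iN iM k l + z' * (o iP iP k l - o iK iK k l) + z' ^+ 2 * o iM iN k l.

Lemma Fa_diag k : Fa k k = 0.
Proof.
by have := ncMM (nc_conf nc k k); rewrite !null_curvature_diag subr0 => <-.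
Qed.

Let FA := (Fa_alt iP iM, Fa_alt iN iM, Fa_alt iN iP, Fa_alt iK iM, Fa_alt iK iP, Fa_alt iK iN).

(** Evaluation at 0, 1 and -1 suffices. *)
Lemma quadratic_eq0 (a b c : F) : (forall z, z ^+ 2 * a + z * b - c = 0) ->
  [/\ a = 0, b = 0 & c = 0].
Proof.
move=> H; have H0 := H 0; have H1 := H 1; have Hm := H (-1).
have c0 : c = 0 by apply: (eq_lincomb (eq_scale (-1) H0)); ring.
split=> //.
  by apply: (eq_lincomb (eq_scale 2%:R^-1 (eq_add (eq_add H1 Hm) (eq_scale (-2%:R) H0)))); field.
by apply: (eq_lincomb (eq_scale 2%:R^-1 (eq_add H1 (eq_scale (-1) Hm)))); field.
Qed.

(** Evaluation at 0, 1, -1, 2 and -2: sums of opposite values isolate the even coefficients and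
    differences the odd ones, in each case two equations in two unknowns. *)
Lemma quartic_eq0 (a b c d e : F) :
  (forall z, a + z * b + z ^+ 2 * c + z ^+ 3 * d + z ^+ 4 * e = 0) ->
  [/\ a = 0, b = 0, c = 0, d = 0 & e = 0].
Proof.
move=> H; have H0 := H 0; have H1 := H 1; have Hm := H (-1).
have H2 := H 2%:R; have Hm2 := H (- 2%:R).
have a0 : a = 0 by apply: (eq_lincomb H0); ring.
rewrite a0 in H0 H1 Hm H2 Hm2.
have E2 := eq_add H2 Hm2; have E1 := eq_add H1 Hm.
have O2 := eq_add H2 (eq_scale (-1) Hm2); have O1 := eq_add H1 (eq_scale (-1) Hm).
split=> //.
- by apply: (eq_lincomb (eq_scale (12%:R^-1) (eq_add (eq_scale 8%:R O1) (eq_scale (-1) O2)))); field.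
- by apply: (eq_lincomb (eq_scale (24%:R^-1) (eq_add (eq_scale 16%:R E1) (eq_scale (-1) E2)))); field.
- by apply: (eq_lincomb (eq_scale (12%:R^-1) (eq_add (eq_scale (- 2%:R) O1) O2))); field.
- by apply: (eq_lincomb (eq_scale (24%:R^-1) (eq_add (eq_scale (- 4%:R) E1) E2))); field.
Qed.

Lemma o_S_values :
  [/\ [/\ o_S iM iM = - 2%:R * o iN iM iM iN, o_S iP iP = - 2%:R * o iM iN iP iK,
          o_S iN iN = 2%:R * o iM iN iM iN & o_S iK iK = 2%:R * o iN iM iP iK],
      [/\ o_S iM iN = - (o iP iP iM iN - o iK iK iM iN), o_S iP iK = o iP iP iP iK - o iK iK iP iK,
          o_S iM iK = o iN iM iN iK - o iN iM iM iP & o_S iP iN = o iM iN iM iP - o iM iN iN iK] &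
      o_S iM iP = (o iP iP iN iK - o iK iK iN iK - o iP iP iM iP + o iK iK iM iP) / 2%:R /\
      o_S iN iK = (o iP iP iN iK - o iK iK iN iK - o iP iP iM iP + o iK iK iM iP) / 2%:R].
Proof.
have [[b1 b2 b3 b4] [b5 b6 b7 b8] [b9 b10 b11 b12] [b13 b14 b15 b16]] := null_bianchi.
have Bi := (b1, b2, b3, b4, b5, b6, b7, b8, (b9, b10, b11, b12, b13, b16, b15, b14)).
have R i j : o_ricci i j = o iM i iM j + o iP i iP j + o iN i iN j + o iK i iK j.
  exact: sum4E.
have Sc : o_scalar = 2%:R * (o_ricci iM iP + o_ricci iP iM) - 2%:R * (o_ricci iN iK + o_ricci iK iN).
  by rewrite /o_scalar invmx_null_form !sum4E !mxE /=; field.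
by split; split; rewrite /o_S Sc !R !mxE /= !(altE, conf_rules, FA)
  ?(null_curvature_diag, Fa_diag) ?Bi; field.
Qed.

(** The nine coefficients in [z] and [z'] are, up to nonzero rational factors, the values in
    [o_S_values]; of the ten entries listed there, those at [iM iP] and [iN iK] coincide because the
    trace is zero. *)
Lemma einstein_weyl_null :
  (forall z z', z ^+ 2 * o_Theta z' iM iN + z * (o_Theta z' iN iK - o_Theta z' iM iP)
     - o_Theta z' iP iK = 0) <-> (forall i j, o_S i j = 0).
Proof.
have [[S11 S22 S33 S44] [S13 S24 S14 S23] [S12 S34]] := o_S_values.
have S_sym i j : o_S i j = o_S j i.
  have Js : J i j = J j i by rewrite -{1}null_form_sym mxE.
  by rewrite /o_S Js (addrC (o_ricci i j)).
split=> [H|H].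
  have T3 z' := quadratic_eq0 (fun z => H z z').
  have A z' : z' ^+ 2 * o iM iN iM iN + z' * (o iP iP iM iN - o iK iK iM iN) - o iN iM iM iN = 0.
    by have [E _ _] := T3 z'; rewrite -[RHS]E /o_Theta; ring.
  have B z' : z' ^+ 2 * (o iM iN iN iK - o iM iN iM iP) + z' * (o iP iP iN iK - o iK iK iN iK
      - o iP iP iM iP + o iK iK iM iP) - (o iN iM iN iK - o iN iM iM iP) = 0.
    by have [_ E _] := T3 z'; rewrite -[RHS]E /o_Theta; ring.
  have D z' : z' ^+ 2 * o iM iN iP iK + z' * (o iP iP iP iK - o iK iK iP iK) - o iN iM iP iK = 0.
    by have [_ _ E] := T3 z'; rewrite -[RHS]E /o_Theta; ring.
  have [A1 A2 A3] := quadratic_eq0 A; have [B1 B2 B3] := quadratic_eq0 B.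
  have [D1 D2 D3] := quadratic_eq0 D.
  have B1' : o iM iN iM iP - o iM iN iN iK = 0 by rewrite -opprB B1 oppr0.
  rewrite A1 in S33; rewrite A2 in S13; rewrite A3 in S11; rewrite B1' in S23.
  rewrite B2 in S12 S34; rewrite B3 in S14; rewrite D1 in S22; rewrite D2 in S24; rewrite D3 in S44.
  rewrite ?(mulr0, oppr0, mul0r) in S11 S22 S33 S44 S13 S12 S34.
  apply: ord4_ind; apply: ord4_ind => //; rewrite S_sym //.
rewrite !H in S11 S22 S33 S44 S13 S24 S14 S23 S12.
have n2 : 2%:R != 0 :> F by rewrite pnatr_eq0.
have A3 : o iN iM iM iN = 0 by apply: (eq_lincomb (eq_scale (2%:R^-1) S11)); field.
have D1 : o iM iN iP iK = 0 by apply: (eq_lincomb (eq_scale (2%:R^-1) S22)); field.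
have A1 : o iM iN iM iN = 0 by apply: (eq_lincomb (eq_scale (- 2%:R^-1) S33)); field.
have D3 : o iN iM iP iK = 0 by apply: (eq_lincomb (eq_scale (- 2%:R^-1) S44)); field.
have B2 := eq_scale (- 2%:R) S12.
move=> z z'; rewrite /o_Theta A3 D1 A1 D3.
apply: (eq_lincomb (eq_add (eq_add (eq_scale (z ^+ 2 * z') S13) (eq_scale z' S24))
  (eq_add (eq_add (eq_scale z S14) (eq_scale (z * z' ^+ 2) S23)) (eq_scale (z * z') B2)))).
by field.
Qed.

(** With [Fa = 0] the five coefficients of the quartic determine every anti-self-dual component of
    the Weyl tensor, and conversely they are multiples of five such components. *)
Lemma self_dual_null : (forall k l, Fa k l = 0) ->
  (forall z', o_Theta z' iM iK - z' * (o_Theta z' iM iP + o_Theta z' iN iK)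
     - z' ^+ 2 * o_Theta z' iP iN = 0) <->
  (forall i j, [/\ o_weyl i j iM iK = 0, o_weyl i j iP iN = 0 &
    o_weyl i j iM iP + o_weyl i j iN iK = 0]).
Proof.
move=> F0.
have [[b1 b2 b3 b4] [b5 b6 b7 b8] [b9 b10 b11 b12] [b13 b14 b15 b16]] := null_bianchi.
rewrite !F0 in b1 b2 b9 b10 b13 b14.
have Bi := (b1, b2, b3, b4, b5, b6, b7, b8, (b9, b10, b11, b12, b13, b16, b15, b14)).
have R i j : o_ricci i j = o iM i iM j + o iP i iP j + o iN i iN j + o iK i iK j.
  exact: sum4E.
have Sc : o_scalar = 2%:R * (o_ricci iM iP + o_ricci iP iM) - 2%:R * (o_ricci iN iK + o_ricci iK iN).
  by rewrite /o_scalar invmx_null_form !sum4E !mxE /=; field.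
split=> [H|H].
  (* The equation sorted by powers of [z']; each [o_Theta] is itself quadratic in [z']. *)
  have Q z' : - o iN iM iM iK + z' * (o iP iP iM iK - o iK iK iM iK + o iN iM iM iP + o iN iM iN iK)
     + z' ^+ 2 * (o iM iN iM iK - (o iP iP iM iP - o iK iK iM iP) - (o iP iP iN iK - o iK iK iN iK)
         + o iN iM iP iN)
     + z' ^+ 3 * (- (o iM iN iM iP + o iM iN iN iK) - (o iP iP iP iN - o iK iK iP iN))
     + z' ^+ 4 * (- o iM iN iP iN) = 0.
    by rewrite -[RHS](H z') /o_Theta; ring.
  have [] := quartic_eq0 Q; rewrite !Bi => c0 c1 c2 c3 c4.
  have a14 : o iN iM iM iK = 0 by apply: (eq_lincomb (eq_scale (-1) c0)); ring.
  have c23 : o iM iN iP iN = 0 by apply: (eq_lincomb (eq_scale (-1) c4)); ring.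
  have p14 : o iP iP iM iK = o iK iK iM iK by apply: (eq_lincomb (eq_scale (2%:R^-1) c1)); field.
  have p23 : o iP iP iP iN = o iK iK iP iN by apply: (eq_lincomb (eq_scale (- 2%:R^-1) c3)); field.
  have q34 : o iK iK iN iK = o iP iP iM iP - 2%:R * o iK iK iM iP - 2%:R * o iN iM iP iN.
    by apply: (eq_lincomb c2); field.
  have riemA p q k l : o_riem p q k l = - o_riem q p k l.
    rewrite /o_riem !sum4E; move: p q; apply: ord4_ind; apply: ord4_ind;
      by rewrite !mxE /= !(conf_rules, F0); ring.
  have weylA p q k l : o_weyl p q k l = - o_weyl q p k l.
    by rewrite /o_weyl (riemA p q); ring.
  have weyl0 p k l : o_weyl p p k l = 0.
    by have /eqP := weylA p p k l; rewrite -subr_eq0 opprK -mulr2n mulrn_eq0 => /eqP.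
  pose ASD p q := [/\ o_weyl p q iM iK = 0, o_weyl p q iP iN = 0 &
    o_weyl p q iM iP + o_weyl p q iN iK = 0].
  have ASDN p q : ASD p q -> ASD q p.
    rewrite /ASD !(weylA q p) -opprD => -[-> -> ->].
    by rewrite oppr0.
  (* Antisymmetry in the first two indices, valid because [Fa] is zero, leaves six pairs to be
     checked. *)
  suff A : [/\ ASD iM iP, ASD iM iN, ASD iM iK, ASD iP iN & ASD iP iK /\ ASD iN iK].
    case: A => A1 A2 A3 A4 [A5 A6].
    by apply: ord4_ind; apply: ord4_ind => //; try (by apply: ASDN); split;
      rewrite !weyl0 ?addr0.
  by do ![split]; rewrite /o_weyl /o_riem Sc !R !sum4E !mxE /= ?(altE, conf_rules, F0)
    ?null_curvature_diag ?Bi ?a14 ?c23 ?p14 ?p23 ?q34; field.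
move=> z'.
(* One Weyl component, or sum of two, is chosen for each power of [z']: [w0] to [w4] give the
   coefficients of degree 0 to 4. *)
have [_ _ w2] := H iM iP; have [w1 w3 _] := H iM iP.
have [w0 _ _] := H iK iM; have [_ w4 _] := H iP iN.
apply: (eq_lincomb (eq_add (eq_add (eq_scale 2%:R w0) (eq_scale (8%:R * z') w1))
  (eq_add (eq_scale (- 6%:R * z' ^+ 2) w2) (eq_add (eq_scale (- 8%:R * z' ^+ 3) w3)
   (eq_scale (- 2%:R * z' ^+ 4) w4))))).
rewrite /o_Theta /o_weyl /o_riem Sc !R !sum4E !mxE /= ?(altE, conf_rules, F0)
     ?null_curvature_diag ?Bi.
by field.
Qed.

End Consequences.

End NullCurvature.

Section FrameComponents.
Variable R : realType.
Local Notation C := R[i].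

Definition frame1 (E : 'M[C]_4) (f : 'I_4 -> C) k := \sum_a f a * E a k.
Definition frame2 (E : 'M[C]_4) (w : 'I_4 -> 'I_4 -> C) k l :=
  \sum_a \sum_b w a b * E a k * E b l.

(** A 4-form evaluated on a frame is multiplied by the determinant; thus the twistor equation can be
    tested on frame components. *)
Lemma wedge211_frame (E : 'M[C]_4) (w : 'I_4 -> 'I_4 -> C) (f g : 'I_4 -> C) :
  (forall a b, w a b = - w b a) ->
  wedge211 (frame2 E w) (frame1 E f) (frame1 E g) iM iP iN iK =
  \det E * wedge211 w f g iM iP iN iK.
Proof.
move=> wN.
have w0 a : w a a = 0.
  by have /eqP := wN a a; rewrite -subr_eq0 opprK -mulr2n mulrn_eq0 => /eqP.
rewrite det_mx4 /wedge211 /wedge21 /frame1 /frame2 !sum4E !w0.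
rewrite !(wN iP iM, wN iN iM, wN iN iP, wN iK iM, wN iK iP, wN iK iN).
move: (w iM iP) (w iM iN) (w iM iK) (w iP iN) (w iP iK) (w iN iK) => w1 w2 w3 w4 w5 w6.
move: (f iM) (f iP) (f iN) (f iK) (g iM) (g iP) (g iN) (g iK) => f1 f2 f3 f4 g1 g2 g3 g4.
ring.
Qed.

End FrameComponents.

(** The commutator of two conformal matrices is skew for [G], so only the derivative terms
    contribute a multiplier, namely that of [dA]. *)
Lemma metric_curvature_mx (F : comNzRingType) n (G Ga Gb Gab Gba : 'M[F]_n) (ca cb cab cba : F) :
  G *m Ga + (G *m Ga)^T = ca *: G -> G *m Gb + (G *m Gb)^T = cb *: G ->
  G *m Gab + (G *m Gab)^T = cab *: G -> G *m Gba + (G *m Gba)^T = cba *: G -> G^T = G ->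
  G *m (Gab - Gba + (Ga *m Gb - Gb *m Ga)) + (G *m (Gab - Gba + (Ga *m Gb - Gb *m Ga)))^T
  = (cab - cba) *: G.
Proof.
move=> Ea Eb Eab Eba Gs.
have A1 := congr1 (mulmx^~ Gb) Ea; have A2 := congr1 (mulmx Gb^T) Ea.
have B1 := congr1 (mulmx^~ Ga) Eb; have B2 := congr1 (mulmx Ga^T) Eb.
have trD (X Y : 'M[F]_n) : (X + Y)^T = X^T + Y^T by apply/matrixP => i j; rewrite !mxE.
have trN (X : 'M[F]_n) : (- X)^T = - X^T by apply/matrixP => i j; rewrite !mxE.
have zE (c : F) (X : 'M[F]_n) i j : (c *: X) i j = c * X i j by rewrite mxE.
move: A1 A2 B1 B2 Eab Eba (Ea) (Eb); rewrite /= !(mulmxDl, mulmxDr, mulmxN, mulNmx).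
rewrite !(trD, trN, trmx_mul) Gs -?(scalemxAl, scalemxAr) ?mulmxA.
rewrite -?scalemxAr.
move=> /matrixP A1 /matrixP A2 /matrixP B1 /matrixP B2 /matrixP Eab' /matrixP Eba' /matrixP Ea' /matrixP Eb'.
apply/matrixP => i j.
move: (A1 i j) (A2 i j) (B1 i j) (B2 i j) (Eab' i j) (Eba' i j) (Ea' i j) (Eb' i j).
rewrite !(mxaddE, mxoppE, zE) => H1 H2 H3 H4 H5 H6 H7 H8.
apply: (eq_lincomb (eq_add (eq_add H5 (eq_scale (-1) H6))
  (eq_add (eq_add (eq_add H1 H2) (eq_scale (-1) (eq_add H3 H4)))
    (eq_add (eq_scale ca H8) (eq_scale (- cb) H7))))).
by ring.
Qed.

Lemma sum_rot (Z : nmodType) (I : finType) (f : I -> I -> I -> Z) :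
  \sum_a \sum_b \sum_c f a b c = \sum_a \sum_b \sum_c f b c a.
Proof. by rewrite [RHS]exchange_big; apply: eq_bigr => b _; rewrite exchange_big. Qed.

Lemma cyclic_entry (F : pzRingType) n (P1 P2 P3 Q : 'M[F]_n) a b c i :
  P1 *m col c Q + P2 *m col a Q + P3 *m col b Q = 0 ->
  (P1 *m Q) i c + (P2 *m Q) i a + (P3 *m Q) i b = 0.
Proof.
move=> /matrixP/(_ i 0); rewrite !mxaddE mx0E => <-.
have colM (P : 'M[F]_n) q : (P *m Q) i q = (P *m col q Q) i 0.
  by rewrite !mxE; apply: eq_bigr => p _; rewrite !mxE.
by rewrite !colM.
Qed.

(** * Connection and curvature in a null cotetrad *)

Section NullFrame.
Variable R : realType.
Local Notation C := R[i].
Local Notation form k := (tensor R 4 k).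
Variables (V : set 'rV[R]_4) (g : form 2) (eta : form 4) (th : 'I_4 -> form 1).
Hypothesis nth : null_cotetrad V g eta th.
Local Notation J := (null_form C).

Lemma null_coframe : coframe V th. Proof. by case: nth. Qed.
Let cth := null_coframe.
Let oV : open V. Proof. by case: cth. Qed.

Lemma null_metric x : V x -> tensor2_mx g x = (coframe_mx th x)^T *m J *m coframe_mx th x.
Proof.
move=> Vx; have [_ G _] := nth.
apply/matrixP => a b; rewrite !mxE (G x Vx) /= !sum4E !mxE !sum4E !mxE /= /pair_idx /=.
by move: (th iM x) (th iP x) (th iN x) (th iK x) => m p n k; field.
Qed.

Lemma gdown_null x : V x -> gdown g th x = J.
Proof.
move=> Vx; rewrite /gdown null_metric //.
have := mulmx_coframe_frame cth Vx.
move: (coframe_mx th x) (frame_mx th x) (null_form C) => T E G TE.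
by rewrite !mulmxA -(mulmxA _ T) TE mulmx1 -trmx_mul TE trmx1 mul1mx.
Qed.

Lemma gup_null x : V x -> gup g th x = invmx J.
Proof. by move=> Vx; rewrite /gup gdown_null. Qed.

Lemma mpartial_gdown_null a x : V x -> mpartial a (gdown g th) x = 0.
Proof. by move=> Vx; rewrite (mpartial_ext a oV Vx gdown_null) mpartial_cst. Qed.

Section Connection.
Variables (A : form 1) (Gam : 'I_4 -> 'I_4 -> form 1).
Hypothesis wc : weyl_connection V g A th Gam.
Hypothesis sA : smooth_tensor V A.

Let sG a : msmooth V (conn_mx Gam a).
Proof. by have /weyl_connectionP[s _ _] := wc. Qed.

Lemma conn_conformal a x : V x ->
  J *m conn_mx Gam a x + (J *m conn_mx Gam a x)^T = form1_at A x a *: J.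
Proof.
move=> Vx; have /weyl_connectionP[_ m _] := wc.
have := m a x Vx; rewrite mpartial_gdown_null // gdown_null // => E.
by rewrite -[RHS]opprK -E sub0r opprD opprK opprK.
Qed.

Lemma null_conn a x : V x ->
  null_conformal (fun i j => form1_at (Gam i j) x a) (form1_at A x a).
Proof.
move=> Vx; have := null_conformalP (conn_conformal a Vx).
have -> : (conn_mx Gam a x : 'I_4 -> 'I_4 -> C) = fun i j => form1_at (Gam i j) x a => //.
by apply/funext => i; apply/funext => j; rewrite mxE.
Qed.

Lemma conn_conformal_partial a b x : V x ->
  J *m mpartial a (conn_mx Gam b) x + (J *m mpartial a (conn_mx Gam b) x)^T =
  cpartial a (fun y => form1_at A y b) x *: J.
Proof.
move=> Vx.
have sJG := msmoothM oV (msmooth_cst V J) (sG b).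
have := mpartial_ext a oV Vx (fun y Vy => conn_conformal b Vy).
rewrite (mpartialD a sJG (msmooth_tr oV sJG) Vx) mpartial_tr.
rewrite (mpartialM a (msmooth_cst V J) (sG b) Vx) mpartial_cst mul0mx add0r => ->.
apply/matrixP => i j; rewrite [LHS]mxE [RHS]mxE.
rewrite -[X in _ = _ * X](addr0) -[RHS]addr0.
have dA : cderivable (fun y => form1_at A y b) x a by exact: csmooth_derivable (sA _) Vx.
rewrite (cpartial_eq (g := fun y => form1_at A y b * J i j)) => [|y]; last exact: mxE.
by rewrite (cpartialM dA (cderivable_cst (J i j) x a)) cpartial_cst mulr0 !addr0.
Qed.

Lemma curv_conformal a b x : V x ->
  J *m curv_mx Gam a b x + (J *m curv_mx Gam a b x)^T =
  form2_at (ext_d A) x a b *: J.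
Proof.
move=> Vx; rewrite /form2_at ext_d1E.
exact: metric_curvature_mx (conn_conformal a Vx) (conn_conformal b Vx)
  (conn_conformal_partial a b Vx) (conn_conformal_partial b a Vx) (null_form_sym C).
Qed.

Definition frame_curv x h j := frame2 (frame_mx th x) (fun a b => curv_mx Gam a b x h j).

Lemma frame_curv_bianchi i j k l x : V x ->
  frame_curv x i j k l + frame_curv x i k l j + frame_curv x i l j k = 0.
Proof.
move=> Vx; set E := frame_mx th x.
(* Contracting the last index of the curvature with the coframe makes all three indices coordinate
   ones, as in [first_bianchi]; the frame coefficients are then relabelled cyclically. *)
pose X a b c := (curv_mx Gam a b x *m coframe_mx th x) i c.
have L p q r : frame_curv x i p q r =
    \sum_a \sum_b \sum_c X a b c * (E a q * E b r * E c p).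
  apply: eq_bigr => a _; apply: eq_bigr => b _.
  have -> : curv_mx Gam a b x i p = \sum_c X a b c * E c p.
    by rewrite -[curv_mx Gam a b x]mulmx1 -(mulmx_coframe_frame cth Vx) mulmxA mxE.
  rewrite -mulrA big_distrl /=; apply: eq_bigr => c _; rewrite -!mulrA; congr (_ * _).
  by rewrite mulrC mulrA.
rewrite !L (sum_rot (fun a b c => X a b c * (E a l * E b j * E c k))).
rewrite (sum_rot (fun a b c => X a b c * (E a j * E b k * E c l))).
rewrite (sum_rot (fun a b c => X b c a * (E b j * E c k * E a l))).
rewrite -!big_split big1 // => a _; rewrite -!big_split big1 // => b _.
rewrite -!big_split big1 // => c _ /=.
have B : X a b c + X b c a + X c a b = 0.
  exact: cyclic_entry i (first_bianchi cth wc a b c Vx).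
by apply: (eq_lincomb (eq_scale (E a k * E b l * E c j) B)); ring.
Qed.

Lemma null_curvature_frame x : V x ->
  null_curvature (frame_curv x) (frame2 (frame_mx th x) (form2_at (ext_d A) x)).
Proof.
move=> Vx; split; last by move=> *; exact: frame_curv_bianchi.
  move=> k l; have cc a b := null_conformalP (curv_conformal a b Vx).
  have Z (w : 'I_4 -> 'I_4 -> C) : (forall a b, w a b = 0) -> frame2 (frame_mx th x) w k l = 0.
    move=> w0; rewrite /frame2 big1 // => a _; rewrite big1 // => b _.
    by rewrite w0 !mul0r.
  have Q (w w' : 'I_4 -> 'I_4 -> C) : (forall a b, w a b = w' a b) ->
      frame2 (frame_mx th x) w k l = frame2 (frame_mx th x) w' k l.
    by move=> ww; apply: eq_bigr => a _; apply: eq_bigr => b _; rewrite ww.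
  have S (w w' w'' : 'I_4 -> 'I_4 -> C) : (forall a b, w a b = w' a b - w'' a b) ->
      frame2 (frame_mx th x) w k l = frame2 (frame_mx th x) w' k l - frame2 (frame_mx th x) w'' k l.
    move=> ww; rewrite /frame2 -sumrB; apply: eq_bigr => a _; rewrite -sumrB.
    by apply: eq_bigr => b _; rewrite ww !mulrBl.
  split; [apply: Z|apply: Z|apply: Z|apply: Z|apply: S|apply: S|apply: Q|apply: Q|apply: Q|apply: Q];
    by move=> a b; case: (cc a b).
move=> h j k l; rewrite /frame_curv /frame2 exchange_big -sumrN; apply: eq_bigr => a _.
rewrite -sumrN; apply: eq_bigr => b _.
by rewrite curv_mxN mxE !mulNr -!mulrA [_ b k * _]mulrC.
Qed.

Lemma ricci_null x p q : V x -> ricci g th Gam x p q = o_ricci (frame_curv x) p q.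
Proof.
move=> Vx; rewrite ricciE ?gdown_null ?null_form_unit ?null_form_sym //.
rewrite /ricci_mx summxE /o_ricci /frame_curv /frame2 exchange_big /=.
apply: eq_bigr => a _; rewrite summxE exchange_big /=; apply: eq_bigr => b _.
rewrite !mxE big_ord1 !mxE big_distrl /=; apply: eq_bigr => k _.
by rewrite [_ a k * _]mulrC.
Qed.

Lemma scalar_null x : V x -> scalar_curv g th Gam x = o_scalar (frame_curv x).
Proof.
move=> Vx; rewrite /scalar_curv /o_scalar gup_null //.
by apply: eq_bigr => p _; apply: eq_bigr => q _; rewrite ricci_null.
Qed.

Lemma S_tensor_null x i j : V x -> S_tensor g th Gam x i j = o_S (frame_curv x) i j.
Proof.
move=> Vx.
by rewrite /S_tensor /o_S !ricci_null // scalar_null // gdown_null.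
Qed.

Lemma weyl_tensor_null x i j k l : V x ->
  weyl_tensor g th Gam x i j k l = o_weyl (frame_curv x) i j k l.
Proof.
move=> Vx.
have Rm : riem g th Gam x i j k l = o_riem (frame_curv x) i j k l.
  rewrite riemE /o_riem gdown_null // /frame_curv /frame2.
  under [RHS]eq_bigr => h _ do rewrite big_distrr /=.
  rewrite [RHS]exchange_big /=; apply: eq_bigr => a _.
  under [RHS]eq_bigr => h _ do rewrite big_distrr /=.
  rewrite [RHS]exchange_big /=; apply: eq_bigr => b _.
  by rewrite mxE !big_distrl /=; apply: eq_bigr => h _; rewrite !mulrA.
by rewrite /weyl_tensor /o_weyl Rm scalar_null // !ricci_null // gdown_null.
Qed.

End Connection.
End NullFrame.

(** * The twistor equations in frame components *)

Section NullTwistor.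
Variable R : realType.
Local Notation C := R[i].
Local Notation form k := (tensor R 4 k).
Variables (V : set 'rV[R]_4) (g : form 2) (eta : form 4) (th : 'I_4 -> form 1).
Hypothesis nth : null_cotetrad V g eta th.
Let cth := null_coframe nth.
Variables (A : form 1) (Gam : 'I_4 -> 'I_4 -> form 1).
Hypothesis wc : weyl_connection V g A th Gam.
Variable x : 'rV[R]_4.
Hypothesis Vx : V x.
Local Notation E := (frame_mx th x).
Local Notation o := (frame_curv th Gam x).
Local Notation e i := (form1_at (th i) x).

(** The derivative terms agree by definition. The quadratic terms of the curvature agree with
    [eps /\ beta] because the connection matrices satisfy the relations [null_conformal]. *)
Lemma Theta_curv z' a b : Theta Gam x z' a b =
  - curv_mx Gam a b x iN iM + z' * (curv_mx Gam a b x iP iP - curv_mx Gam a b x iK iK)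
  + z' ^+ 2 * curv_mx Gam a b x iM iN.
Proof.
have [/= a1 a2 a3 a4 a5 a6 a7 a8 a9 a10] := null_conn nth wc a Vx.
have [/= b1 b2 b3 b4 b5 b6 b7 b8 b9 b10] := null_conn nth wc b Vx.
rewrite -!curv_formE /curv_form !sum4E !wedge11E -!/(form2_at _ x a b).
rewrite /Theta /eps /beta.
rewrite a1 a2 a3 a4 a5 a6 a7 a8 a9 a10 b1 b2 b3 b4 b5 b6 b7 b8 b9 b10.
move: (form2_at _ x a b) (form2_at _ x a b) (form2_at _ x a b) (form2_at _ x a b).
move: (form1_at A x a) (form1_at A x b) => *; ring.
Qed.

Lemma frame2_Theta z' k l : frame2 E (Theta Gam x z') k l = o_Theta o z' k l.
Proof.
rewrite /o_Theta /frame_curv /frame2 -!sumrN -!big_split /= !mulr_sumr -!big_split /=.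
apply: eq_bigr => a _; rewrite -!sumrN -!big_split /= !mulr_sumr -!big_split /=.
apply: eq_bigr => b _; rewrite Theta_curv.
by move: (curv_mx Gam a b x) (E a k) (E b l) => W p q; ring.
Qed.

Lemma frame1_coframe i k : frame1 E (e i) k = (i == k)%:R.
Proof.
have /matrixP/(_ i k) := mulmx_coframe_frame cth Vx; rewrite [in RHS]mxE => <-.
by rewrite mxE; apply: eq_bigr => a _; rewrite mxE.
Qed.

Lemma frame_det_neq0 : \det E != 0.
Proof.
have := mulmx_frame_coframe cth Vx => /mulmx1_unit[].
by rewrite unitmxE unitfE.
Qed.

Definition lambda_at z z' a := - e iN a - z * z' * e iK a - z * e iP a - z' * e iM a.
Definition phi_at z a := e iM a + z * e iK a.
Definition phi'_at z' a := e iP a + z' * e iK a.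

Lemma form_LambdaE z z' :
  form1_at (form_Lambda th) (PPcoords x z z') = base_ext (lambda_at z z').
Proof.
apply/funext => c; rewrite /form_Lambda {1}/form1_at /fadd /fmul /fopp.
rewrite -!/(form1_at (pullback _ _) _ c) !pullback_base1 !base_ptE zfunE z'funE.
by rewrite /base_ext /lambda_at; case: (fintype.split c) => // ?; ring.
Qed.

Lemma form_FE z z' : form1_at (form_F th) (PPcoords x z z') = base_ext (phi_at z).
Proof.
apply/funext => c; rewrite /form_F {1}/form1_at /fadd /fmul.
rewrite -!/(form1_at (pullback _ _) _ c) !pullback_base1 !base_ptE zfunE.
by rewrite /base_ext /phi_at; case: (fintype.split c) => // ?; ring.
Qed.

Lemma form_F'E z z' : form1_at (form_F' th) (PPcoords x z z') = base_ext (phi'_at z').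
Proof.
apply/funext => c; rewrite /form_F' {1}/form1_at /fadd /fmul.
rewrite -!/(form1_at (pullback _ _) _ c) !pullback_base1 !base_ptE z'funE.
by rewrite /base_ext /phi'_at; case: (fintype.split c) => // ?; ring.
Qed.

Let dGam i j a b : cderivable (fun x' => form1_at (Gam i j) x' b) x a.
Proof. by case: wc => s _ _; exact: csmooth_derivable (s i j _) Vx. Qed.

Lemma frame_lambda z z' k : frame1 E (lambda_at z z') k =
  - (iN == k)%:R - z * z' * (iK == k)%:R - z * (iP == k)%:R - z' * (iM == k)%:R.
Proof.
by rewrite -!frame1_coframe /frame1 /lambda_at !sum4E; ring.
Qed.

Lemma frame_phi z k : frame1 E (phi_at z) k = (iM == k)%:R + z * (iK == k)%:R.
Proof. by rewrite -!frame1_coframe /frame1 /phi_at !sum4E; ring. Qed.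

Lemma frame_phi' z k : frame1 E (phi'_at z) k = (iP == k)%:R + z * (iK == k)%:R.
Proof. by rewrite -!frame1_coframe /frame1 /phi'_at !sum4E; ring. Qed.

Lemma wedge_frame_eq0 z' (f h : 'I_4 -> C) :
  wedge211 (Theta Gam x z') f h iM iP iN iK = 0 <->
  wedge211 (o_Theta o z') (frame1 E f) (frame1 E h) iM iP iN iK = 0.
Proof.
have -> : o_Theta o z' = frame2 E (Theta Gam x z').
  by apply/funext => k; apply/funext => l; rewrite frame2_Theta.
rewrite wedge211_frame; last by move=> a b; exact: ThetaN.
split=> [->|/eqP]; first by rewrite mulr0.
by rewrite mulf_eq0 (negbTE frame_det_neq0) => /eqP.
Qed.

Lemma twistor_F z z' :
  (forall v, dE'_Lambda_F_E' th Gam (PPcoords x z z') v = 0) <->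
  z ^+ 2 * o_Theta o z' iM iN + z * (o_Theta o z' iN iK - o_Theta o z' iM iP)
     - o_Theta o z' iP iK = 0.
Proof.
apply: iff_trans (twistor_5form_eq0 dGam (form_LambdaE z z') (form_FE z z')) _.
rewrite wedge_frame_eq0.
suff -> : wedge211 (o_Theta o z') (frame1 E (lambda_at z z')) (frame1 E (phi_at z)) iM iP iN iK =
  z ^+ 2 * o_Theta o z' iM iN + z * (o_Theta o z' iN iK - o_Theta o z' iM iP)
     - o_Theta o z' iP iK by [].
by rewrite /wedge211 /wedge21 !frame_lambda !frame_phi; move: (o_Theta o z') => T /=; ring.
Qed.

Lemma twistor_F'_wedge z z' :
  (forall v, dE'_Lambda_F'_E' th Gam (PPcoords x z z') v = 0) <->
  wedge211 (Theta Gam x z') (lambda_at z z') (phi'_at z') iM iP iN iK = 0.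
Proof. exact: (twistor_5form_eq0 dGam (form_LambdaE z z') (form_F'E z z')). Qed.

(** No [z] is left on the right: it enters [lambda_at] only through a multiple of [phi'_at]. *)
Lemma wedge_F'_frame z z' :
  wedge211 (Theta Gam x z') (lambda_at z z') (phi'_at z') iM iP iN iK = 0 <->
  o_Theta o z' iM iK - z' * (o_Theta o z' iM iP + o_Theta o z' iN iK)
     - z' ^+ 2 * o_Theta o z' iP iN = 0.
Proof.
rewrite wedge_frame_eq0.
suff -> : wedge211 (o_Theta o z') (frame1 E (lambda_at z z')) (frame1 E (phi'_at z')) iM iP iN iK =
  o_Theta o z' iM iK - z' * (o_Theta o z' iM iP + o_Theta o z' iN iK)
     - z' ^+ 2 * o_Theta o z' iP iN by [].
by rewrite /wedge211 /wedge21 !frame_lambda !frame_phi'; move: (o_Theta o z') => T /=; ring.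
Qed.

Lemma weyl_tensor_alt i j k l :
  weyl_tensor g th Gam x i j k l = - weyl_tensor g th Gam x i j l k.
Proof.
have riemN : riem g th Gam x i j k l = - riem g th Gam x i j l k.
  rewrite !riemE exchange_big -sumrN; apply: eq_bigr => a _.
  rewrite -sumrN; apply: eq_bigr => b _.
  by rewrite curv_mxN mulmxN mxoppE !mulNr -!mulrA [E b k * _]mulrC.
by rewrite /weyl_tensor riemN; ring.
Qed.

Lemma frame2_wedge i j k l :
  frame2 E (fun a b => (th i /^\ th j)%ff x (pair_idx a b)) k l =
  (i == k)%:R * (j == l)%:R - (i == l)%:R * (j == k)%:R.
Proof.
rewrite [(i == l)%:R * _]mulrC -!frame1_coframe /frame1 /frame2 !mulr_suml -sumrB.
apply: eq_bigr => a _.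
rewrite !mulr_sumr -sumrB; apply: eq_bigr => b _.
by rewrite wedge11E; ring.
Qed.

Lemma frame2_sum (F : 'I_4 -> 'I_4 -> 'I_4 -> C) k l :
  frame2 E (fun a b => \sum_p F p a b) k l = \sum_p frame2 E (F p) k l.
Proof.
rewrite /frame2 [RHS]exchange_big /=; apply: eq_bigr => a _; rewrite [RHS]exchange_big /=.
by apply: eq_bigr => b _; rewrite !mulr_suml.
Qed.

Lemma frame2Z (c : C) (F : 'I_4 -> 'I_4 -> C) k l :
  frame2 E (fun a b => c * F a b) k l = c * frame2 E F k l.
Proof.
rewrite /frame2 mulr_sumr; apply: eq_bigr => a _; rewrite mulr_sumr.
by apply: eq_bigr => b _; rewrite !mulrA.
Qed.

(** The coefficients of the Weyl 2-form in the coframe are its values on frame vectors. The three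
    spanning forms involve neither [M /\ K] nor [P /\ N], and contain [M /\ P] and [N /\ K] with
    opposite signs. *)
Lemma self_dual_2formP i j :
  self_dual_2form th x (weyl_2form g th Gam x i j) <->
  [/\ weyl_tensor g th Gam x i j iM iK = 0, weyl_tensor g th Gam x i j iP iN = 0 &
    weyl_tensor g th Gam x i j iM iP + weyl_tensor g th Gam x i j iN iK = 0].
Proof.
have w0 k : weyl_tensor g th Gam x i j k k = 0.
  have /eqP := weyl_tensor_alt i j k k.
  by rewrite -subr_eq0 opprK -mulr2n mulrn_eq0 => /eqP.
have wN := weyl_tensor_alt i j.
have wR := (wN iP iM, wN iN iM, wN iN iP, wN iK iM, wN iK iP, wN iK iN).
split=> [[c1 [c2 [c3 H]]]|[H1 H2 H3]].
  have D k l : weyl_tensor g th Gam x i j k l =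
      c1 * ((iP == k)%:R * (iK == l)%:R - (iP == l)%:R * (iK == k)%:R)
      + c2 * (((iN == k)%:R * (iK == l)%:R - (iN == l)%:R * (iK == k)%:R)
         - ((iM == k)%:R * (iP == l)%:R - (iM == l)%:R * (iP == k)%:R))
      + c3 * ((iN == k)%:R * (iM == l)%:R - (iN == l)%:R * (iM == k)%:R).
    have L : frame2 E (fun a b => weyl_2form g th Gam x i j (pair_idx a b)) k l =
        weyl_tensor g th Gam x i j k l.
      transitivity (2%:R^-1 * \sum_p \sum_q weyl_tensor g th Gam x i j p q *
          ((p == k)%:R * (q == l)%:R - (p == l)%:R * (q == k)%:R)).
        rewrite /weyl_2form frame2Z frame2_sum; congr (_ * _); apply: eq_bigr => p _.
        rewrite frame2_sum; apply: eq_bigr => q _.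
        by rewrite frame2Z frame2_wedge.
      rewrite !sum4E !wR !w0.
      by move: k l; apply: ord4_ind; apply: ord4_ind; rewrite /= ?wR ?w0; field.
    rewrite -L -!frame2_wedge.
    rewrite (_ : (fun a b => _) = (fun a b => c1 * (th iP /^\ th iK)%ff x (pair_idx a b)
        + c2 * (th iN /^\ th iK - th iM /^\ th iP)%ff x (pair_idx a b)
        + c3 * (th iN /^\ th iM)%ff x (pair_idx a b))); last first.
      by apply/funext => a; apply/funext => b; rewrite H.
    rewrite /frame2 -!sumrN -!big_split /= !mulr_sumr -!big_split /=; apply: eq_bigr => a _.
    rewrite -!sumrN -!big_split /= !mulr_sumr -!big_split /=; apply: eq_bigr => b _.
    by rewrite /fadd /fopp; ring.
  by split; rewrite !D /=; ring.
(* The last coefficient has a minus sign because the spanning form is [N /\ M]. *)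
exists (weyl_tensor g th Gam x i j iP iK), (weyl_tensor g th Gam x i j iN iK),
  (- weyl_tensor g th Gam x i j iM iN) => v.
have H3' : weyl_tensor g th Gam x i j iM iP = - weyl_tensor g th Gam x i j iN iK.
  by apply/eqP; rewrite -addr_eq0 H3.
rewrite (pair_idx_eta v) /weyl_2form !sum4E !wR !w0 H1 H2 H3' /fadd /fopp !wedge11E.
by field.
Qed.

End NullTwistor.

(** * Change of the Weyl form *)

Section WeylShiftAlgebra.
Variables (F : fieldType) (n : nat).
Hypothesis two_neq0 : 2%:R != 0 :> F.
Variables (J J' : 'M[F]_n) (b : 'rV[F]_n).
Hypothesis Js : J^T = J.
Hypothesis J's : J'^T = J'.
Hypothesis JJ' : J *m J' = 1%:M.

(* [C_a = (B_a + theta_a b - b^# theta_a^flat) / 2] is the difference of the Weyl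
   connections with Weyl forms [A + B] and [A], [b] being the frame components of [B]. *)
Definition shift_mx (Ba : F) (t : 'cV[F]_n) : 'M[F]_n :=
  2%:R^-1 *: (Ba%:M + t *m b - J' *m b^T *m (t^T *m J)).

(** The two rank-one terms are adjoint to each other for [J], so their difference is skew and only
    the scalar part survives. *)
Lemma shift_mx_conformal Ba t :
  J *m shift_mx Ba t + (J *m shift_mx Ba t)^T = Ba *: J.
Proof.
rewrite /shift_mx -scalemxAr linearZ /= -scalerDr.
have -> : J *m (Ba%:M + t *m b - J' *m b^T *m (t^T *m J)) =
    Ba *: J + J *m t *m b - (J *m t *m b)^T.
  rewrite mulmxBr mulmxDr mul_mx_scalar !mulmxA JJ' mul1mx.
  by rewrite !trmx_mul Js mulmxA.
have trD (X Y : 'M[F]_n) : (X + Y)^T = X^T + Y^T by apply/matrixP => i j; rewrite !mxE.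
have trN (X : 'M[F]_n) : (- X)^T = - X^T by apply/matrixP => i j; rewrite !mxE.
rewrite !(trD, trN) trmxK linearZ /= Js.
apply/matrixP => i j; rewrite !mxE; move: (\sum_(_ | _) _) (\sum_(_ | _) _) => p q.
by field.
Qed.

(** Because [b] pairs with the coframe columns to give [Ba] and [Bb], the product
    [shift_mx Ba t *m u] is symmetric under exchange of [(Ba, t)] and [(Bb, u)]. *)
Lemma shift_mx_torsion Ba Bb t u : b *m t = Ba%:M -> b *m u = Bb%:M ->
  shift_mx Ba t *m u - shift_mx Bb u *m t = 0.
Proof.
move=> bt bu; rewrite /shift_mx -!scalemxAl -scalerBr.
rewrite !(mulmxBl, mulmxDl) !mul_scalar_mx -!(mulmxA _ b) bt bu !mul_mx_scalar.
rewrite -!(mulmxA (J' *m b^T)).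
have -> : t^T *m J *m u = u^T *m J *m t.
  have : (t^T *m J *m u)^T = t^T *m J *m u by apply/matrixP => i j; rewrite !ord1 mxE.
  by rewrite !trmx_mul trmxK Js mulmxA.
by rewrite [Bb *: t + _]addrC subrr scaler0.
Qed.

Lemma mulmx_addB (Ga Gb S T : 'M[F]_n) (u v : 'cV[F]_n) : S *m u - T *m v = 0 ->
  (Ga + S) *m u - (Gb + T) *m v = Ga *m u - Gb *m v.
Proof. by move=> ST; rewrite !mulmxDl opprD addrACA ST addr0. Qed.

End WeylShiftAlgebra.

Section WeylShift.
Variable R : realType.
Local Notation C := R[i].
Local Notation form k := (tensor R 4 k).
Variables (V : set 'rV[R]_4) (g : form 2) (eta : form 4) (th : 'I_4 -> form 1).
Hypothesis nth : null_cotetrad V g eta th.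
Let cth := null_coframe nth.
Let oV : open V. Proof. by case: cth. Qed.
Local Notation J := (null_form C).
Variables (A B A' : form 1) (Gam : 'I_4 -> 'I_4 -> form 1).
Hypothesis wc : weyl_connection V g A th Gam.
Hypothesis sB : smooth_tensor V B.
Hypothesis A'E : forall x a, form1_at A' x a = form1_at A x a + form1_at B x a.

Definition frame_row (x : 'rV[R]_4) : 'rV[C]_4 := (\row_a form1_at B x a) *m frame_mx th x.

Definition shifted_connection (i j : 'I_4) : form 1 := fun x v =>
  Gam i j x v + shift_mx J (invmx J) (frame_row x) (form1_at B x (v ord0))
    (coframe_col th (v ord0) x) i j.
Local Notation Gam' := shifted_connection.

Lemma conn_mx_shifted a x : conn_mx Gam' a x =
  conn_mx Gam a x + shift_mx J (invmx J) (frame_row x) (form1_at B x a) (coframe_col th a x).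
Proof. by apply/matrixP => i j; rewrite mxE [RHS]mxE [conn_mx _ _ _ _ _]mxE. Qed.

Let sBr : msmooth V (fun x => \row_a form1_at B x a).
Proof. by move=> i a; apply: csmooth_ext_fun (sB (fun=> a)) => x; rewrite mxE. Qed.

Lemma frame_row_smooth : msmooth V frame_row.
Proof. exact: msmoothM oV sBr (frame_smooth cth). Qed.

Lemma frame_row_coframe a x : V x ->
  frame_row x *m coframe_col th a x = (form1_at B x a)%:M.
Proof.
move=> Vx; rewrite /frame_row /coframe_col colE -mulmxA (mulmxA (frame_mx th x)).
rewrite (mulmx_frame_coframe cth Vx) mul1mx -colE.
by apply/matrixP => i j; rewrite !ord1 !mxE mulr1n.
Qed.

Let J's : (invmx J)^T = invmx J.
Proof. by rewrite trmx_inv null_form_sym. Qed.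
Let JJ' : J *m invmx J = 1%:M.
Proof. by rewrite mulmxV // null_form_unit. Qed.
Let n2 : 2%:R != 0 :> C. Proof. by rewrite pnatr_eq0. Qed.

Lemma shifted_smooth a : msmooth V (conn_mx Gam' a).
Proof.
have /weyl_connectionP[s _ _] := wc.
have st := coframe_col_smooth a cth.
have sb := frame_row_smooth.
have sBa : csmooth V (fun x => form1_at B x a) by exact: sB.
have s1 : msmooth V (fun x => (form1_at B x a)%:M : 'M[C]_4).
  apply: msmooth_ext oV _ (msmoothZ oV sBa (msmooth_cst V 1%:M)) => x _.
  by rewrite scalemx1.
have s2 := msmoothM oV st sb.
have s3 := msmoothM oV (msmoothM oV (msmooth_cst V (invmx J)) (msmooth_tr oV sb))
  (msmoothM oV (msmooth_tr oV st) (msmooth_cst V J)).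
have s4 := msmoothZ oV (csmooth_cst V 2%:R^-1)
  (msmoothD oV (msmoothD oV s1 s2) (msmoothN oV s3)).
apply: msmooth_ext oV _ (msmoothD oV (s a) s4) => x _.
by rewrite conn_mx_shifted.
Qed.

Lemma shifted_weyl_connection : weyl_connection V g A' th Gam'.
Proof.
have /weyl_connectionP[s m t] := wc.
apply/weyl_connectionP; split=> [a|a x Vx|a b x Vx]; first exact: shifted_smooth.
  have c1 := conn_conformal nth wc a Vx.
  have c2 := shift_mx_conformal n2 (frame_row x) (null_form_sym C) JJ' (form1_at B x a)
    (coframe_col th a x).
  rewrite (mpartial_gdown_null nth) // (gdown_null nth) // conn_mx_shifted A'E.
  move: c1 c2; move: (shift_mx _ _ _ _ _) (conn_mx Gam a x) => S G c1 c2.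
  rewrite sub0r -opprD; congr (- _).
  rewrite scalerDl -c1 -c2.
  have trD (X Y : 'M[C]_4) : (X + Y)^T = X^T + Y^T by apply/matrixP => i j; rewrite !mxE.
  by rewrite mulmxDr trD addrACA.
rewrite (t a b x Vx) !conn_mx_shifted; congr (- _); apply/esym/mulmx_addB.
by apply: shift_mx_torsion; [exact: null_form_sym|exact: frame_row_coframe|exact: frame_row_coframe].
Qed.

Lemma null_shift_entries (b : 'rV[C]_4) Ba (t : 'cV[C]_4) :
  let S := shift_mx J (invmx J) b Ba t in
  [/\ S iN iM = 2%:R^-1 * (b 0 iM * t iN 0 + b 0 iK * t iP 0),
      S iP iP - S iK iK = 2%:R^-1 * (b 0 iP * t iP 0 - b 0 iM * t iM 0
         - b 0 iK * t iK 0 + b 0 iN * t iN 0) &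
      S iM iN = 2%:R^-1 * (b 0 iN * t iM 0 + b 0 iP * t iK 0)].
Proof.
rewrite /= invmx_null_form /shift_mx.
by split; rewrite !mxE !big_ord1 !mxE !sum4E !mxE /=; field.
Qed.

Lemma null_form_lower (f : 'I_4 -> C) :
  [/\ \sum_k J iM k * f k = 2%:R^-1 * f iP, \sum_k J iP k * f k = 2%:R^-1 * f iM,
      \sum_k J iN k * f k = - 2%:R^-1 * f iK & \sum_k J iK k * f k = - 2%:R^-1 * f iN].
Proof. by split; rewrite sum4E !mxE /=; ring. Qed.

Section ThetaShift.
Variable x : 'rV[R]_4.
Hypothesis Vx : V x.
Local Notation e i := (form1_at (th i)).
Local Notation b j := (frame_row x 0 j).
Local Notation Db j a := (cpartial a (fun y => frame_row y 0 j) x).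
Local Notation G i j := (form1_at (Gam i j)).

(* The frame components of the symmetric part of the change of the Schouten tensor. *)
Definition schouten_shift j a :=
  2%:R^-1 * (Db j a - \sum_k b k * G k j x a)
  - 4%:R^-1 * b j * \sum_k b k * e k x a
  + 2%:R^-1 * (b iM * b iP - b iN * b iK) * \sum_k J j k * e k x a.

(** Derivatives of [frame_row] and terms quadratic in it are collected in [schouten_shift].
    Derivatives of the coframe occur only antisymmetrised, so the torsion equation turns them into
    connection terms, which combine with the cross terms of [eps /\ beta]. *)
Lemma Theta_shift z' a c :
  let al d := - schouten_shift iM d + z' * schouten_shift iN d in
  let ka d := - schouten_shift iK d + z' * schouten_shift iP d in
  let n d := e iN x d + z' * e iM x d in
  let q d := e iP x d + z' * e iK x d in
  Theta Gam' x z' a c = Theta Gam x z' a c + (al a * n c - al c * n a)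
    + (ka a * q c - ka c * q a).
Proof.
move=> al ka n q.
have sb := frame_row_smooth.
have db j d : cderivable (fun y => frame_row y 0 j) x d.
  exact: csmooth_derivable (sb 0 j) Vx.
have de i f d : cderivable (fun y => e i y f) x d.
  by case: cth => _ s _; exact: csmooth_derivable (s i _) Vx.
have dG i j f d : cderivable (fun y => G i j y f) x d.
  by case: wc => s _ _; exact: csmooth_derivable (s i j _) Vx.
have dG' i j f d : cderivable (fun y => form1_at (Gam' i j) y f) x d.
  by case: shifted_weyl_connection => s _ _; exact: csmooth_derivable (s i j _) Vx.
have eE i f y : coframe_col th f y i 0 = e i y f by rewrite !mxE.
have [G31 G2244 G13] :
  [/\ forall y f, form1_at (Gam' iN iM) y f = G iN iM y f
       + 2%:R^-1 * (frame_row y 0 iM * e iN y f + frame_row y 0 iK * e iP y f),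
     forall y f, form1_at (Gam' iP iP) y f - form1_at (Gam' iK iK) y f =
       (G iP iP y f - G iK iK y f)
       + 2%:R^-1 * (frame_row y 0 iP * e iP y f - frame_row y 0 iM * e iM y f
          - frame_row y 0 iK * e iK y f + frame_row y 0 iN * e iN y f) &
     forall y f, form1_at (Gam' iM iN) y f = G iM iN y f
       + 2%:R^-1 * (frame_row y 0 iN * e iM y f + frame_row y 0 iP * e iK y f)].
  split=> y f; have [s1 s2 s3] := null_shift_entries (frame_row y) (form1_at B y f) (coframe_col th f y);
    rewrite !eE in s1 s2 s3; rewrite {1}/form1_at /shifted_connection -/(form1_at _ y f).
  - by rewrite s1.
  - by rewrite {2}/form1_at -/(form1_at _ y f) opprD addrACA s2.
  - by rewrite s3.
(* Only the three entry formulas and differentiability of the shifted connection are kept; its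
   definition is forgotten. *)
move: shifted_connection dG' G31 G2244 G13 => Gam'' dG' G31 G2244 G13.
have tor i : cpartial a (fun y => e i y c) x = cpartial c (fun y => e i y a) x
    - \sum_j (G i j x a * e j x c - G i j x c * e j x a).
  case: wc => _ _ /(_ i x Vx (pair_idx a c)); rewrite ext_d1E => /eqP.
  rewrite subr_eq addrC => /eqP ->; congr (_ - _).
  by apply: eq_bigr => j _; rewrite wedge11E.
have h2 d : cderivable (fun=> 2%:R^-1 : C) x d by exact: cderivable_cst.
have pM j i f d := cpartialM (db j d) (de i f d).
have dM j i f d := cderivableM (db j d) (de i f d).
have dMN j i f d := cderivableN (dM j i f d).
have P31 f d : cpartial d (fun y => form1_at (Gam'' iN iM) y f) x =
    cpartial d (fun y => G iN iM y f) x + 2%:R^-1 *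
    (Db iM d * e iN x f + b iM * cpartial d (fun y => e iN y f) x
     + (Db iK d * e iP x f + b iK * cpartial d (fun y => e iP y f) x)).
  rewrite (cpartial_eq _ _ (fun y => G31 y f)).
  have d1 := cderivableD (dM iM iN f d) (dM iK iP f d).
  rewrite (cpartialD (dG iN iM f d) (cderivableM (h2 d) d1)) (cpartialM (h2 d) d1).
  by rewrite cpartial_cst mul0r add0r (cpartialD (dM _ _ _ _) (dM _ _ _ _)) !pM.
have P13 f d : cpartial d (fun y => form1_at (Gam'' iM iN) y f) x =
    cpartial d (fun y => G iM iN y f) x + 2%:R^-1 *
    (Db iN d * e iM x f + b iN * cpartial d (fun y => e iM y f) x
     + (Db iP d * e iK x f + b iP * cpartial d (fun y => e iK y f) x)).
  rewrite (cpartial_eq _ _ (fun y => G13 y f)).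
  have d1 := cderivableD (dM iN iM f d) (dM iP iK f d).
  rewrite (cpartialD (dG iM iN f d) (cderivableM (h2 d) d1)) (cpartialM (h2 d) d1).
  by rewrite cpartial_cst mul0r add0r (cpartialD (dM _ _ _ _) (dM _ _ _ _)) !pM.
have P2244 f d : cpartial d (fun y => form1_at (Gam'' iP iP) y f) x
      - cpartial d (fun y => form1_at (Gam'' iK iK) y f) x =
    cpartial d (fun y => G iP iP y f) x - cpartial d (fun y => G iK iK y f) x + 2%:R^-1 *
    (Db iP d * e iP x f + b iP * cpartial d (fun y => e iP y f) x
     - (Db iM d * e iM x f + b iM * cpartial d (fun y => e iM y f) x)
     - (Db iK d * e iK x f + b iK * cpartial d (fun y => e iK y f) x)
     + (Db iN d * e iN x f + b iN * cpartial d (fun y => e iN y f) x)).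
  rewrite -(cpartialN (dG' iK iK f d)).
  rewrite -(cpartialD (dG' iP iP f d) (cderivableN (dG' iK iK f d))).
  rewrite (cpartial_eq _ _ (fun y => G2244 y f)).
  have d1 := cderivableD (dM iP iP f d) (dMN iM iM f d).
  have d2 := cderivableD d1 (dMN iK iK f d).
  have d3 := cderivableD d2 (dM iN iN f d).
  have d4 := cderivableD (dG iP iP f d) (cderivableN (dG iK iK f d)).
  rewrite (cpartialD d4 (cderivableM (h2 d) d3)) (cpartialM (h2 d) d3).
  rewrite cpartial_cst mul0r add0r (cpartialD d2 (dM _ _ _ _)) (cpartialD d1 (dMN _ _ _ _)).
  rewrite (cpartialD (dM _ _ _ _) (dMN _ _ _ _)) !(cpartialN (dM _ _ _ _)) !pM.
  by rewrite (cpartialD (dG _ _ _ _) (cderivableN (dG _ _ _ _))) (cpartialN (dG _ _ _ _)).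
have JE d := null_form_lower (fun i => e i x d).
have dd (p q' r s : C) : p - q' - (r - s) = (p - r) - (q' - s) by ring.
have na := null_conn nth wc a Vx; have nc := null_conn nth wc c Vx.
have [JM JP JN JK] := all_and4 JE.
have rules := (ncPM na, ncMP na, ncKN na, ncNK na, ncMM na, ncNN na, ncPN na, ncPK na,
  ncKP na, ncMK na).
have rulesc := (ncPM nc, ncMP nc, ncKN nc, ncNK nc, ncMM nc, ncNN nc, ncPN nc, ncPK nc,
  ncKP nc, ncMK nc).
rewrite /al /ka /n /q /schouten_shift JM JP JN JK JM JP JN JK.
rewrite /Theta /eps /beta /form2_at !ext_d1E.
rewrite (dd (cpartial a (fun y => form1_at (Gam'' iP iP) y c) x)).
rewrite (dd (cpartial a (fun y => G iP iP y c) x)).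
rewrite (P2244 c a) (P2244 a c).
rewrite !P31 !P13.
rewrite !G31 !G13 !G2244.
rewrite !tor.
rewrite !sum4E.
rewrite !(rules, rulesc).
move: (form1_at A x a) (form1_at A x c) => Aa Ac.
(* The identity is polynomial in these quantities; [field] is slow unless they are variables. *)
move: (cpartial a (fun y => frame_row y 0 iM) x) (cpartial a (fun y => frame_row y 0 iP) x)
  (cpartial a (fun y => frame_row y 0 iN) x) (cpartial a (fun y => frame_row y 0 iK) x)
  (cpartial c (fun y => frame_row y 0 iM) x) (cpartial c (fun y => frame_row y 0 iP) x)
  (cpartial c (fun y => frame_row y 0 iN) x) (cpartial c (fun y => frame_row y 0 iK) x)
  (cpartial c (fun y => e iM y a) x) (cpartial c (fun y => e iP y a) x)
  (cpartial c (fun y => e iN y a) x) (cpartial c (fun y => e iK y a) x)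
  (cpartial a (fun y => G iN iM y c) x) (cpartial a (fun y => G iP iP y c) x)
  (cpartial a (fun y => G iK iK y c) x) (cpartial a (fun y => G iM iN y c) x)
  (cpartial c (fun y => G iN iM y a) x) (cpartial c (fun y => G iP iP y a) x)
  (cpartial c (fun y => G iK iK y a) x) (cpartial c (fun y => G iM iN y a) x) (b iM) (b iP)
  (b iN) (b iK) (e iM x a) (e iP x a) (e iN x a) (e iK x a) (G iN iM x a) (G iM iN x a)
  (G iK iM x a) (G iN iP x a) (G iP iP x a) (G iK iK x a) (e iM x c) (e iP x c) (e iN x c)
  (e iK x c) (G iN iM x c) (G iM iN x c) (G iK iM x c) (G iN iP x c) (G iP iP x c) (G iK iK x c) => *.
by field.
Qed.

Lemma wedge_shift z z' :
  wedge211 (Theta Gam' x z') (lambda_at th x z z') (phi'_at th x z') iM iP iN iK =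
  wedge211 (Theta Gam x z') (lambda_at th x z z') (phi'_at th x z') iM iP iN iK.
Proof.
rewrite /wedge211 /wedge21 !Theta_shift /lambda_at /phi'_at.
move: (schouten_shift iM) (schouten_shift iP) (schouten_shift iN) (schouten_shift iK).
move: (Theta Gam x z') => T s1 s2 s3 s4 /=.
by ring.
Qed.

End ThetaShift.

End WeylShift.

(** * The two equations *)

Section Local.
Variable R : realType.
Local Notation C := R[i].
Local Notation form k := (tensor R 4 k).
Variables (V : set 'rV[R]_4) (g : form 2) (eta : form 4) (th : 'I_4 -> form 1).
Hypothesis nth : null_cotetrad V g eta th.

Lemma einstein_weyl_frame (A : form 1) Gam x : smooth_tensor V A ->
  weyl_connection V g A th Gam -> V x ->
  (forall z z' v, dE'_Lambda_F_E' th Gam (PPcoords x z z') v = 0) <->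
  (forall i j, S_tensor g th Gam x i j = 0).
Proof.
move=> sA wc Vx; have ew := einstein_weyl_null (null_curvature_frame nth wc sA Vx).
split=> [H i j|H z z'].
  rewrite (S_tensor_null nth _ _ _ Vx); move: i j; apply/ew => z z'.
  exact/(twistor_F nth wc Vx).
apply/(twistor_F nth wc Vx); move: z z'; apply/ew => i j.
by rewrite -(S_tensor_null nth _ _ _ Vx).
Qed.

Lemma self_dual_frame Gam x : levi_civita V g th Gam -> V x ->
  (forall z z', wedge211 (Theta Gam x z') (lambda_at th x z z') (phi'_at th x z') iM iP iN iK = 0)
  <-> (forall i j, self_dual_2form th x (weyl_2form g th Gam x i j)).
Proof.
move=> lc Vx.
have s0 : smooth_tensor V ((fun _ _ => 0) : form 1) by move=> v; exact: csmooth_cst.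
have F0 k l : frame2 (frame_mx th x) (form2_at (ext_d ((fun _ _ => 0) : form 1)) x) k l = 0.
  rewrite /frame2 big1 // => a _; rewrite big1 // => b _.
  by rewrite /form2_at ext_d1E !cpartial_cst subrr !mul0r.
have sd := self_dual_null (null_curvature_frame nth lc s0 Vx) F0.
split=> [H i j|H z z'].
  apply/(self_dual_2formP nth _ Vx); rewrite !(weyl_tensor_null nth _ _ _ _ _ Vx).
  (* Any value of [z] would serve, since the frame equation does not contain it; 0 is taken. *)
  move: i j; apply/sd => z'; exact/(wedge_F'_frame nth lc Vx 0).
apply/(wedge_F'_frame nth lc Vx); move: z'; apply/sd => i j.
by rewrite -!(weyl_tensor_null nth _ _ _ _ _ Vx); apply/(self_dual_2formP nth _ Vx).
Qed.

End Local.

Section Global.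
Variables (R : realType) (X : oriented_manifold R 4) (W : weyl_geometry X).
Variable eta : chart X -> tensor R 4 4.
Hypothesis Heta : volume_form W eta.
Local Notation C := R[i].

(** A cotetrad with finite [z], [z'] spans its own pair of planes, so quantifying over points of the
    bundle amounts to quantifying over cotetrads and coordinates. *)
Lemma vanishes_on_PPE Psi : vanishes_on_PP W eta Psi <->
  forall a V th Gam, null_cotetrad_on W eta a V th ->
    weyl_connection V (metric W a) (weyl_form W a) th Gam ->
    forall x, V x -> forall z z' v, Psi th Gam (PPcoords x z z') v = 0.
Proof.
split=> [H a V th Gam nth wc x Vx z z'|H a x s s' _ V th Gam z z' nth Vx wc _ _]; last first.
  exact: H nth wc x Vx z z'.
apply: (H a x (sd_plane th x (Some z)) (asd_plane th x (Some z')) _ V th) => //;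
  try exact/eqmxP.
by exists V, th, (Some z), (Some z'); split => //; exact/eqmxP.
Qed.

(** One side speaks of Weyl connections, the other of Levi-Civita ones. Each direction constructs
    the connection required by its hypothesis from the given one, and [wedge_shift] compares the
    two. *)
Lemma vanishes_self_dual : vanishes_on_PP W eta (@dE'_Lambda_F'_E' R) <-> self_dual W eta.
Proof.
have sA a V : V `<=` chart_img a -> smooth_tensor V (weyl_form W a).
  by move=> Va v; exact: csmooth_sub Va ((weyl_form_field W).1 a v).
rewrite vanishes_on_PPE; split=> H a V th Gam [Va nth] wc x Vx.
  apply/(self_dual_frame nth wc Vx) => z z'.
  (* From Levi-Civita to Weyl: shift from the zero 1-form by [weyl_form]. *)
  have A'E y b : form1_at (weyl_form W a) y b = form1_at (fun _ _ => 0) y b + form1_at (weyl_form W a) y b.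
    by rewrite add0r.
  rewrite -(wedge_shift nth wc (sA a V Va) A'E Vx).
  have wc' := shifted_weyl_connection nth wc (sA a V Va) A'E.
  apply/(twistor_F'_wedge wc' Vx) => v; exact: H wc' x Vx z z' v.
move=> z z'; apply/(twistor_F'_wedge wc Vx).
(* From Weyl to Levi-Civita: shift by the opposite of [weyl_form]. *)
have sB : smooth_tensor V (fopp (weyl_form W a)).
  by move=> v; have [oV _ _] := null_coframe nth; exact: csmoothN oV (sA a V Va v).
have A'E y b : form1_at (fun _ _ => 0) y b = form1_at (weyl_form W a) y b + form1_at (fopp (weyl_form W a)) y b.
  by rewrite /form1_at /fopp subrr.
rewrite -(wedge_shift nth wc sB A'E Vx); move: z z'.
have lc := shifted_weyl_connection nth wc sB A'E.
by apply/(self_dual_frame nth lc Vx); apply: H lc x Vx.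
Qed.

Lemma vanishes_einstein_weyl : vanishes_on_PP W eta (@dE'_Lambda_F_E' R) <-> einstein_weyl W.
Proof.
have sA a V : V `<=` chart_img a -> smooth_tensor V (weyl_form W a).
  by move=> Va v; exact: csmooth_sub Va ((weyl_form_field W).1 a v).
rewrite vanishes_on_PPE; split=> H a V th Gam; last first.
  move=> [Va nth] wc x Vx; apply/(einstein_weyl_frame nth (sA a V Va) wc Vx).
  by apply: H wc x Vx; split=> //; exact: null_coframe nth.
move=> [Va cth] wc x Vx; have [oV _ _] := cth; have [[sE _] aE E2] := Heta.
have sg : msmooth V (tensor2_mx (metric W a)).
  move=> i j; apply: csmooth_ext_fun (csmooth_sub Va ((metric_field W).1 a (pair_idx i j))) => y.
  by rewrite mxE.
have gs y : V y -> (tensor2_mx (metric W a) y)^T = tensor2_mx (metric W a) y.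
  by move=> Vy; exact: metric_sym (Va y Vy).
have gd y : V y -> \det (tensor2_mx (metric W a) y) != 0.
  by move=> Vy; exact: metric_nondeg (Va y Vy).
(* The coframe is arbitrary here, while the twistor equation is known only in null cotetrads: one is
   chosen near [x], the connection is transported to it, and the vanishing of [S] is carried
   back. *)
have [V' [th' [V'V V'x nth']]] : exists V' th',
    [/\ V' `<=` V, V' x & null_cotetrad V' (metric W a) (eta a) th'].
  apply: exists_null_cotetrad oV Vx sg gs gd _ _ _ => [v|y Vy|y Vy].
  - exact: csmooth_sub Va (sE a v).
  - exact: aE (Va y Vy).
  - exact: E2 (Va y Vy).
have cth' := null_coframe nth'.
have wc' := changed_weyl_connection cth cth' V'V sg gs wc.
have V'a : V' `<=` chart_img a by move=> y /V'V /Va.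
apply: (S_tensor_change (mulmx_change cth cth' V'V V'x) (frame_mx_change _ cth V'V V'x)).
- have := gd x Vx; have : frame_mx th x \in unitmx by rewrite unitmx_inv (coframe_unit cth Vx).
  rewrite /gdown; move: (frame_mx th x) (tensor2_mx _ x) => E G uE.
  by rewrite -unitfE -unitmxE !unitmx_mul unitmx_tr uE => ->.
- exact: (gdown_sym _ gs).
- by move=> b c; apply: (mul_change_curv cth cth' V'V wc).
apply/(einstein_weyl_frame nth' (sA a V' V'a) wc' V'x).
by apply: (H a V' th' _ _ wc').
Qed.

End Global.

Theorem theorem6p2 (R : realType) (X : oriented_manifold R 4)
    (W : weyl_geometry X) (eta : chart X -> tensor R 4 4)
    (Heta : volume_form W eta) :
  (vanishes_on_PP W eta (@dE'_Lambda_F'_E' R) <-> self_dual W eta) /\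
  (vanishes_on_PP W eta (@dE'_Lambda_F_E' R) <-> einstein_weyl W).
Proof.
by split; [exact: vanishes_self_dual|exact: vanishes_einstein_weyl].
Qed.
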